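(* Let $\Gamma$ be a group and let $r,r':\Gamma\to N$ be two group morphisms with values in ${\rm SU}(4)=N^0$ which are element conjugate in $N$ but not $N$-conjugate. Then there exists a group morphism $f:\Gamma\to\mathcal{G}$ such that, up to replacing $r$ and $r'$ by some $N$-conjugates if necessary, we have: (i) $r=\rho\circ f$, (ii) $r'=\eta\, r$ with $\eta:=\upsilon\circ f$, and (iii) $\eta$ and ${\rm d}\circ f$ are distinct, order $2$, characters of $\Gamma$.
   Context: Two morphisms $r,r':\Gamma\to G$ are element conjugate in $G$ if $r(\gamma)$ and $r'(\gamma)$ are conjugate in $G$ for every $\gamma\in\Gamma$; they are $G$-conjugate if there is $g\in G$ with $r'(\gamma)=g\,r(\gamma)\,g^{-1}$ for all $\gamma\in\Gamma$. The group $N$. Let $\pi:{\rm Spin}(7)\to{\rm SO}(7)$ be the canonical double cover (compact groups). Fix an orthogonal decomposition $\mathbb{R}^7=L\perp F$ with $L$ a line, and let $N\subset{\rm Spin}(7)$ be the inverse image under $\pi$ of the stabilizer of $L$ in ${\rm SO}(7)$. The identity component $N^0$ of $N$ (the subgroup acting with determinant $1$ on $F$) has index $2$, is isomorphic to ${\rm Spin}(6)$ and is identified with ${\rm SU}(4)$ via a fixed unitary half-spin representation. The central element $-1\in{\rm Spin}(7)$ lies in $N^0$, so a $\{\pm1\}$-valued character of $\Gamma$ can be multiplied with an $N$-valued morphism. The group $\mathcal{G}$. Equip $\mathbb{C}^2$ with the quadratic form $q(x,y)=x^2+y^2$. Let ${\rm GO}_2(\mathbb{C})$ be its group of similitudes,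 $\mu:{\rm GO}_2(\mathbb{C})\to\mathbb{C}^\times$ the similitude factor ($q(gv)=\mu(g)q(v)$), and $\epsilon:{\rm GO}_2(\mathbb{C})\to\{\pm1\}$ the signature of the permutation action on the two isotropic lines of $q$. Let ${\rm O}(2)^{\pm}$ be the subgroup of elements $g$ with $\mu(g)=\pm1$ in the maximal compact subgroup ${\rm GO}(2)$ of ${\rm GO}_2(\mathbb{C})$; it is generated by the real orthogonal group ${\rm O}(2)$ and $i\cdot 1_2$. Let $\mathcal{G}$ be the group of $(g_1,g_2)\in{\rm O}(2)^{\pm}\times{\rm O}(2)^{\pm}$ with $\det g_1=\det g_2$ and $\mu(g_2)=\epsilon(g_1)$. Let $\rho:\mathcal{G}\to{\rm SU}(4)=N^0\subset N$ be the block-diagonal embedding $(g_1,g_2)\mapsto{\rm diag}(g_1,g_2)$. Define characters $\upsilon,{\rm d}:\mathcal{G}\to\{\pm1\}$ by $\upsilon(g_1,g_2)=\epsilon(g_1)=\mu(g_2)$ and ${\rm d}(g_1,g_2)=\det g_1=\det g_2$. *)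

(* Defs.v *)
From HB Require Import structures.
From mathcomp Require Import all_boot all_order all_fingroup all_algebra all_field.
From mathcomp Require Import spectral ring.
From mathcomp Require Import reals.
From mathcomp.real_closed Require Import complex.

Set Implicit Arguments.
Unset Strict Implicit.
Unset Printing Implicit Defensive.
Import Order.TTheory GRing.Theory Num.Theory.
Local Open Scope ring_scope.

(* The Clifford algebra Cl_n of (K^n, -(x_1^2 + ... + x_n^2)), in the basis
   e_A = e_(a_1) ... e_(a_k), for A = {a_1 < ... < a_k} a subset of 'I_n.
   One has e_i^2 = -1 and e_i e_j = - e_j e_i for i != j, so that
   e_A e_B = (-1)^m e_(A symdiff B), with m the number of pairs (a, b) in
   A x B such that b <= a. *)

Section Clifford.

Variables (K : fieldType) (n : nat).

Definition clifford : Type := {ffun {set 'I_n} -> K^o}.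

Definition symdiff (A B : {set 'I_n}) : {set 'I_n} :=
  [set i | (i \in A) (+) (i \in B)].

Definition clifford_sign (A B : {set 'I_n}) : K :=
  \prod_(a in A) \prod_(b in B | (b <= a)%N) (-1).

Definition clifford_one : clifford := [ffun A => (A == set0)%:R].

Definition clifford_mul (x y : clifford) : clifford :=
  [ffun C : {set 'I_n} =>
     \sum_(A : {set 'I_n})
       clifford_sign A (symdiff A C) * (x A * y (symdiff A C))].

Lemma symdiffA A B C : symdiff A (symdiff B C) = symdiff (symdiff A B) C.
Proof. by apply/setP=> i; rewrite !inE addbA. Qed.

Lemma symdiffC A B : symdiff A B = symdiff B A.
Proof. by apply/setP=> i; rewrite !inE addbC. Qed.

Lemma symdiffK A B : symdiff A (symdiff A B) = B.
Proof. by apply/setP=> i; rewrite !inE addKb. Qed.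

Lemma symdiff0 A : symdiff A set0 = A.
Proof. by apply/setP=> i; rewrite !inE addbF. Qed.

Lemma symdiffv A : symdiff A A = set0.
Proof. by apply/setP=> i; rewrite !inE addbb. Qed.

Lemma prod_symdiff (A B : {set 'I_n}) (P : pred 'I_n) (f : 'I_n -> K) :
    (forall i, f i * f i = 1) ->
  \prod_(i in symdiff A B | P i) f i
    = (\prod_(i in A | P i) f i) * \prod_(i in B | P i) f i.
Proof.
move=> ff1; rewrite [LHS]big_mkcond [X in X * _]big_mkcond.
rewrite [X in _ * X]big_mkcond -big_split /=; apply: eq_bigr => i _.
by rewrite inE; case: (i \in A); case: (i \in B); case: (P i);
  rewrite /= ?mulr1 ?mul1r ?ff1.
Qed.

Lemma clifford_sign_symdiffr A B C :
  clifford_sign A (symdiff B C) = clifford_sign A B * clifford_sign A C.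
Proof.
rewrite /clifford_sign -big_split /=; apply: eq_bigr => a _.
by apply: prod_symdiff => i; rewrite mulrNN mulr1.
Qed.

Lemma clifford_sign_symdiffl A B C :
  clifford_sign (symdiff A B) C = clifford_sign A C * clifford_sign B C.
Proof.
have := @prod_symdiff A B predT
  (fun a => \prod_(b in C | (b <= a)%N) (-1 : K)).
rewrite /clifford_sign !(eq_bigl _ _ (fun i => andbT _)); apply=> i.
by rewrite -big_split /= big1 // => j _; rewrite mulrNN mulr1.
Qed.

Lemma clifford_sign0l A : clifford_sign set0 A = 1.
Proof. by rewrite /clifford_sign big1 // => i; rewrite inE. Qed.

Lemma clifford_sign0r A : clifford_sign A set0 = 1.
Proof. by rewrite /clifford_sign big1 // => i _; rewrite big1 // => j; rewrite inE. Qed.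

HB.instance Definition _ := Vector.copy clifford {ffun {set 'I_n} -> K^o}.

Fact clifford_mulA : associative clifford_mul.
Proof.
move=> x y z; apply/ffunP=> D; rewrite !ffunE.
under eq_bigr => B _.
  rewrite ffunE !mulr_sumr.
  rewrite (reindex_inj (can_inj (symdiffK B))) /=.
  over.
rewrite exchange_big /=; apply: eq_bigr => A _.
rewrite ffunE mulr_suml mulr_sumr; apply: eq_bigr => B _.
have -> : symdiff (symdiff B A) (symdiff B D) = symdiff A D.
  by rewrite symdiffA (symdiffC (symdiff B A)) symdiffK.
have -> : symdiff B D = symdiff (symdiff B A) (symdiff A D).
  by rewrite -symdiffA symdiffK.
set E := symdiff B A; set G := symdiff A D.
have -> : A = symdiff B E by rewrite symdiffK.
rewrite clifford_sign_symdiffr clifford_sign_symdiffl.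
have aux (p q r a b c : K) :
  p * q * (a * (r * (b * c))) = q * r * (p * (a * b) * c) by ring.
exact: aux.
Qed.

Fact clifford_mul1l : left_id clifford_one clifford_mul.
Proof.
move=> x; apply/ffunP=> C; rewrite ffunE (bigD1 set0) //= big1 => [|A A0].
  by rewrite ffunE eqxx clifford_sign0l symdiffC symdiff0 addr0 !mul1r.
by rewrite ffunE (negPf A0) mul0r mulr0.
Qed.

Fact clifford_mul1r : right_id clifford_one clifford_mul.
Proof.
move=> x; apply/ffunP=> C; rewrite ffunE (bigD1 C) //= big1 => [|A AC].
  by rewrite ffunE symdiffv eqxx clifford_sign0r addr0 mul1r mulr1.
rewrite ffunE; case: eqP => [e|_]; last by rewrite !mulr0.
by case/eqP: AC; rewrite -(symdiff0 A) -e symdiffK.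
Qed.

Fact clifford_mulDl : left_distributive clifford_mul +%R.
Proof.
move=> x y z; apply/ffunP=> C; rewrite !ffunE -big_split /=.
by apply: eq_bigr => A _; rewrite ffunE mulrDl mulrDr.
Qed.

Fact clifford_mulDr : right_distributive clifford_mul +%R.
Proof.
move=> x y z; apply/ffunP=> C; rewrite !ffunE -big_split /=.
by apply: eq_bigr => A _; rewrite ffunE mulrDr mulrDr.
Qed.

Fact clifford_one_neq0 : clifford_one != 0.
Proof.
by apply/eqP => /ffunP/(_ set0)/eqP; rewrite !ffunE eqxx oner_eq0.
Qed.

HB.instance Definition _ := GRing.Zmodule_isNzRing.Build clifford
  clifford_mulA clifford_mul1l clifford_mul1r clifford_mulDl clifford_mulDr
  clifford_one_neq0.

Fact clifford_scaleAl (a : K) (x y : clifford) : a *: (x * y) = a *: x * y.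
Proof.
apply/ffunP=> C; rewrite !ffunE scaler_sumr; apply: eq_bigr => A _.
have aux (s b c : K) : a * (s * (b * c)) = s * (a * b * c) by ring.
by rewrite ffunE; exact: aux.
Qed.

HB.instance Definition _ :=
  GRing.Lmodule_isLalgebra.Build K clifford clifford_scaleAl.

Fact clifford_scaleAr (a : K) (x y : clifford) : a *: (x * y) = x * (a *: y).
Proof.
apply/ffunP=> C; rewrite !ffunE scaler_sumr; apply: eq_bigr => A _.
have aux (s b c : K) : a * (s * (b * c)) = s * (b * (a * c)) by ring.
by rewrite ffunE; exact: aux.
Qed.

HB.instance Definition _ :=
  GRing.Lalgebra_isAlgebra.Build K clifford clifford_scaleAr.
HB.instance Definition _ := Algebra_isFalgebra.Build K clifford.

Definition clifford_vec (v : 'rV[K]_n) : clifford :=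
  [ffun A : {set 'I_n} => \sum_i (if A == [set i] then v 0 i else 0)].

Definition sqnorm (v : 'rV[K]_n) : K := \sum_i v 0 i ^+ 2.

Lemma clifford_sign11 (i j : 'I_n) :
  clifford_sign [set i] [set j] = if (j <= i)%N then -1 else 1.
Proof. by rewrite /clifford_sign big_set1 big_mkcondr big_set1. Qed.

Lemma clifford_vecM (u v : 'rV[K]_n) (C : {set 'I_n}) :
  (clifford_vec u * clifford_vec v : clifford) C =
  \sum_i \sum_j (if C == symdiff [set i] [set j]
                 then (if (j <= i)%N then -1 else 1) * (u 0 i * v 0 j) else 0).
Proof.
rewrite ffunE.
under eq_bigr => A _ do rewrite ffunE mulr_suml mulr_sumr.
rewrite exchange_big /=; apply: eq_bigr => i _.
rewrite (bigD1 [set i]) //= eqxx big1 => [|A /negPf->]; last first.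
  have e0 (a b : K) : a * (0 * b) = 0 by rewrite mul0r mulr0.
  exact: e0.
rewrite addr0 ffunE mulr_sumr mulr_sumr; apply: eq_bigr => j _.
have -> : (symdiff [set i] C == [set j]) = (C == symdiff [set i] [set j]).
  by apply/eqP/eqP => [<-|->]; rewrite symdiffK.
case: eqP => [->|_]; last by rewrite mulr0 mulr0.
by rewrite symdiffK clifford_sign11.
Qed.

Lemma clifford_vec_sqr (v : 'rV[K]_n) :
  clifford_vec v * clifford_vec v = (- sqnorm v) *: (1 : clifford).
Proof.
apply/ffunP=> C; rewrite clifford_vecM !ffunE.
pose F (i j : 'I_n) : K := if C == symdiff [set i] [set j]
  then (if (j <= i)%N then -1 else 1) * (v 0 i * v 0 j) else 0.
have FN (i j : 'I_n) : (i < j)%N -> F i j = - F j i.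
  move=> ij; rewrite /F symdiffC leqNgt ij ltnW //=.
  by case: eqP; rewrite ?oppr0 // mul1r mulN1r opprK mulrC.
transitivity (\sum_i F i i + (\sum_(i : 'I_n) \sum_(j : 'I_n | (i < j)%N) F i j
              + \sum_(i : 'I_n) \sum_(j : 'I_n | (j < i)%N) F i j)).
  rewrite -!big_split /=; apply: eq_bigr => i _.
  rewrite (bigD1 i) //= (bigID (fun j : 'I_n => (i < j)%N)) /=.
  by do 2 congr (_ + _); apply: eq_bigl => j; rewrite -(inj_eq val_inj) /=;
    case: ltngtP.
have -> : \sum_(i : 'I_n) \sum_(j : 'I_n | (i < j)%N) F i j
          + \sum_(i : 'I_n) \sum_(j : 'I_n | (j < i)%N) F i j = 0.
  rewrite addrC (exchange_big_dep xpredT) //= -big_split big1 //= => i _.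
  by rewrite -big_split big1 //= => j ij; rewrite (FN _ _ ij) subrr.
rewrite addr0.
transitivity (- \sum_i (C == set0)%:R * v 0 i ^+ 2).
  rewrite -sumrN; apply: eq_bigr => i _; rewrite /F leqnn symdiffv.
  by case: eqP => _; rewrite ?mulN1r ?mul1r ?mul0r ?oppr0.
by rewrite -mulr_sumr -mulrN mulrC.
Qed.

End Clifford.

Section SpinGroup.

Variables (R : realType) (n : nat).

Definition spin (x : clifford R n) : Prop :=
  exists s : seq 'rV[R]_n,
    [/\ ~~ odd (size s), all (fun v => sqnorm v == 1) s
      & x = \prod_(v <- s) clifford_vec v].

(* The covering map Spin(n) -> SO(n), v |-> x v x^-1, as a matrix acting on
   row vectors: clifford_vec (v *m spin_action x)
   = x * clifford_vec v * x^-1 for x in Spin(n). *)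
Definition spin_action (x : clifford R n) : 'M[R]_n :=
  \matrix_(i, j) (x * clifford_vec (delta_mx 0 i) * x^-1) [set j].

(* Subspaces of R^n are row spaces of matrices. *)
Definition line_decomposition (L F : 'M[R]_n) : Prop :=
  [/\ \rank L = 1%N, L *m F^T = 0 & row_full (L + F)%MS].

Definition spinN (L : 'M[R]_n) (x : clifford R n) : Prop :=
  spin x /\ stablemx L (spin_action x).

Definition spinN0 (L F : 'M[R]_n) (x : clifford R n) : Prop :=
  spinN L x /\ \det (restrictmx F (spin_action x)) = 1.

(* The even Clifford algebra of F: the subalgebra generated by the products
   of two vectors of F. *)
Definition even_clifford (F : 'M[R]_n) : {vspace clifford R n} :=
  agenv <<[seq (clifford_vec (row i F) * clifford_vec (row j F))%R
             | i <- enum 'I_n, j <- enum 'I_n]>>%VS.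

End SpinGroup.

(* A half-spin representation of Spin(F) = N^0 (dim F = 6) is the restriction
   of an irreducible complex representation h, of dimension 4, of the even
   Clifford algebra of F; there are two of them, up to isomorphism.  Only the
   values of h on even_clifford F matter.  Matrices act on column vectors, so
   that a subspace of C^4, seen as a row space, is acted upon by (h x)^T.
   Unitarity forces h to restrict to an isomorphism from N^0 onto SU(4), which
   is the identification SU(4) = N^0: for x in N^0 and M in SU(4), "x = M"
   means h x = M. *)
Record unitary_half_spin (R : realType) (L F : 'M[R]_7)
    (h : clifford R 7 -> 'M[R[i]]_4) : Prop := UnitaryHalfSpin {
  half_spin_linear : forall a : R, {in even_clifford F &, forall x y,
    h (a *: x + y) = real_complex R a *: h x + h y};
  half_spin_one : h 1 = 1;
  half_spin_mul : {in even_clifford F &, {morph h : x y / x * y}};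
  half_spin_irr : forall U : 'M[R[i]]_4,
    (forall x, x \in even_clifford F -> stablemx U (h x)^T) ->
    \rank U = 0%N \/ \rank U = 4%N;
  half_spin_unitary : forall x, spinN0 L F x -> h x \is unitarymx
}.

Section Similitudes.

Variable R : realType.
Let C := R[i].

Definition quad (v : 'cV[C]_2) : C := v 0 0 ^+ 2 + v 1 0 ^+ 2.

Definition GO2C (g : 'M[C]_2) : Prop :=
  g \in unitmx /\ exists m : C, forall v, quad (g *m v) = m * quad v.

(* For g in GO_2(C), the unique m as above, since quad e_0 = 1. *)
Definition simil (g : 'M[C]_2) : C := quad (g *m delta_mx 0 0).

(* x^2 + y^2 = (x + i y) (x - i y): the isotropic lines are spanned by (1, i)
   and (1, -i).  They are seen as row spaces, on which g acts as g^T. *)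
Definition isotropic_line (k : 'I_2) : 'rV[C]_2 :=
  \row_j (if j == 0 then 1 else (-1) ^+ k * Complex 0 1).

(* The pick always succeeds, and is unambiguous, for g in GO_2(C). *)
Definition simil_sign (g : 'M[C]_2) : C :=
  if [pick s : {perm 'I_2} |
        [forall k, (isotropic_line k *m g^T == isotropic_line (s k))%MS]]
    is Some s then (-1) ^+ s else 1.

(* The maximal compact subgroup GO(2) = GO_2(C) :&: U(2), containing the real
   orthogonal group O(2) and the scalars of modulus 1. *)
Definition GO2 (g : 'M[C]_2) : Prop := GO2C g /\ g \is unitarymx.

Definition O2pm (g : 'M[C]_2) : Prop :=
  GO2 g /\ (simil g = 1 \/ simil g = -1).

Definition groupG (p : 'M[C]_2 * 'M[C]_2) : Prop :=
  [/\ O2pm p.1, O2pm p.2, \det p.1 = \det p.2 & simil p.2 = simil_sign p.1].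

Definition rho (p : 'M[C]_2 * 'M[C]_2) : 'M[C]_4 :=
  block_mx p.1 0 0 p.2.

Definition upsilon (p : 'M[C]_2 * 'M[C]_2) : C := simil_sign p.1.

Definition detG (p : 'M[C]_2 * 'M[C]_2) : C := \det p.1.

End Similitudes.

Section Morphisms.

Variable Gamma : groupType.

(* Group morphisms from Gamma to a group S of units of a ring A: Spin(7) and
   N in the Clifford algebra, groupG in M_2(C) x M_2(C), K^* in K. *)
Definition group_morphism (A : nzRingType) (S : A -> Prop) (r : Gamma -> A) :
    Prop :=
  [/\ forall x, S (r x), r 1%g = 1 & forall x y, r (x * y)%g = r x * r y].

Definition element_conjugate (A : unitRingType) (S : A -> Prop)
    (r r' : Gamma -> A) : Prop :=
  forall x, exists2 g, S g & r' x = g * r x * g^-1.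

Definition group_conjugate (A : unitRingType) (S : A -> Prop)
    (r r' : Gamma -> A) : Prop :=
  exists2 g, S g & forall x, r' x = g * r x * g^-1.

Definition order2_character (K : fieldType) (chi : Gamma -> K) : Prop :=
  [/\ group_morphism (fun z => z != 0) chi,
      forall x, chi x ^+ 2 = 1 & exists x, chi x != 1].

End Morphisms.

(* Main.v *)
Require Import Defs.
From mathcomp Require Import all_boot all_order all_fingroup all_algebra all_field.
From mathcomp Require Import spectral.
From mathcomp Require Import reals.
From mathcomp.real_closed Require Import complex.
From HB Require Import structures.
From mathcomp Require Import ring lra zify boolp.
From mathcomp.real_closed Require Import mxtens.

Set Implicit Arguments.
Unset Strict Implicit.
Unset Printing Implicit Defensive.
Import Order.TTheory GRing.Theory Num.Theory Num.Def.
Local Open Scope ring_scope.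
Local Open Scope sesquilinear_scope.

(** The map h identifies N^0 with SU(4), and N is the union of N^0 and of one
    more coset n0 N^0, on which conjugation acts on SU(4) as complex
    conjugation, up to an inner automorphism ([half_spin_su4],
    [outer_conjugation]).  Hence elements of N^0 that are conjugate in N have
    equal or complex conjugate traces, and two morphisms to N^0 are
    N-conjugate if and only if one, seen as a representation on C^4, is
    equivalent to the other or to its complex conjugate.  What remains is the
    statement [su4_classification] on two representations r and r' to SU(4).

    Since the traces of r and r' have the same real part, r is a sum X + Y
    such that r' is X + conj Y ([real_trace_decomposition]).  As det r and
    det r' are 1, det X and det Y are real, so that a summand of dimension at
    most 1 would be equal to its conjugate, and r' would be equivalent to r or
    to conj r.  Thus X and Y have dimension 2, and det X = det Y is a
    character d with values 1 and -1.  In dimension 2, conj Y is equivalent to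
    d Y.  Where d is -1 the traces of X and Y are therefore imaginary, and
    the hypothesis on traces says that one of them vanishes: the
    representations X (x) Y and d X (x) Y have the same trace, hence a nonzero
    intertwiner between them ([intertwiner_of_trace]).

    Seen as a bilinear form on pairs of 2 x 2 matrices, this intertwiner is
    carried by pairs of traceless Hermitian matrices, because X is not
    equivalent to d X, nor Y to d Y.  This gives a nonzero real matrix M of
    size 3 with x M = d M y, where x and y are the images of X and Y in SO(3).
    As d takes the value -1, det M is 0; from this one finds a line stable
    under x, with a character eta, which M maps to a line stable under y, with
    the character d eta ([common_line], [common_character]).  A stable line is
    a traceless Hermitian matrix that X preserves up to eta; in a suitable
    orthonormal basis X then takes its values in O(2)^pm, with signature eta
    and similitude factor d eta, and Y likewise, with signature d eta and
    similitude factor eta.  This is the morphism f, and X + conj Y is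
    equivalent to eta X + d (d eta) Y = eta (X + Y).

    The identification of N^0 with SU(4) is made explicit as follows.  The
    volume element of the even Clifford algebra of F is central, so h maps it
    to i or to -i by irreducibility; changing the orientation of an orthonormal
    basis of F, one gets i.  Five anticommuting unitary matrices with this product have
    a unique normal form ([gamma_normal_form]), so that in a suitable basis
    h(uv) = A(u) conj A(v), where A is the isometry from F to the skew
    matrices [spinor_mx].  Any U in SU(4) acts on the latter by
    A -> U A U^T, and it preserves the Pfaffian, hence it is a rotation
    ([su4_rotation]).  Surjectivity of h then follows by writing this rotation
    as a product of reflections, injectivity by observing that an even element
    of the Clifford algebra commuting with all vectors is a scalar
    ([half_spin_surj], [half_spin_inj]). *)

(** * Unitary representations and their traces *)

Section UnitaryRepresentations.

Variables (C : numClosedFieldType) (Gamma : groupType).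

Local Notation "B ^!" :=
  (orthomx conjC (mx_of_hermitian (hermitian1mx _)) B) : matrix_set_scope.

Definition urep n (V : Gamma -> 'M[C]_n) : Prop :=
  [/\ forall x, V x \is unitarymx, V 1%g = 1%:M
    & forall x y, V (x * y)%g = V x *m V y].

(** The intertwiner P is rectangular: equality of the two dimensions
    is a consequence, which avoids casts between them. *)
Definition uequiv m n (V : Gamma -> 'M[C]_m) (W : Gamma -> 'M[C]_n) : Prop :=
  exists P : 'M[C]_(m, n), [/\ P \is unitarymx, P ^t* \is unitarymx
    & forall x, V x *m P = P *m W x].

Definition dsum m n (V : Gamma -> 'M[C]_m) (W : Gamma -> 'M[C]_n) x :=
  block_mx (V x) 0 0 (W x).

Definition conjrep n (V : Gamma -> 'M[C]_n) x := (V x) ^ conjC.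

Lemma trmxC_mul m n p (A : 'M[C]_(m, n)) (B : 'M[C]_(n, p)) :
  (A *m B) ^t* = B ^t* *m A ^t*.
Proof. by rewrite trmx_mul map_mxM. Qed.

Lemma trmxC_unitary_rect m n (M : 'M[C]_(m, n)) :
  m = n -> M \is unitarymx -> M ^t* \is unitarymx.
Proof. by move=> mn; case: _ / mn M => M; rewrite trmxC_unitary. Qed.

Lemma unitarymx_dim m n (P : 'M[C]_(m, n)) :
  P \is unitarymx -> P ^t* \is unitarymx -> m = n.
Proof.
move=> /mxrank_unitary rP /mxrank_unitary.
by rewrite mxrank_map mxrank_tr rP.
Qed.

Lemma urepV n (V : Gamma -> 'M[C]_n) x : urep V -> V x^-1%g = (V x) ^t*.
Proof.
move=> [uV V1 VM]; rewrite -(invmx_unitary (uV x)).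
have VV : V x *m V x^-1%g = 1%:M by rewrite -VM mulgV.
by rewrite -[RHS]mulmx1 -VV mulKmx ?unitarymx_unit.
Qed.

Lemma urep_conj n (V : Gamma -> 'M[C]_n) : urep V -> urep (conjrep V).
Proof.
move=> [uV V1 VM]; split=> [x||x y]; rewrite /conjrep.
- by rewrite conjC_unitary.
- by rewrite V1 map_mx1.
- by rewrite VM map_mxM.
Qed.

Lemma urep_dsum m n (V : Gamma -> 'M[C]_m) (W : Gamma -> 'M[C]_n) :
  urep V -> urep W -> urep (dsum V W).
Proof.
move=> [uV V1 VM] [uW W1 WM]; split=> [x||x y]; rewrite /dsum.
- apply/unitarymxP; rewrite tr_block_mx map_block_mx mulmx_block !trmx0.
  rewrite !map_mx0 !mulmx0 !mul0mx !addr0 !add0r.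
  by rewrite !(unitarymxP _) // -scalar_mx_block.
- by rewrite V1 W1 -scalar_mx_block.
- by rewrite VM WM mulmx_block !mulmx0 !mul0mx !addr0 !add0r.
Qed.

Lemma dsum_conj m n (V : Gamma -> 'M[C]_m) (W : Gamma -> 'M[C]_n) x :
  conjrep (dsum V W) x = dsum (conjrep V) (conjrep W) x.
Proof. by rewrite /conjrep /dsum map_block_mx !map_mx0. Qed.

Lemma tr_dsum m n (V : Gamma -> 'M[C]_m) (W : Gamma -> 'M[C]_n) x :
  \tr (dsum V W x) = \tr (V x) + \tr (W x).
Proof. exact: mxtrace_block. Qed.

Lemma uequiv_refl n (V : Gamma -> 'M[C]_n) : uequiv V V.
Proof.
by exists 1%:M; split=> [||x]; rewrite ?trmx1 ?map_mx1 ?mulmx1 ?mul1mx //;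
  apply/unitarymxP; rewrite trmx1 map_mx1 mulmx1.
Qed.

Lemma uequiv_sym m n (V : Gamma -> 'M[C]_m) (W : Gamma -> 'M[C]_n) :
  uequiv V W -> uequiv W V.
Proof.
move=> [P [uP uPt VP]]; exists (P ^t*); split=> //; first by rewrite trmxCK.
have /unitarymxP := uP; have /unitarymxP := uPt; rewrite trmxCK => PtP PPt x.
by rewrite -[W x]mul1mx -PtP -(mulmxA _ P) -VP -!mulmxA PPt mulmx1.
Qed.

Lemma uequiv_trans m n p (V : Gamma -> 'M[C]_m) (W : Gamma -> 'M[C]_n)
    (X : Gamma -> 'M[C]_p) :
  uequiv V W -> uequiv W X -> uequiv V X.
Proof.
move=> [P [uP uPt VP]] [Q [uQ uQt WQ]]; exists (P *m Q); split=> [||x].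
- exact: mul_unitarymx.
- by rewrite trmxC_mul mul_unitarymx.
- by rewrite mulmxA VP -!mulmxA WQ.
Qed.

Lemma uequiv_dim m n (V : Gamma -> 'M[C]_m) (W : Gamma -> 'M[C]_n) :
  uequiv V W -> m = n.
Proof. by move=> [P [uP uPt _]]; apply: unitarymx_dim uP uPt. Qed.

Lemma uequiv_tr m n (V : Gamma -> 'M[C]_m) (W : Gamma -> 'M[C]_n) x :
  uequiv V W -> \tr (V x) = \tr (W x).
Proof.
move=> [P [/unitarymxP uP /unitarymxP uPt VP]].
rewrite -[V x]mulmx1 -uP mulmxA VP -mulmxA mxtrace_mulC -mulmxA.
by move: uPt; rewrite trmxCK => ->; rewrite mulmx1.
Qed.

Lemma uequiv_det m n (V : Gamma -> 'M[C]_m) (W : Gamma -> 'M[C]_n) x :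
  uequiv V W -> \det (V x) = \det (W x).
Proof.
move=> VW; have mn := uequiv_dim VW; case: _ / mn W VW => W.
move=> [P [uP _ VP]].
have /(congr1 determinant) := VP x; rewrite !det_mulmx mulrC.
by apply: mulfI; rewrite -unitfE -unitmxE unitarymx_unit.
Qed.

Lemma uequiv_dsum m n p q (V : Gamma -> 'M[C]_m) (W : Gamma -> 'M[C]_n)
    (X : Gamma -> 'M[C]_p) (Y : Gamma -> 'M[C]_q) :
  uequiv V W -> uequiv X Y -> uequiv (dsum V X) (dsum W Y).
Proof.
have uB k l k' l' (P : 'M[C]_(k, l)) (Q : 'M[C]_(k', l')) :
    P \is unitarymx -> Q \is unitarymx -> block_mx P 0 0 Q \is unitarymx.
  move=> uP uQ; apply/unitarymxP; rewrite tr_block_mx map_block_mx mulmx_block.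
  rewrite !trmx0 !map_mx0 !mulmx0 !mul0mx !addr0 !add0r.
  by rewrite !(unitarymxP _) // -scalar_mx_block.
move=> [P [uP uPt VP]] [Q [uQ uQt XQ]]; exists (block_mx P 0 0 Q).
split=> [||x]; first exact: uB.
  by rewrite tr_block_mx map_block_mx !trmx0 !map_mx0 uB.
by rewrite /dsum !mulmx_block !mulmx0 !mul0mx !addr0 !add0r VP XQ.
Qed.

Lemma uequiv_conj m n (V : Gamma -> 'M[C]_m) (W : Gamma -> 'M[C]_n) :
  uequiv V W -> uequiv (conjrep V) (conjrep W).
Proof.
move=> [P [uP uPt VP]]; exists (P ^ conjC); split=> [||x].
- by rewrite conjC_unitary.
- by rewrite conjC_unitary map_trmx.
- by rewrite /conjrep -!map_mxM VP.
Qed.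

Lemma uequiv_cast m n (e : m = n) (V : Gamma -> 'M[C]_m)
    (W : Gamma -> 'M[C]_n) :
  (forall x, W x = castmx (e, e) (V x)) -> uequiv V W.
Proof.
case: _ / e W => W /(_ _)/esym VW.
by have [P [? ? P3]] := uequiv_refl V; exists P; split=> // x;
  rewrite -VW castmx_id P3.
Qed.

Lemma uequiv_dsumA m n p (V : Gamma -> 'M[C]_m) (W : Gamma -> 'M[C]_n)
    (X : Gamma -> 'M[C]_p) :
  uequiv (dsum V (dsum W X)) (dsum (dsum V W) X).
Proof.
apply/uequiv_sym/(@uequiv_cast _ _ (esym (addnA m n p))) => x.
have := @block_mxA _ m n p m n p (V x) 0 0 0 (W x) 0 0 0 (X x).
by rewrite /= !row_mx0 !col_mx0 /dsum => ->.
Qed.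

Lemma uequiv_dsumC m n (V : Gamma -> 'M[C]_m) (W : Gamma -> 'M[C]_n) :
  uequiv (dsum V W) (dsum W V).
Proof.
exists (block_mx 0 1%:M 1%:M 0); split=> [||x].
- apply/unitarymxP; rewrite tr_block_mx map_block_mx mulmx_block.
  rewrite !trmx0 !trmx1 !map_mx0 !map_mx1 !mulmx0 !mul0mx !mulmx1 addr0 !add0r.
  by rewrite addr0 -scalar_mx_block.
- apply/unitarymxP; rewrite trmxCK tr_block_mx map_block_mx mulmx_block.
  rewrite !trmx0 !trmx1 !map_mx0 !map_mx1 !mulmx0 !mul0mx !mulmx1 addr0 !add0r.
  by rewrite addr0 -scalar_mx_block.
- rewrite /dsum !mulmx_block !mulmx0 !mul0mx !mulmx1 !mul1mx.
  by rewrite !addr0 !add0r.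
Qed.

(** The orthogonal complement of a stable subspace is stable, since the
    inverse of a unitary matrix is its adjoint; the rows of E are an
    orthonormal basis of the subspace. *)
Lemma urep_split k n (V : Gamma -> 'M[C]_n) (A : Gamma -> 'M[C]_k)
    (E : 'M[C]_(k, n)) :
    urep V -> E \is unitarymx -> (forall x, E *m V x = A x *m E) ->
  exists n1 (V1 : Gamma -> 'M[C]_n1),
    [/\ urep A, urep V1 & uequiv (dsum A V1) V].
Proof.
move=> rV uE EV; have [uV V1 VM] := rV.
have EE : E *m E ^t* = 1%:M by apply/unitarymxP.
pose E2 := schmidt (row_base (E^!)%MS).
have uE2 : E2 \is unitarymx by rewrite schmidt_unitarymx ?rank_leq_col.
have E2E2 : E2 *m E2 ^t* = 1%:M by apply/unitarymxP.
have E12 : E *m E2 ^t* = 0.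
  apply/orthomx1P; rewrite orthomx_sym /E2.
  by rewrite eqmx_schmidt_free ?eq_row_base ?row_base_free // orthomx_sym.
have E21 : E2 *m E ^t* = 0.
  by rewrite -[LHS]trmxCK trmxC_mul trmxCK E12 trmx0 map_mx0.
pose P := col_mx E E2.
have uP : P \is unitarymx.
  apply/unitarymxP; rewrite tr_col_mx map_row_mx mul_col_row EE E2E2 E12 E21.
  by rewrite -scalar_mx_block.
have dimP : (k + \rank (E^!)%MS)%N = n.
  by rewrite rank_ortho mxrank_unitary // subnKC // -(mxrank_unitary uE)
    rank_leq_col.
have uPt := trmxC_unitary_rect dimP uP.
have PtP : P ^t* *m P = 1%:M by have /unitarymxP := uPt; rewrite trmxCK.
have AE x : A x = E *m V x *m E ^t* by rewrite EV -mulmxA EE mulmx1.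
have E2V x : E2 *m V x = E2 *m V x *m E2 ^t* *m E2.
  have E2VE : E2 *m V x *m E ^t* = 0.
    have := EV x^-1%g; rewrite (urepV _ rV) => /(congr1 (mulmx^~ (E2 ^t*))).
    rewrite -[RHS]mulmxA E12 mulmx0 => /(congr1 (fun M => M ^t*)).
    by rewrite !trmxC_mul !trmxCK trmx0 map_mx0 !mulmxA.
  have := congr1 (mulmx (E2 *m V x)) PtP.
  rewrite mulmx1 tr_col_mx map_row_mx mul_row_col mulmxDr !mulmxA E2VE.
  by rewrite mul0mx add0r.
have uA x : A x \is unitarymx.
  apply/unitarymxP; rewrite {1}(AE x) -!mulmxA -trmxC_mul -EV trmxC_mul.
  by rewrite !mulmxA -(mulmxA E) (unitarymxP (uV x)) mulmx1.
have V1E x y : E2 *m V x *m V y *m E2 ^t* =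
   E2 *m V x *m E2 ^t* *m (E2 *m V y *m E2 ^t*).
  by rewrite {1}E2V !mulmxA.
exists _, (fun x => E2 *m V x *m E2 ^t*); split.
- split=> // [|x y]; first by rewrite AE V1 mulmx1 EE.
  by rewrite [A (x * y)%g]AE [A y]AE VM !mulmxA EV.
- split=> [x||x y].
  + apply/unitarymxP; rewrite !trmxC_mul trmxCK !mulmxA.
    rewrite -(urepV _ rV) -E2V -(mulmxA E2) -VM mulgV V1 mulmx1 //.
  + by rewrite V1 mulmx1.
  + by rewrite VM mulmxA V1E.
- exists P; split=> // x; rewrite /dsum /P mul_block_col mul_col_mx.
  by rewrite !mul0mx addr0 add0r EV -E2V.
Qed.


Lemma intertwine_adj m n (V : Gamma -> 'M[C]_m) (W : Gamma -> 'M[C]_n)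
    (T : 'M[C]_(m, n)) :
    urep V -> urep W -> (forall x, V x *m T = T *m W x) ->
  forall x, W x *m T ^t* = T ^t* *m V x.
Proof.
move=> rV rW VT x; have := VT x^-1%g => /(congr1 (fun M => M ^t*)).
by rewrite !trmxC_mul !(urepV, trmxCK) //; rewrite (urepV _ rV) (urepV _ rW) !trmxCK.
Qed.

Lemma unitary_conj_unitary n (B U : 'M[C]_n) :
  B \is unitarymx -> U \is unitarymx -> B *m U *m B ^t* \is unitarymx.
Proof. by move=> uB uU; rewrite !mul_unitarymx ?trmxC_unitary. Qed.

Lemma unitary_trC_mul n (B : 'M[C]_n) : B \is unitarymx -> B ^t* *m B = 1%:M.
Proof. by rewrite -trmxC_unitary => /unitarymxP; rewrite trmxCK. Qed.

Lemma urep_basis n (V : Gamma -> 'M[C]_n) (B : 'M[C]_n) :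
    urep V -> B \is unitarymx ->
  urep (fun g => B *m V g *m B ^t*) /\ uequiv V (fun g => B *m V g *m B ^t*).
Proof.
move=> [uV V1 VM] uB; have BtB := unitary_trC_mul uB.
have BBt : B *m B ^t* = 1%:M by apply/unitarymxP.
split; first split=> [g||g h].
- exact: unitary_conj_unitary.
- by rewrite V1 mulmx1.
- by rewrite VM !mulmxA -(mulmxA _ (B ^t*) B) BtB mulmx1.
exists (B ^t*); split=> [||g]; rewrite ?trmxCK ?trmxC_unitary //.
by rewrite !mulmxA BtB mul1mx.
Qed.

Lemma submx_unitaryE k m n (A : 'M[C]_(m, n)) (E : 'M[C]_(k, n)) :
  E \is unitarymx -> (A <= E)%MS -> A *m E ^t* *m E = A.
Proof. by move=> uE /submxP[D ->]; rewrite mulmxtVK. Qed.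

Lemma dotmx_eq0 n (u : 'rV[C]_n) : (u *m u ^t*) 0 0 = 0 -> u = 0.
Proof. by rewrite -dotmxE => /eqP; rewrite dnorm_eq0 => /eqP. Qed.

(** Polar decomposition, one eigenvalue at a time: T T^* commutes with V, and
    on an eigenspace for an eigenvalue l > 0 the map T is sqrt(l) times an
    isometry onto a stable subspace of W. *)
Lemma common_constituent m n (V : Gamma -> 'M[C]_m) (W : Gamma -> 'M[C]_n)
    (T : 'M[C]_(m, n)) :
    urep V -> urep W -> T != 0 -> (forall x, V x *m T = T *m W x) ->
  exists k m1 n1 (A : Gamma -> 'M[C]_k) (V1 : Gamma -> 'M[C]_m1)
         (W1 : Gamma -> 'M[C]_n1),
    [/\ (0 < k)%N, urep A, urep V1, urep W1
      & uequiv (dsum A V1) V /\ uequiv (dsum A W1) W].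
Proof.
move=> rV rW T0 VT; pose H := T *m T ^t*.
have VH x : V x *m H = H *m V x.
  by rewrite mulmxA VT -!mulmxA (intertwine_adj rV rW VT).
have Hherm : H ^t* = H by rewrite trmxC_mul trmxCK.
have /orthomx_spectralP HE : H \is normalmx.
  by apply/normalmxP; rewrite Hherm.
set P := spectralmx H in HE; set D := spectral_diag H in HE.
have uP : P \is unitarymx by exact: spectral_unitarymx.
have PH i : row i P *m H = D 0 i *: row i P.
  rewrite HE !mulmxA -row_mul mulmxV ?unitarymx_unit // row1 -rowE.
  by rewrite row_diag_mx -scalemxAl -rowE.
have /existsP[i Di] : [exists i, D 0 i != 0].
  apply: contraNT T0; rewrite negb_exists => /forallP D0.
  have PT i : row i P *m T = 0.
    apply: dotmx_eq0; rewrite trmxC_mul mulmxA.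
    rewrite -(mulmxA _ T) PH; have /negPn/eqP-> := D0 i.
    by rewrite scale0r mul0mx mxE.
  have -> : T = invmx P *m (P *m T) by rewrite mulKmx ?unitarymx_unit.
  suff -> : P *m T = 0 by rewrite mulmx0.
  by apply/row_matrixP => i; rewrite row_mul PT row0.
pose l := D 0 i; pose E0 := eigenspace H l.
have l_gt0 : 0 < l.
  rewrite lt_def Di /=; suff -> : l = dotmx (row i P *m T) (row i P *m T).
    exact: dnorm_ge0.
  rewrite dotmxE trmxC_mul mulmxA -(mulmxA _ T) PH -scalemxAl mxE.
  by rewrite -dotmxE; have /row_unitarymxP -> := uP; rewrite eqxx mulr1.
pose E := schmidt (row_base E0).
have EE0 : (E :=: E0)%MS.
  exact: eqmx_trans (eqmx_schmidt_free (row_base_free _)) (eq_row_base _).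
have uE : E \is unitarymx by rewrite schmidt_unitarymx ?rank_leq_col.
have EH : E *m H = l *: E by apply/eigenspaceP; rewrite EE0.
have EV x : E *m V x = E *m V x *m E ^t* *m E.
  rewrite submx_unitaryE // EE0; apply/eigenspaceP.
  by rewrite -mulmxA VH mulmxA EH scalemxAl.
pose A x := E *m V x *m E ^t*.
(* On the l-eigenspace of T T^*, the map T multiplies norms by sqrt l. *)
pose E' := (sqrtC l)^-1 *: (E *m T).
have sl_ge0 : 0 <= sqrtC l by rewrite sqrtC_ge0 ltW.
have uE' : E' \is unitarymx.
  apply/unitarymxP; rewrite /E' linearZ /= map_mxZ trmxC_mul.
  rewrite -scalemxAl -scalemxAr scalerA mulmxA -(mulmxA E) EH -scalemxAl.
  rewrite (unitarymxP _) // scalerA fmorphV /= geC0_conj // -invfM -expr2.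
  by rewrite sqrtCK mulVf ?scale1r // gt_eqF.
have E'W x : E' *m W x = A x *m E'.
  by rewrite /E' -scalemxAl -scalemxAr mulmxA -EV -!mulmxA VT.
have [m1 [V1 [rA rV1 VE]]] := urep_split rV uE EV.
have [n1 [W1 [_ rW1 WE]]] := urep_split rW uE' E'W.
exists _, m1, n1, A, V1, W1; split=> //.
rewrite lt0n mxrank_eq0; apply/eqP => E00.
have : (row i P <= E0)%MS by apply/eigenspaceP; rewrite PH.
rewrite E00 submx0 => /eqP Pi0; have /row_unitarymxP/(_ i i) := uP.
by rewrite Pi0 linear0l eqxx => /eqP; rewrite eq_sym oner_eq0.
Qed.

(** Take a matrix of maximal rank among those whose rows all satisfy P. *)
Lemma linear_closed_rowspace n (P : 'rV[C]_n -> Prop) :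
    P 0 -> (forall a u v, P u -> P v -> P (a *: u + v)) ->
  exists K : 'M[C]_n, forall u, P u <-> (u <= K)%MS.
Proof.
move=> P0 PD.
have PZ a u : P u -> P (a *: u) by move=> Pu; rewrite -[_ *: _]addr0; apply: PD.
have Pcomb k (M : 'M[C]_(k, n)) (c : 'rV_k) :
    (forall i, P (row i M)) -> P (c *m M).
  move=> PM; rewrite mulmx_sum_row; apply: big_ind => // [u v Pu Pv|i _].
    by rewrite -[u]scale1r; apply: PD.
  exact: PZ.
pose Q r := `[< exists2 K : 'M[C]_n, \rank K = r & forall i, P (row i K) >].
have Q0 : exists r, Q r.
  by exists 0%N; apply/asboolP; exists 0; rewrite ?mxrank0 // => i; rewrite row0.
have Qn r : Q r -> (r <= n)%N by move=> /asboolP[K <- _]; apply: rank_leq_row.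
case: (ex_maxnP Q0 Qn) => r /asboolP[K rK PK] rmax.
exists K => u; split=> [Pu|/submxP[c ->]]; last exact: Pcomb.
have PKu i : P (row i (K + u)%MS).
  have /sub_addsmxP[[a b] /= ->] := row_sub i (K + u)%MS.
  rewrite -[a *m K]scale1r; apply: PD; first exact: Pcomb.
  by apply: Pcomb => j; rewrite row_id.
have := rmax _ (introT (asboolP _) (ex_intro2 _ _ _ erefl PKu)).
rewrite -rK => leK; have := addsmxSl K u.
move/mxrank_leqif_sup/geq_leqif; rewrite leK => /esym.
exact: submx_trans (addsmxSr K u).
Qed.

Lemma mxvec_dotC m n (A B : 'M[C]_(m, n)) :
  (mxvec A *m (mxvec B) ^t*) 0 0 = \tr (A *m B ^t*).
Proof.
transitivity (\sum_i \sum_j A i j * (B i j)^*); last first.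
  by apply: eq_bigr => i _; rewrite mxE; apply: eq_bigr => j _; rewrite !mxE.
rewrite pair_bigA mxE (reindex _ (curry_mxvec_bij m n)) /=.
by apply: eq_bigr => -[i j] _; rewrite !mxE !mxvecE.
Qed.

Section MatrixOperator.

Variables (p : nat) (Phi : 'M[C]_(p * p)).

Definition op_on_mx (N : 'M[C]_p) : 'M[C]_p := vec_mx (mxvec N *m Phi).

(** A linear endomorphism of the space of matrices is a sum of
    maps N -> E N c, with E elementary; these are the coefficients c. *)
Definition op_coef (i j : 'I_p) : 'M[C]_p :=
  \matrix_(a, b) op_on_mx (delta_mx i a) j b.

Lemma op_on_mxE N j b :
  op_on_mx N j b = \sum_i (row i N *m op_coef i j) 0 b.
Proof.
rewrite /op_on_mx {1}[N]matrix_sum_delta linear_sum mulmx_suml linear_sum.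
rewrite summxE; apply: eq_bigr => i _.
rewrite linear_sum mulmx_suml linear_sum summxE mxE; apply: eq_bigr => a _.
by rewrite linearZ -scalemxAl linearZ !mxE.
Qed.

(** An endomorphism of the space of matrices commutes with the right
    multiplication by q if and only if its coefficients commute with q: commutation
    can thus be passed from one q to another, as in the double commutant
    theorem. *)
Lemma op_on_mx_commute (q : 'M[C]_p) :
  (forall i j, op_coef i j *m q = q *m op_coef i j) <->
  (forall N, op_on_mx (N *m q) = op_on_mx N *m q).
Proof.
split=> [cq N|oq i j].
  apply/matrixP => j b; rewrite op_on_mxE mxE.
  under eq_bigr => i _ do rewrite row_mul -mulmxA -cq mulmxA mxE.
  rewrite exchange_big /=; apply: eq_bigr => c _.
  by rewrite op_on_mxE mulr_suml.
apply/matrixP => a b.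
have /matrixP/(_ j b) := oq (delta_mx i a).
rewrite op_on_mxE (bigD1 i) //= big1 ?addr0 => [|i' i'i]; last first.
  have -> : row i' (delta_mx i a *m q) = 0; last by rewrite mul0mx mxE.
  by rewrite row_mul; apply/rowP=> c; rewrite !mxE big1 // => d _;
     rewrite !mxE (negPf i'i) mul0r.
have -> : row i (delta_mx i a *m q) = row a q.
  by rewrite row_mul rowE mul_delta_mx -rowE.
rewrite -row_mul mxE => ->; rewrite !mxE; apply: eq_bigr => c _.
by rewrite mxE.
Qed.

End MatrixOperator.

(** Let Z = V + W and suppose that every intertwiner is 0.  The
    space K of matrices N with tr(N Z) = 0 is stable under right
    multiplication by Z; so the coefficients of the orthogonal projection
    to K commute with Z, and being block diagonal by assumption they commute
    with the projection q to V.  Hence K is stable under right multiplication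
    by q; but it contains diag(1, -1), and not diag(1, 0). *)
Lemma intertwiner_of_trace m n (V : Gamma -> 'M[C]_m) (W : Gamma -> 'M[C]_n) :
    urep V -> urep W -> (0 < m)%N -> (forall x, \tr (V x) = \tr (W x)) ->
  exists2 T : 'M[C]_(m, n), T != 0 & forall x, V x *m T = T *m W x.
Proof.
move=> rV rW m_gt0 trVW; apply: contrapT => noT.
have noVW T : (forall x, V x *m T = T *m W x) -> T = 0.
  by move=> VT; apply/eqP/negP => /negP T0; apply: noT; exists T.
have noWV T : (forall x, W x *m T = T *m V x) -> T = 0.
  move=> /(intertwine_adj rW rV)/noVW T0.
  by rewrite -[T]trmxCK T0 trmx0 map_mx0.
pose Z := dsum V W; have rZ : urep Z by exact: urep_dsum.
have [_ Z1 ZM] := rZ; pose p := (m + n)%N.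
pose S (w : 'rV[C]_(p * p)) := forall x, \tr (vec_mx w *m Z x) = 0.
have [K SK] : exists K : 'M[C]_(p * p), forall w, S w <-> (w <= K)%MS.
  apply: linear_closed_rowspace => [x|a u v Su Sv x].
    by rewrite linear0 mul0mx linear0.
  by rewrite linearP mulmxDl -scalemxAl linearP /= Su Sv mulr0 addr0.
have KZ N x : (mxvec N <= K)%MS -> (mxvec (N *m Z x) <= K)%MS.
  move=> /SK SN; apply/SK => y; have := SN (x * y)%g.
  by rewrite !mxvecK ZM mulmxA.
pose Phi := proj_ortho K; pose phi := op_on_mx Phi.
(* K and its orthogonal are both stable under right multiplication by Z. *)
have phiZ x N : phi (N *m Z x) = phi N *m Z x.
  pose N1 := phi N; pose N2 := N - N1.
  have KN1 : (mxvec N1 <= K)%MS by rewrite vec_mxK proj_ortho_sub.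
  have KN2 : (mxvec N2 <= K^!)%MS.
    by rewrite linearB /= vec_mxK proj_ortho_compl_sub.
  have -> : N = N1 + N2 by rewrite addrC subrK.
  rewrite mulmxDl /phi /op_on_mx linearD /= mulmxDl.
  rewrite (proj_ortho_id (KZ _ _ KN1)) proj_ortho_0; last first.
    apply/orthomx1P/rowP => j; rewrite [RHS]mxE.
    have -> : (mxvec (N2 *m Z x) *m K ^t*) 0 j
            = (mxvec (N2 *m Z x) *m (row j K) ^t*) 0 0.
      by rewrite !mxE; apply: eq_bigr => k _; rewrite !mxE.
    rewrite -[row j K]vec_mxK mxvec_dotC -mulmxA -[Z x]trmxCK -trmxC_mul.
    rewrite -mxvec_dotC -(urepV _ rZ).
    have KK : (mxvec (vec_mx (row j K) *m Z x^-1%g) <= K)%MS.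
      by apply: KZ; rewrite vec_mxK row_sub.
    have := orthomx1P (submx_trans KN2 _) => /(_ _ (mxvec (vec_mx (row j K) *m Z x^-1%g))).
    by rewrite submx_ortho => /(_ KK) ->; rewrite mxE.
  rewrite addr0 mxvecK; congr (_ *m _).
  rewrite linearD /= mulmxDl (proj_ortho_id KN1) (proj_ortho_0 KN2) addr0.
  by rewrite mxvecK.
pose q : 'M[C]_p := block_mx 1%:M 0 0 0.
have phiq : forall N, phi (N *m q) = phi N *m q.
  apply/(op_on_mx_commute Phi q) => i j.
  have CZ x : op_coef Phi i j *m Z x = Z x *m op_coef Phi i j.
    by move: i j; apply/(op_on_mx_commute Phi (Z x)); exact: phiZ.
  move: (op_coef Phi i j) CZ => c; rewrite -[c]submxK => cZ.
  have {}cZ x := eq_block_mx (etrans (esym (mulmx_block _ _ _ _ _ _ _ _))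
     (etrans (cZ x) (mulmx_block _ _ _ _ _ _ _ _))).
  have -> : ursubmx c = 0.
    apply: noVW => x; have [_ /eqP + _ _] := cZ x.
    by rewrite mulmx0 mul0mx add0r addr0 => /eqP.
  have -> : dlsubmx c = 0.
    apply: noWV => x; have [_ _ /eqP + _] := cZ x.
    by rewrite mulmx0 mul0mx add0r addr0 => /eqP.
  by rewrite /q !mulmx_block !mulmx0 !mul0mx !mulmx1 !mul1mx !addr0.
(* The equality of traces puts N0 in K; if N0 q = diag(1, 0) were in K, its
   trace against Z 1 = 1, which is m, would vanish. *)
pose N0 : 'M[C]_p := block_mx 1%:M 0 0 (- 1%:M).
have KN0 : (mxvec N0 <= K)%MS.
  apply/SK => x; rewrite mxvecK /N0 /Z /dsum mulmx_block.
  rewrite !mulmx0 !mul0mx !mul1mx mulNmx mul1mx addr0 add0r.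
  by rewrite mxtrace_block sub0r linearN /= trVW subrr.
have phiN0 : phi N0 = N0 by rewrite /phi /op_on_mx proj_ortho_id ?mxvecK.
have : (mxvec (N0 *m q) <= K)%MS.
  by rewrite -[in N0 *m q]phiN0 -phiq vec_mxK proj_ortho_sub.
move/SK/(_ 1%g); rewrite mxvecK Z1 mulmx1 mulmx_block.
rewrite !mulmx0 !mul0mx !mul1mx !addr0 mxtrace_block mxtrace1 linear0 addr0.
by move/eqP; rewrite pnatr_eq0 -leqn0 leqNgt m_gt0.
Qed.

Lemma flatmx0_eq n (A B : 'M[C]_(0, n)) : A = B.
Proof. by rewrite (flatmx0 A) (flatmx0 B). Qed.

(** V + conj V and W + conj W have the same trace, so they have a nonzero
    intertwiner, one block of which gives a constituent A of V that is also one
    of W or of conj W.  Remove it, and conclude by induction on the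
    dimension: A goes to X in the first case, and to Y in the second. *)
Lemma real_trace_decomposition m n (V : Gamma -> 'M[C]_m)
    (W : Gamma -> 'M[C]_n) :
    urep V -> urep W ->
    (forall x, \tr (V x) + (\tr (V x))^* = \tr (W x) + (\tr (W x))^* ) ->
  exists k l (X : Gamma -> 'M[C]_k) (Y : Gamma -> 'M[C]_l),
    [/\ urep X, urep Y, uequiv (dsum X Y) V & uequiv (dsum X (conjrep Y)) W].
Proof.
have [N] := ubnP m; elim: N => // N IHN in m n V W *; rewrite ltnS => mN.
move=> rV rW trVW.
have tr_conj k (U : Gamma -> 'M[C]_k) x : \tr (conjrep U x) = (\tr (U x))^*.
  by rewrite /conjrep -trace_map_mx.
have [rVb rWb] := (urep_conj rV, urep_conj rW).
case: (posnP m) => [m0|m_gt0].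
  have n0 : n = 0%N.
    have := trVW 1%g; have [_ -> _] := rV; have [_ -> _] := rW.
    rewrite !mxtrace1 !conjC_nat -!natrD => /eqP; rewrite eqr_nat m0 => /eqP.
    by case: (n).
  subst m n; exists 0%N, 0%N, V, (fun _ => 1%:M); split=> //.
  - split=> [x||x y]; last by rewrite mulmx1.
      by apply/unitarymxP; rewrite trmx1 map_mx1 mulmx1.
    by [].
  - exists 0; split=> [||x]; try by apply/unitarymxP/(@flatmx0_eq 0).
    exact: (@flatmx0_eq 0).
  - exists 0; split=> [||x]; try by apply/unitarymxP/(@flatmx0_eq 0).
    exact: (@flatmx0_eq 0).
have [T T0 VT] : exists2 T : 'M[C]_(m + m, n + n), T != 0 &
    forall x, dsum V (conjrep V) x *m T = T *m dsum W (conjrep W) x.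
  apply: intertwiner_of_trace; rewrite ?addn_gt0 ?m_gt0 //.
  - exact: urep_dsum.
  - exact: urep_dsum.
  - by move=> x; rewrite !tr_dsum !tr_conj.
have {VT} VT x : [/\ V x *m ulsubmx T = ulsubmx T *m W x,
    V x *m ursubmx T = ursubmx T *m conjrep W x,
    conjrep V x *m dlsubmx T = dlsubmx T *m W x
  & conjrep V x *m drsubmx T = drsubmx T *m conjrep W x].
  have := VT x; rewrite -[T]submxK /dsum !mulmx_block !mulmx0 !mul0mx.
  by rewrite !addr0 !add0r => /eq_block_mx[? ? ? ?]; rewrite !submxK.
have conjK k (U : Gamma -> 'M[C]_k) x : (conjrep U x) ^ conjC = U x.
  by apply/matrixP=> i j; rewrite !mxE conjCK.
have {T T0 VT} [[T T0 VT]|[T T0 VT]] :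
    (exists2 T : 'M[C]_(m, n), T != 0 & forall x, V x *m T = T *m W x) \/
    (exists2 T : 'M[C]_(m, n), T != 0 & forall x, V x *m T = T *m conjrep W x).
  have [ul0|ul0] := eqVneq (ulsubmx T) 0; last first.
    by left; exists (ulsubmx T) => // x; have [] := VT x.
  have [ur0|ur0] := eqVneq (ursubmx T) 0; last first.
    by right; exists (ursubmx T) => // x; have [] := VT x.
  have [dl0|dl0] := eqVneq (dlsubmx T) 0; last first.
    right; exists ((dlsubmx T) ^ conjC); first by rewrite map_mx_eq0.
    by move=> x; have [_ _ + _] := VT x => /(congr1 (map_mx conjC));
       rewrite !map_mxM /= conjK.
  left; exists ((drsubmx T) ^ conjC).
    rewrite map_mx_eq0; apply: contraNneq T0 => dr0.
    by rewrite -[T]submxK ul0 ur0 dl0 dr0 block_mx_const.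
  by move=> x; have [_ _ _] := VT x => /(congr1 (map_mx conjC));
     rewrite !map_mxM /= !conjK.
- have [k [m1 [n1 [A [V1 [W1 [k0 rA rV1 rW1 [VE WE]]]]]]]] :=
    common_constituent rV rW T0 VT.
  have tr1 x : \tr (V1 x) + (\tr (V1 x))^* = \tr (W1 x) + (\tr (W1 x))^*.
    have := trVW x; rewrite -(uequiv_tr x VE) -(uequiv_tr x WE) !tr_dsum.
    by rewrite !rmorphD /= !addrA ![_ + _ + (\tr (A x))^*]addrAC -!addrA
       => /addrI/addrI.
  have lm1 : (m1 < N)%N.
    apply: leq_trans mN; rewrite -(uequiv_dim VE).
    by rewrite -[X in (X < _)%N]add0n ltn_add2r.
  have [k1 [l1 [X [Y [rX rY V1E W1E]]]]] := IHN _ _ _ _ lm1 rV1 rW1 tr1.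
  exists _, _, (dsum A X), Y; split=> //; first exact: urep_dsum.
  + apply: uequiv_trans VE; apply: uequiv_trans (uequiv_dsum (uequiv_refl A) V1E).
    exact/uequiv_sym/uequiv_dsumA.
  + apply: uequiv_trans WE; apply: uequiv_trans (uequiv_dsum (uequiv_refl A) W1E).
    exact/uequiv_sym/uequiv_dsumA.
- have [k [m1 [n1 [A [V1 [W1 [k0 rA rV1 rW1 [VE WE]]]]]]]] :=
    common_constituent rV rWb T0 VT.
  have WE' : uequiv (dsum (conjrep A) (conjrep W1)) W.
    have [P [uP uPt P3]] := uequiv_conj WE; exists P; split=> // x.
    by rewrite -dsum_conj P3 /conjrep -/(conjrep W x) conjK.
  have tr1 x : \tr (V1 x) + (\tr (V1 x))^* =
     \tr (conjrep W1 x) + (\tr (conjrep W1 x))^*.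
    have := trVW x; rewrite -(uequiv_tr x VE) -(uequiv_tr x WE') !tr_dsum.
    rewrite !tr_conj !rmorphD /= !conjCK => /eqP.
    rewrite -subr_eq0 => /eqP e; apply/eqP; rewrite -subr_eq0 -e; apply/eqP.
    by ring.
  have lm1 : (m1 < N)%N.
    apply: leq_trans mN; rewrite -(uequiv_dim VE).
    by rewrite -[X in (X < _)%N]add0n ltn_add2r.
  have [k1 [l1 [X [Y [rX rY V1E W1E]]]]] :=
    IHN _ _ _ _ lm1 rV1 (urep_conj rW1) tr1.
  exists _, _, X, (dsum Y A); split=> //; first exact: urep_dsum.
  + apply: uequiv_trans (uequiv_dsumA _ _ _) _.
    apply: uequiv_trans (uequiv_dsumC _ _) _.
    exact: uequiv_trans (uequiv_dsum (uequiv_refl A) V1E) VE.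
  + apply: (@uequiv_trans _ _ _ _ (dsum X (dsum (conjrep Y) (conjrep A)))).
      apply: uequiv_dsum (uequiv_refl _) _.
      have [P [uP uPt P3]] := uequiv_refl (dsum (conjrep Y) (conjrep A)).
      by exists P; split=> // x; rewrite dsum_conj P3.
    apply: uequiv_trans (uequiv_dsumA _ _ _) _.
    apply: uequiv_trans (uequiv_dsumC _ _) _.
    exact: uequiv_trans (uequiv_dsum (uequiv_refl _) W1E) WE'.
Qed.

End UnitaryRepresentations.

(** * Reflections and orthogonal matrices *)

Lemma sqr1_sign (K : idomainType) (a : K) : a ^+ 2 = 1 -> a = 1 \/ a = -1.
Proof. by move=> /eqP; rewrite sqrf_eq1 => /orP[]/eqP; [left|right]. Qed.

Section RealLines.

Variable (R : rcfType).

Lemma sqnorm_ge0 n (v : 'rV[R]_n) : 0 <= sqnorm v.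
Proof. by apply: sumr_ge0 => i _; apply: sqr_ge0. Qed.

Lemma sqnorm_eq0 n (v : 'rV[R]_n) : (sqnorm v == 0) = (v == 0).
Proof.
apply/eqP/eqP => [|->]; last by rewrite /sqnorm big1 // => i _; rewrite mxE expr0n.
move=> /eqP; rewrite psumr_eq0 => [/allP v0|i _]; last exact: sqr_ge0.
by apply/rowP=> i; rewrite mxE; apply/eqP; rewrite -sqrf_eq0; apply: v0 (mem_index_enum i).
Qed.

Lemma sqnormE n (v : 'rV[R]_n) : v *m v^T = (sqnorm v)%:M.
Proof.
rewrite [LHS]mx11_scalar mxE; congr (_ %:M).
by apply: eq_bigr => i _; rewrite mxE expr2.
Qed.

Lemma sqnormZ n a (v : 'rV[R]_n) : sqnorm (a *: v) = a ^+ 2 * sqnorm v.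
Proof. by rewrite mulr_sumr; apply: eq_bigr => i _; rewrite mxE exprMn. Qed.

Definition orthomx_real n (O : 'M[R]_n) : Prop := O *m O^T = 1%:M.

Lemma orthomx_realC n (O : 'M[R]_n) : orthomx_real O -> O^T *m O = 1%:M.
Proof. exact: mulmx1C. Qed.

Lemma sqnorm_ortho n (O : 'M[R]_n) v :
  orthomx_real O -> sqnorm (v *m O) = sqnorm v.
Proof.
move=> OO; have := sqnormE (v *m O); rewrite trmx_mul mulmxA -(mulmxA v) OO.
by rewrite mulmx1 sqnormE => /matrixP/(_ 0 0); rewrite !mxE eqxx !mulr1n.
Qed.

Definition reflection n (v : 'rV[R]_n) : 'M[R]_n := 1%:M - 2 *: (v^T *m v).

Lemma reflection_ortho n (v : 'rV[R]_n) : sqnorm v = 1 ->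
  orthomx_real (reflection v).
Proof.
move=> v1; rewrite /orthomx_real; have -> : (reflection v)^T = reflection v.
  by rewrite /reflection raddfB /= trmx1 linearZ /= trmx_mul trmxK.
rewrite /reflection; set X := 2 *: _; have XX : X *m X = 2 *: X.
  rewrite -scalemxAl -scalemxAr mulmxA -(mulmxA _ v) sqnormE v1 mulmx1.
  by rewrite !scalerA.
rewrite mulmxBl !mulmxBr !mul1mx mulmx1 XX.
by rewrite scaler_nat mulr2n opprB addrK subrK.
Qed.

(** The vector v is the unit vector on the line of u - w, the only possible
    axis; it is recorded in order to know what it is orthogonal to. *)
Lemma reflection_swap n (u w : 'rV[R]_n) :
    sqnorm u = sqnorm w -> u != w ->
  exists v, [/\ sqnorm v = 1, u *m reflection v = w
    & exists c, v = c *: (u - w)].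
Proof.
move=> uw unw; pose z := u - w.
have z0 : 0 < sqnorm z by rewrite lt_def sqnorm_ge0 sqnorm_eq0 subr_eq0 unw.
pose c := (Num.sqrt (sqnorm z))^-1.
have c2 : c ^+ 2 = (sqnorm z)^-1 by rewrite exprVn sqr_sqrtr ?ltW.
exists (c *: z); split; last by exists c.
  by rewrite sqnormZ c2 mulVf ?gt_eqF.
have -> : u *m reflection (c *: z) = u - (2 * (c * c)) *: (u *m z^T *m z).
  rewrite /reflection mulmxBr mulmx1 [(c *: z)^T]linearZ /=.
  by rewrite -!(scalemxAl, scalemxAr) !scalerA mulmxA; congr (_ - _ *: _); ring.
have -> : u *m z^T = (sqnorm z / 2)%:M.
  rewrite [LHS]mx11_scalar; congr (_ %:M).
  have : sqnorm z = 2 * (u *m z^T) 0 0.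
    transitivity (2 * (u *m z^T) 0 0 + sqnorm w - sqnorm u); last first.
      by rewrite uw addrK.
    rewrite mxE mulr_sumr -big_split -sumrB /=; apply: eq_bigr => i _.
    by rewrite !mxE; ring.
  by move=> ->; rewrite mulrAC mulfV ?mul1r ?pnatr_eq0.
rewrite mul_scalar_mx scalerA [_ * _](_ : _ = 1).
  by rewrite scale1r /z opprB addrC subrK.
have -> : 2 * (c * c) * (sqnorm z / 2) = c ^+ 2 * sqnorm z by field.
by rewrite c2 mulVf ?gt_eqF.
Qed.

Lemma ortho_with_row n (v : 'rV[R]_n.+1) : sqnorm v = 1 ->
  exists2 O : 'M[R]_n.+1, orthomx_real O & row 0 O = v.
Proof.
move=> v1; pose e : 'rV[R]_n.+1 := delta_mx 0 0.
have e1 : sqnorm e = sqnorm v.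
  rewrite v1 /sqnorm (bigD1 0) //= big1 => [|i /negPf i0]; rewrite !mxE ?eqxx.
    by rewrite expr1n addr0.
  by rewrite i0 expr0n.
have [ev|env] := eqVneq e v.
  by exists 1%:M; rewrite ?row1 // /orthomx_real trmx1 mulmx1.
have [w [w1 ew _]] := reflection_swap e1 env.
by exists (reflection w); rewrite ?rowE //; apply: reflection_ortho.
Qed.

Lemma unit_multiple n (v : 'rV[R]_n) : v != 0 ->
  exists2 c, c != 0 & sqnorm (c *: v) = 1.
Proof.
move=> v0; have n0 : 0 < sqnorm v by rewrite lt_def sqnorm_ge0 sqnorm_eq0 v0.
exists (Num.sqrt (sqnorm v))^-1; first by rewrite invr_eq0 sqrtr_eq0 -ltNge.
by rewrite sqnormZ exprVn sqr_sqrtr ?ltW // mulVf ?gt_eqF.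
Qed.

Lemma ortho_scale n (O : 'M[R]_n) (v : 'rV_n) a :
  orthomx_real O -> v != 0 -> v *m O = a *: v -> a ^+ 2 = 1.
Proof.
move=> OO v0 vO; have := sqnorm_ortho v OO; rewrite vO sqnormZ.
by rewrite -[RHS]mul1r => /mulIf; apply; rewrite sqnorm_eq0.
Qed.

Lemma rank1_stable_line n (K A : 'M[R]_n) (v : 'rV_n) :
    (\rank K <= 1)%N -> (v <= K)%MS -> v != 0 -> stablemx K A ->
  exists a, v *m A = a *: v.
Proof.
move=> rK vK v0 KA; apply/sub_rVP.
have /eqmxP Kv : (v == K)%MS.
  rewrite -mxrank_leqif_eq // rank_rV v0 eqn_leq rK andbT.
  by apply: leq_trans (mxrankS vK); rewrite rank_rV v0.
by rewrite Kv; apply: submx_trans KA; rewrite submxMr.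
Qed.

End RealLines.

(** * Matrices of size 2, and stable lines in dimension 3 *)

Section Mx2.

Variable K : comPzRingType.

Definition mx2 (a b c e : K) : 'M[K]_2 :=
  \matrix_(i, j) if i == 0 then (if j == 0 then a else b)
                 else (if j == 0 then c else e).

Lemma ord2P (P : 'I_2 -> Prop) : P 0 -> P 1 -> forall i, P i.
Proof.
move=> P0 P1 [[|[|//]] lt].
  by rewrite (_ : Ordinal lt = 0) //; apply: val_inj.
by rewrite (_ : Ordinal lt = 1) //; apply: val_inj.
Qed.

Lemma mx2P (A B : 'M[K]_2) : A 0 0 = B 0 0 -> A 0 1 = B 0 1 ->
  A 1 0 = B 1 0 -> A 1 1 = B 1 1 -> A = B.
Proof. by move=> *; apply/matrixP; elim/ord2P; elim/ord2P. Qed.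

Lemma mx2_eta (A : 'M[K]_2) : A = mx2 (A 0 0) (A 0 1) (A 1 0) (A 1 1).
Proof. by apply: mx2P; rewrite !mxE. Qed.

Lemma mx2_inj a b c e a' b' c' e' : mx2 a b c e = mx2 a' b' c' e' ->
  [/\ a = a', b = b', c = c' & e = e'].
Proof.
move=> /matrixP h; have := (h 0 0, h 0 1, h 1 0, h 1 1).
by rewrite !mxE /= => -[[[-> ->] ->] ->].
Qed.

Lemma mx2M a b c e a' b' c' e' : mx2 a b c e *m mx2 a' b' c' e' =
  mx2 (a * a' + b * c') (a * b' + b * e') (c * a' + e * c') (c * b' + e * e').
Proof.
by apply: mx2P; rewrite !mxE !big_ord_recl big_ord0 addr0 !mxE.
Qed.

Lemma mx2D a b c e a' b' c' e' : mx2 a b c e + mx2 a' b' c' e' =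
  mx2 (a + a') (b + b') (c + c') (e + e').
Proof. by apply: mx2P; rewrite !mxE. Qed.

Lemma mx2Z k a b c e : k *: mx2 a b c e = mx2 (k * a) (k * b) (k * c) (k * e).
Proof. by apply: mx2P; rewrite !mxE. Qed.

Lemma mx2_tr a b c e : (mx2 a b c e)^T = mx2 a c b e.
Proof. by apply: mx2P; rewrite !mxE. Qed.

Lemma mx2_scalar k : k%:M = mx2 k 0 0 k.
Proof. by apply: mx2P; rewrite !mxE. Qed.

Lemma mxtrace2 a b c e : \tr (mx2 a b c e) = a + e.
Proof. by rewrite /mxtrace !big_ord_recl big_ord0 addr0 !mxE. Qed.

End Mx2.

Lemma mx2N (K : comPzRingType) (a b c e : K) :
  - mx2 a b c e = mx2 (- a) (- b) (- c) (- e).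
Proof. by apply: mx2P; rewrite !mxE. Qed.

Lemma det_mx2 (K : comNzRingType) (a b c e : K) :
  \det (mx2 a b c e) = a * e - b * c.
Proof.
rewrite (expand_det_row _ 0) !big_ord_recl big_ord0 addr0 /cofactor !det_mx11.
by rewrite !mxE /= expr0 expr1 mul1r mulN1r mulrN.
Qed.

Lemma map_mx2 (K L : comPzRingType) (f : K -> L) a b c e :
  map_mx f (mx2 a b c e) = mx2 (f a) (f b) (f c) (f e).
Proof. by apply: mx2P; rewrite !mxE. Qed.

Lemma mul_block_diag (K : pzSemiRingType) m n (a b : 'M[K]_m) (A B : 'M[K]_n) :
  block_mx a 0 0 A *m block_mx b 0 0 B = block_mx (a *m b) 0 0 (A *m B).
Proof. by rewrite mulmx_block !mulmx0 !mul0mx !addr0 !add0r. Qed.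

Section CommonLine.

Variable (R : rcfType).

Lemma ortho2E (A : 'M[R]_2) : orthomx_real A -> let a := \det A in
  [/\ a ^+ 2 = 1, A 1 1 = a * A 0 0, A 1 0 = - a * A 0 1
    & A 0 0 ^+ 2 + A 0 1 ^+ 2 = 1].
Proof.
rewrite /orthomx_real; rewrite [A]mx2_eta det_mx2 mx2_tr mx2M mx2_scalar !mxE /=.
set p := A 0 0; set q := A 0 1; set u := A 1 0; set v := A 1 1.
move=> /mx2_inj[h1 h2 h3 h4]; split; last by rewrite !expr2.
- transitivity ((p * p + q * q) * (u * u + v * v) - (p * u + q * v) ^+ 2).
    by ring.
  by rewrite h1 h2 h4; ring.
- transitivity ((p * p + q * q) * v - q * (p * u + q * v)); last by ring.
  by rewrite h1 h2; ring.
- transitivity ((p * p + q * q) * u - p * (p * u + q * v)); last by ring.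
  by rewrite h1 h2; ring.
Qed.

(** With A = (p, q; - a q, a p), a = det A, the hypothesis says nothing when
    a = -1, as a reflection has trace 0; when a = 1, it reads 4 (1 - p^2) = 0,
    so q = 0. *)
Lemma ortho2_involution (A : 'M[R]_2) : orthomx_real A ->
    (1 + \det A + \tr A) * (1 + \det A - \tr A) = 0 ->
  A *m A = 1%:M /\ (\det A = 1 -> exists s, A = s%:M).
Proof.
move=> /ortho2E; set a := \det A => -[a2 e1 e2 e3].
rewrite [A]mx2_eta mxtrace2 e1 e2 mx2M mx2_scalar.
move: (A 0 0) (A 0 1) e3 => p q e3 h.
have [a1|a1] : a = 1 \/ a = -1.
  exact: sqr1_sign.
- rewrite a1 in h *.
  have p2 : p ^+ 2 = 1 by lra.
  have q0 : q = 0 by apply/eqP; rewrite -sqrf_eq0; apply/eqP; lra.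
  rewrite q0; split=> [|_]; first by congr mx2; nra.
  by exists p; rewrite mx2_scalar; congr mx2; ring.
- rewrite a1 in h *; split=> [|e]; last by exfalso; lra.
  by congr mx2; nra.
Qed.

Lemma block_of_corner n (X : 'M[R]_(1 + n)) a :
    row 0 X = a *: delta_mx 0 0 -> row 0 X^T = a *: delta_mx 0 0 ->
  X = block_mx a%:M 0 0 (drsubmx X).
Proof.
move=> X0 Xt0; rewrite -[LHS]submxK; congr block_mx.
- apply/matrixP => i j; have /rowP/(_ 0) := X0; rewrite !ord1 !mxE eqxx mulr1.
  by move=> <-; congr (X _ _); apply: val_inj.
- apply/matrixP => i j; have /rowP/(_ (rshift 1 j)) := X0.
  by rewrite ord1 !mxE /= mulr0 => <-; congr (X _ _); apply: val_inj.
- apply/matrixP => i j; have /rowP/(_ (rshift 1 i)) := Xt0.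
  by rewrite ord1 !mxE /= mulr0 => <-; congr (X _ _); apply: val_inj.
Qed.

Lemma block_of_line n (O x : 'M[R]_(1 + n)) (k : 'rV[R]_(1 + n)) a :
    orthomx_real O -> orthomx_real x -> row 0 O = k -> k *m x = a *: k ->
  O *m x *m O^T = block_mx a%:M 0 0 (drsubmx (O *m x *m O^T)).
Proof.
move=> OO xx Ok kx; set X := O *m x *m O^T.
have kO : k *m O^T = delta_mx 0 0 by rewrite -Ok -row_mul OO row1.
have k0 : k != 0.
  apply/eqP => k0; have := kO; rewrite k0 mul0mx => /matrixP/(_ 0 0)/eqP.
  by rewrite !mxE eqxx eq_sym oner_eq0.
have a2 := ortho_scale xx k0 kx.
have kxt : k *m x^T = a *: k.
  have := congr1 (mulmx^~ x^T) kx; rewrite -mulmxA xx mulmx1 -scalemxAl.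
  by move=> /(congr1 (fun v => a *: v)); rewrite scalerA -expr2 a2 scale1r => <-.
have X0 : row 0 X = a *: delta_mx 0 0.
  by rewrite /X !row_mul Ok kx -scalemxAl kO.
have Xt0 : row 0 X^T = a *: delta_mx 0 0.
  by rewrite /X !trmx_mul trmxK mulmxA !row_mul Ok kxt -scalemxAl kO.
exact: block_of_corner X0 Xt0.
Qed.

Variable (Gamma : groupType).

(** A group of involutions is commutative.  If one of them, g1, is not
    scalar, its eigenspace for 1 is a line, stable under the others. *)
Lemma common_eigenline (A : Gamma -> 'M[R]_2) :
    (forall g, orthomx_real (A g)) ->
    (forall g h, A (g * h)%g = A g *m A h) ->
    (forall g, A g *m A g = 1%:M) ->
  exists2 u : 'rV[R]_2, u != 0 & forall g, exists c, u *m A g = c *: u.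
Proof.
move=> OA AM AA.
have comm g h : A g *m A h = A h *m A g.
  have := AA (g * h)%g; rewrite AM => e.
  have := congr1 (fun B => A g *m B *m A h) e.
  rewrite mulmx1 !mulmxA AA mul1mx -!mulmxA AA mulmx1 => ->.
  by [].
have [scal|/existsNP[g1 ns]] := pselect (forall g, exists c, A g = c%:M).
  exists (delta_mx 0 0) => [|g].
    by apply/eqP => /matrixP/(_ 0 0)/eqP; rewrite !mxE oner_eq0.
  by have [c ->] := scal g; exists c; rewrite mul_mx_scalar.
pose P := A g1 + 1%:M; pose K := kermx (A g1 - 1%:M).
have P0 : P != 0.
  apply/eqP => /eqP; rewrite addr_eq0 => /eqP Ag; apply: ns; exists (-1).
  by rewrite Ag raddfN.
have [i Pi] : exists i, row i P != 0.
  apply/existsP; rewrite -negb_forall; apply: contra P0 => /forallP Pi.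
  by apply/eqP/row_matrixP => i; rewrite row0; apply/eqP.
exists (row i P) => // g.
have PK : (P <= K)%MS.
  apply/sub_kermxP; rewrite /P mulmxBr !mulmxDl AA !mulmx1 !mul1mx.
  by rewrite [A g1 + _]addrC subrr.
apply: (rank1_stable_line (K := K)) => //.
- rewrite mxrank_ker leq_subLR addn1 ltnS lt0n mxrank_eq0 subr_eq0.
  by apply/eqP => Ag; apply: ns; exists 1.
- exact: submx_trans (row_sub _ _) PK.
- apply/sub_kermxP; rewrite -mulmxA.
  have -> : A g *m (A g1 - 1%:M) = (A g1 - 1%:M) *m A g.
    by rewrite mulmxBr mulmxBl comm mulmx1 mul1mx.
  by rewrite mulmxA mulmx_ker mul0mx.
Qed.

(** Since d is -1 somewhere, det M = - det M = 0, so M has rank 1 or 2.  In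
    rank 1, the row space of M is a line stable under y, and the orthogonal of
    the kernel of M is the required line.  In rank 2, the kernels of M and
    M^T are lines, stable under x and y; let A and B be the blocks of x and y
    on the orthogonals of these lines.  Then B is conjugate to d A, so that
    both lines have the character det A, and the hypothesis on traces says
    that A is an involution where d is -1.  Some
    such A is 1 or -1, because the kernel of M does not have the character d;
    multiplying by it shows that A is an involution where d is 1 too.  All the
    A then have a common eigenline. *)
Lemma common_line (x y : Gamma -> 'M[R]_3) (d : Gamma -> R) (M : 'M[R]_3) :
    (forall g, orthomx_real (x g)) -> (forall g, orthomx_real (y g)) ->
    (forall g h, x (g * h)%g = x g *m x h) ->
    (forall g h, d (g * h)%g = d g * d h) ->
    (forall g, \det (x g) = 1) -> (forall g, \det (y g) = 1) ->
    (forall g, d g ^+ 2 = 1) -> (exists g, d g = -1) ->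
    (forall g, d g = -1 -> (1 + \tr (x g)) * (1 + \tr (y g)) = 0) ->
    (forall v : 'rV_3, (forall g, v *m x g = d g *: v) -> v = 0) ->
    M != 0 -> (forall g, x g *m M = d g *: (M *m y g)) ->
  exists (l : 'rV[R]_3) (eta : Gamma -> R),
    [/\ l *m M != 0, forall g, l *m x g = eta g *: l
      & forall g, eta g ^+ 2 = 1].
Proof.
move=> Ox Oy xM dM dx dy d2 [gm dgm] trxy nox M0 xMy.
have Myx g : M *m y g = d g *: (x g *m M).
  by rewrite xMy scalerA -expr2 d2 scale1r.
have line (l : 'rV_3) : l *m M != 0 -> (forall g, exists a, l *m x g = a *: l) ->
  exists (l : 'rV[R]_3) (eta : Gamma -> R), [/\ l *m M != 0,
    forall g, l *m x g = eta g *: l & forall g, eta g ^+ 2 = 1].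
  move=> lM /choice[eta le]; exists l, eta; split=> // g.
  apply: ortho_scale (Ox g) _ (le g).
  by apply: contraNneq lM => ->; rewrite mul0mx.
(* Compare determinants at gm; the size 3 is odd. *)
have detM : \det M = 0.
  have := congr1 determinant (xMy gm).
  by rewrite detZ !det_mulmx dx dy dgm mul1r mulr1 (_ : (-1) ^+ 3 = -1); [lra|ring].
have rM : (\rank M < 3)%N.
  rewrite ltn_neqAle rank_leq_row andbT; apply: contra_eqN detM => rM.
  by rewrite -unitfE -unitmxE -row_free_unit.
have : (\rank M == 1%N) || (\rank M == 2).
  by move: M0 rM; rewrite -mxrank_eq0; case: (\rank M) => [|[|[|]]].
case/orP => /eqP {}rM.
  have [i Mi] : exists i, row i M != 0.
    apply/existsP; rewrite -negb_forall; apply: contra M0 => /forallP Mi.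
    by apply/eqP/row_matrixP => i; rewrite row0; apply/eqP.
  pose m := row i M.
  have my g : exists a, m *m y g = a *: m.
    apply: (rank1_stable_line (K := M)); rewrite ?rM ?row_sub //.
    by rewrite Myx scalemx_sub // submxMl.
  have mm : m *m m^T != 0.
    by rewrite sqnormE -scalemx1 scaler_eq0 sqnorm_eq0 negb_or Mi oner_eq0.
  have l0 : m *m M^T != 0.
    apply: contraNneq mm => l0; rewrite /m [in X in _ *m X]rowE trmx_mul mulmxA.
    by rewrite l0 mul0mx.
  apply: (line (m *m M^T)).
    apply: contraNneq l0 => /(congr1 (mulmx^~ m^T)).
    rewrite mul0mx -mulmxA -[M in M *m m^T]trmxK -trmx_mul sqnormE => e.
    rewrite -sqnorm_eq0; apply/eqP.
    by have /matrixP/(_ 0 0) := e; rewrite !mxE eqxx mulr1n.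
  move=> g; have [a ma] := my g.
  have Mt : M^T *m x g = d g *: (y g *m M^T).
    have := congr1 trmx (xMy g); rewrite linearZ /= !trmx_mul => e.
    have := congr1 (fun B => y g *m B *m x g) e.
    rewrite -!mulmxA (orthomx_realC (Ox g)) mulmx1 => ->.
    by rewrite -scalemxAl -scalemxAr !mulmxA (Oy g) mul1mx scalerA -expr2 d2 scale1r.
  exists (d g * a); rewrite -mulmxA Mt -scalemxAr mulmxA ma.
  by rewrite -scalemxAl scalerA.
have unit_ker (N : 'M[R]_3) : \rank N = 2 ->
    exists2 k : 'rV[R]_3, sqnorm k = 1 & k *m N = 0.
  move=> rN; have : kermx N != 0 by rewrite -mxrank_eq0 mxrank_ker rN.
  case/rowV0Pn => v /sub_kermxP vN /unit_multiple[c _ cv].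
  by exists (c *: v) => //; rewrite -scalemxAl vN scaler0.
have neq0_unit (k : 'rV[R]_3) : sqnorm k = 1 -> k != 0.
  by move=> k1; rewrite -sqnorm_eq0 k1 oner_eq0.
have [k k1 kM] := unit_ker M rM.
have [n n1 nM] : exists2 n : 'rV[R]_3, sqnorm n = 1 & n *m M^T = 0.
  by apply: unit_ker; rewrite mxrank_tr.
have kx g : exists a, k *m x g = a *: k.
  apply: (rank1_stable_line (K := kermx M)); rewrite ?neq0_unit //.
  - by rewrite mxrank_ker rM.
  - exact/sub_kermxP.
  - by apply/sub_kermxP; rewrite -mulmxA xMy -scalemxAr mulmxA mulmx_ker mul0mx scaler0.
have ny g : exists a, n *m y g = a *: n.
  apply: (rank1_stable_line (K := kermx M^T)); rewrite ?neq0_unit //.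
  - by rewrite mxrank_ker mxrank_tr rM.
  - exact/sub_kermxP.
  - apply/sub_kermxP.
    have e : y g *m M^T = d g *: (M^T *m x g).
      have := congr1 trmx (Myx g); rewrite linearZ /= !trmx_mul => e.
      have := congr1 (fun B => y g *m B *m x g) e.
      rewrite !mulmxA (Oy g) mul1mx => ->.
      rewrite -scalemxAr -scalemxAl -!mulmxA (orthomx_realC (Ox g)) mulmx1.
      by rewrite scalerA -expr2 d2 scale1r.
    by rewrite -mulmxA e -scalemxAr mulmxA mulmx_ker mul0mx scaler0.
have [eta0 {}kx] := choice kx; have [chi {}ny] := choice ny.
have [O1 OO1 rO1] := ortho_with_row k1; have [O2 OO2 rO2] := ortho_with_row n1.
pose A g := drsubmx (O1 *m x g *m O1^T : 'M_(1 + 2)).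
pose B g := drsubmx (O2 *m y g *m O2^T : 'M_(1 + 2)).
have XE g : O1 *m x g *m O1^T = block_mx ((eta0 g)%:M : 'M_1) 0 0 (A g).
  exact: block_of_line (OO1) (Ox g) rO1 (kx g).
have YE g : O2 *m y g *m O2^T = block_mx ((chi g)%:M : 'M_1) 0 0 (B g).
  exact: block_of_line (OO2) (Oy g) rO2 (ny g).
pose N := drsubmx (O1 *m M *m O2^T : 'M_(1 + 2)).
have NE : O1 *m M *m O2^T = block_mx (0 : 'M_1) 0 0 N.
  have r0 : row 0 (O1 *m M *m O2^T) = 0 by rewrite !row_mul rO1 kM mul0mx.
  have c0 : row 0 (O1 *m M *m O2^T)^T = 0.
    by rewrite !trmx_mul trmxK mulmxA !row_mul rO2 nM mul0mx.
  rewrite -[0 : 'M_1](scale0r 1%:M) scalemx1.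
  by apply: block_of_corner; rewrite scale0r.
have O1tO1 := orthomx_realC OO1; have O2tO2 := orthomx_realC OO2.
have Ou n' (O : 'M[R]_n') : orthomx_real O -> O \in unitmx by case/mulmx1_unit.
have Nu : N \in unitmx.
  rewrite -row_free_unit -row_leq_rank.
  have := rank_diag_block_mx (0 : 'M[R]_1) N; rewrite mxrank0 add0n => <-.
  rewrite -NE.
  rewrite mxrankMfree ?row_free_unit ?unitmx_tr ?Ou //.
  by rewrite -mxrank_tr trmx_mul mxrankMfree ?row_free_unit ?unitmx_tr ?Ou // mxrank_tr rM.
have AN g : A g *m N = d g *: (N *m B g).
  have e : (O1 *m x g *m O1^T) *m (O1 *m M *m O2^T)
         = d g *: ((O1 *m M *m O2^T) *m (O2 *m y g *m O2^T)).
    rewrite !mulmxA -(mulmxA _ _ O1) O1tO1 mulmx1 -(mulmxA _ _ O2) O2tO2 mulmx1.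
    by rewrite -(mulmxA O1) xMy -scalemxAr -!scalemxAl !mulmxA.
  move: e; rewrite XE YE NE (@mul_block_diag _ 1 2 _ _ (A g) N).
  rewrite (@mul_block_diag _ 1 2 0 _ N (B g)) (@scale_block_mx _ 1 2 1 2 (d g) _ 0 0 (N *m B g)).
  by move=> /(@eq_block_mx _ 1 2 1 2)[].
have OA g : orthomx_real (A g).
  have : (O1 *m x g *m O1^T) *m (O1 *m x g *m O1^T)^T = 1%:M.
    rewrite !trmx_mul trmxK !mulmxA -(mulmxA _ _ O1) O1tO1 mulmx1.
    by rewrite -(mulmxA O1) Ox mulmx1 OO1.
  rewrite XE (tr_block_mx ((eta0 g)%:M : 'M_1) 0 0 (A g)) !trmx0.
  rewrite (@mul_block_diag _ 1 2 _ _ (A g) (A g)^T) (scalar_mx_block 1 2).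
  by move=> /(@eq_block_mx _ 1 2 1 2)[].
have AM g h : A (g * h)%g = A g *m A h.
  have : O1 *m x (g * h)%g *m O1^T = (O1 *m x g *m O1^T) *m (O1 *m x h *m O1^T).
    by rewrite xM !mulmxA -(mulmxA _ _ O1) O1tO1 mulmx1.
  rewrite !XE (@mul_block_diag _ 1 2 _ _ (A g) (A h)).
  by move=> /(@eq_block_mx _ 1 2 1 2)[].
have eta2 g : eta0 g ^+ 2 = 1 by apply: ortho_scale (Ox g) (neq0_unit _ k1) (kx g).
have conjE n' (O z : 'M[R]_n') : orthomx_real O ->
    \det (O *m z *m O^T) = \det z /\ \tr (O *m z *m O^T) = \tr z.
  move=> OO; split; last by rewrite mxtrace_mulC mulmxA (orthomx_realC OO) mul1mx.
  by rewrite !det_mulmx mulrC mulrA -det_mulmx (orthomx_realC OO) det1 mul1r.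
have detA g : \det (A g) = eta0 g.
  have [e _] := conjE _ O1 (x g) OO1; move: e; rewrite XE dx.
  rewrite (det_ublock ((eta0 g)%:M : 'M_1) 0 (A g)) det_scalar1 => e.
  by rewrite -[LHS]mul1r -(eta2 g) expr2 -mulrA e mulr1.
(* N is invertible and A N = d N B, in size 2 where d^2 = 1. *)
have detB g : \det (B g) = eta0 g.
  have := congr1 determinant (AN g); rewrite detZ !det_mulmx d2 mul1r mulrC.
  by rewrite detA => /mulfI <- //; rewrite -unitfE -unitmxE.
have chiE g : chi g = eta0 g.
  have [e _] := conjE _ O2 (y g) OO2; move: e; rewrite YE dy.
  rewrite (det_ublock ((chi g)%:M : 'M_1) 0 (B g)) det_scalar1 detB => e.
  by rewrite -[LHS]mulr1 -(eta2 g) expr2 mulrA e mul1r.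
have trA g : \tr (x g) = eta0 g + \tr (A g).
  by have [_ <-] := conjE _ O1 (x g) OO1; rewrite XE (mxtrace_block ((eta0 g)%:M : 'M_1) 0 0 (A g)) mxtrace_scalar.
have trB g : \tr (y g) = eta0 g + d g * \tr (A g).
  have [_ <-] := conjE _ O2 (y g) OO2; rewrite YE (mxtrace_block ((chi g)%:M : 'M_1) 0 0 (B g)) mxtrace_scalar chiE.
  congr (_ + _); have -> : B g = d g *: (invmx N *m A g *m N).
    by rewrite -mulmxA AN -scalemxAr scalerA -expr2 d2 scale1r mulKmx.
  by rewrite linearZ /= -mulmxA mxtrace_mulC mulmxK.
have invA g : d g = -1 -> A g *m A g = 1%:M /\ (eta0 g = 1 -> exists s, A g = s%:M).
  move=> dg; rewrite -detA; apply: ortho2_involution (OA g) _.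
  by have := trxy g dg; rewrite trA trB dg detA mulN1r !addrA.
have d_sign g : d g = 1 \/ d g = -1.
  exact: sqr1_sign.
have eta_sign g : eta0 g = 1 \/ eta0 g = -1.
  exact: sqr1_sign.
have etaM g h : eta0 (g * h)%g = eta0 g * eta0 h.
  by rewrite -!detA AM det_mulmx.
(* Here A delta is the scalar 1 or -1. *)
have [delta dd ed] : exists2 delta, d delta = -1 & eta0 delta = 1.
  have [g dg] : exists g, d g != eta0 g.
    apply: contrapT => /forallNP de; have /eqP := neq0_unit _ k1; apply.
    apply: nox => g; rewrite kx; congr (_ *: _); apply/esym/eqP.
    exact/negPn/negP/de.
  have [dg1|dg1] := d_sign g; last first.
    by exists g => //; move: dg; rewrite dg1; have [->|->] := eta_sign g; rewrite ?eqxx.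
  have eg : eta0 g = -1.
    by move: dg; rewrite dg1; have [->|->] := eta_sign g; rewrite ?eqxx.
  have [em|em] := eta_sign gm; first by exists gm.
  exists (gm * g)%g; first by rewrite dM dgm dg1 mulr1.
  by rewrite etaM em eg mulrNN mulr1.
have AA g : A g *m A g = 1%:M.
  have [dg|/invA[]//] := d_sign g.
  have [s As] := (invA _ dd).2 ed.
  have := (invA _ dd).1; rewrite As -scalar_mxM => s2.
  have := (invA (delta * g)%g _).1; rewrite dM dd dg mulr1 => /(_ erefl).
  rewrite AM As mul_scalar_mx -scalemxAl -scalemxAr scalerA => e.
  by rewrite -[LHS]mul1mx -s2 mul_scalar_mx e.
have [u u0 uA] := common_eigenline OA AM AA.
pose l : 'rV[R]_(1 + 2) := row_mx 0 u.
apply: (line (l *m O1)).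
  have -> : l *m O1 *m M = (l *m (O1 *m M *m O2^T)) *m O2.
    by rewrite !mulmxA -(mulmxA _ _ O2) O2tO2 mulmx1.
  rewrite NE (@mul_row_block _ 1 1 2 1 2 0 u 0 0 0 N) !mul0mx !mulmx0 !addr0 add0r.
  apply/eqP => /(congr1 (mulmx^~ O2^T)); rewrite -mulmxA OO2 mulmx1 mul0mx.
  move=> e; have := etrans e (esym (@row_mx0 R 1 1 2)).
  move=> /(@eq_row_mx _ 1 1 2)[_] /(congr1 (mulmx^~ (invmx N))).
  by rewrite mulmxK // mul0mx; apply/eqP.
move=> g; have [c uc] := uA g; exists c.
have -> : l *m O1 *m x g = l *m (O1 *m x g *m O1^T) *m O1.
  by rewrite !mulmxA -(mulmxA _ _ O1) O1tO1 mulmx1.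
rewrite XE (@mul_row_block _ 1 1 2 1 2 0 u _ 0 0 (A g)) !mul0mx !mulmx0 !addr0 add0r uc.
by rewrite scalemxAl (@scale_row_mx _ 1 1 2 c 0 u) scaler0.
Qed.

End CommonLine.

(** * The adjoint action of U(2) on traceless Hermitian matrices *)

Lemma unitary_conjM (C : numClosedFieldType) n (U A B : 'M[C]_n) :
  U \is unitarymx ->
  (U ^t* *m A *m U) *m (U ^t* *m B *m U) = U ^t* *m (A *m B) *m U.
Proof.
by move=> /unitarymxP UU; rewrite !mulmxA -(mulmxA _ U) UU mulmx1.
Qed.

Lemma unitary_conj_tr (C : numClosedFieldType) n (U A : 'M[C]_n) :
  U \is unitarymx -> \tr (U ^t* *m A *m U) = \tr A.
Proof.
by move=> /unitarymxP UU; rewrite mxtrace_mulC mulmxA UU mul1mx.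
Qed.

Section HermitianAdjoint.

Variable (R : realType).
Local Notation C := R[i].
Local Notation "x %:C" := (real_complex R x).

Definition ord3_2 : 'I_3 := @Ordinal 3 2 isT.

Lemma big_ord3 (V : nmodType) (F : 'I_3 -> V) :
  \sum_i F i = F 0 + F 1 + F ord3_2.
Proof.
rewrite !big_ord_recl big_ord0 addr0 addrA.
by congr (F _ + F _ + F _); apply: val_inj.
Qed.

Lemma ord3P (P : 'I_3 -> Prop) : P 0 -> P 1 -> P ord3_2 -> forall i, P i.
Proof.
move=> P0 P1 P2 [[|[|[|//]]] lt].
- by rewrite (_ : Ordinal lt = 0) //; apply: val_inj.
- by rewrite (_ : Ordinal lt = 1) //; apply: val_inj.
- by rewrite (_ : Ordinal lt = ord3_2) //; apply: val_inj.
Qed.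

(** The linear combinations of the Pauli matrices. *)
Definition herm (v : 'rV[R]_3) : 'M[C]_2 :=
  mx2 (v 0 ord3_2)%:C (Complex (v 0 0) (- v 0 1))
      (Complex (v 0 0) (v 0 1)) (- v 0 ord3_2)%:C.

Definition herm_coord (H : 'M[C]_2) : 'rV[R]_3 :=
  \row_i nth 0 [:: complex.Re (H 1 0); complex.Im (H 1 0); complex.Re (H 0 0)] i.

Lemma herm_coordK : cancel herm herm_coord.
Proof. by move=> v; apply/rowP; elim/ord3P; rewrite !mxE. Qed.

Lemma mx2_trC (a b c e : C) : (mx2 a b c e) ^t* = mx2 a^* c^* b^* e^*.
Proof. by rewrite mx2_tr map_mx2. Qed.

Lemma conj_Complex (a b : R) : (Complex a b)^* = Complex a (- b).
Proof. by []. Qed.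

Lemma hermK (H : 'M[C]_2) : H ^t* = H -> \tr H = 0 -> herm (herm_coord H) = H.
Proof.
rewrite [H]mx2_eta mx2_trC mxtrace2 /herm !mxE /=.
case: (H 0 0) (H 0 1) (H 1 0) (H 1 1) => [a a'] [b b'] [c c'] [e e'].
rewrite !conj_Complex => /mx2_inj[[h1] [h2 h3] [h4 h5] [h6]] [h7 h8].
by congr mx2; apply/eqP; rewrite eq_complex /=; apply/andP; split; apply/eqP; lra.
Qed.

Lemma herm_trC v : (herm v) ^t* = herm v.
Proof.
by rewrite /herm mx2_trC !conj_Complex; congr mx2;
  apply/eqP; rewrite eq_complex /=; apply/andP; split; apply/eqP; ring.
Qed.

Lemma herm_trace v : \tr (herm v) = 0.
Proof.
by rewrite /herm mxtrace2; apply/eqP; rewrite eq_complex /=; apply/andP; split;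
  apply/eqP; ring.
Qed.

Lemma herm_linear a u v : herm (a *: u + v) = a%:C *: herm u + herm v.
Proof.
by rewrite /herm mx2Z mx2D !mxE; congr mx2; apply/eqP;
  rewrite eq_complex /=; apply/andP; split; apply/eqP; ring.
Qed.

Lemma herm0 : herm 0 = 0.
Proof.
have := herm_linear 1 0 0; rewrite scale1r addr0 scale1r => /eqP.
by rewrite -subr_eq0 opprD addrA subrr sub0r oppr_eq0 => /eqP.
Qed.

Lemma hermZ a v : herm (a *: v) = a%:C *: herm v.
Proof. by rewrite -[a *: v]addr0 herm_linear herm0 addr0. Qed.

Lemma herm_mul n (v : 'rV[R]_n) (A : 'M[R]_(n, 3)) :
  herm (v *m A) = \sum_i (v 0 i)%:C *: herm (row i A).
Proof.
rewrite mulmx_sum_row; elim/big_rec2: _ => [|i H u _ <-]; first exact: herm0.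
by rewrite herm_linear.
Qed.

Lemma herm_eq0 v : (herm v == 0) = (v == 0).
Proof.
by apply/eqP/eqP => [v0|->]; [apply: (can_inj herm_coordK); rewrite v0|]; rewrite herm0.
Qed.

Definition sigma (i : 'I_3) := herm (delta_mx 0 i).

(** The double cover of SO(3), in the basis of the Pauli matrices. *)
Definition Ad (U : 'M[C]_2) : 'M[R]_3 :=
  \matrix_i herm_coord (U ^t* *m sigma i *m U).

Lemma herm_conj (U : 'M[C]_2) H : U \is unitarymx -> H ^t* = H -> \tr H = 0 ->
  herm (herm_coord (U ^t* *m H *m U)) = U ^t* *m H *m U.
Proof.
move=> uU Hh tH; apply: hermK; first by rewrite !trmxC_mul trmxCK Hh mulmxA.
by rewrite mxtrace_mulC mulmxA (unitarymxP uU) mul1mx.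
Qed.

Lemma herm_Ad (U : 'M[C]_2) v : U \is unitarymx ->
  herm (v *m Ad U) = U ^t* *m herm v *m U.
Proof.
move=> uU; rewrite herm_mul -[v in RHS]mulmx1 herm_mul mulmx_sumr mulmx_suml.
apply: eq_bigr => i _; rewrite rowK herm_conj ?herm_trC ?herm_trace //.
by rewrite -scalemxAr -scalemxAl row1.
Qed.

Lemma Ad_mul (U V : 'M[C]_2) : U \is unitarymx -> V \is unitarymx ->
  Ad (U *m V) = Ad U *m Ad V.
Proof.
move=> uU uV; apply/row_matrixP => i; rewrite !rowE.
apply: (can_inj herm_coordK); rewrite [_ *m (_ *m _)]mulmxA.
rewrite (herm_Ad _ uV) (herm_Ad _ uU) (herm_Ad _ (mul_unitarymx uU uV)).
by rewrite trmxC_mul !mulmxA.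
Qed.

Lemma herm_dot u v : \tr (herm u *m herm v) = (2 * (u *m v^T) 0 0)%:C.
Proof.
rewrite /herm mx2M mxtrace2 mxE big_ord3 !mxE.
by apply/eqP; rewrite eq_complex /=; apply/andP; split; apply/eqP; ring.
Qed.

Lemma Ad_ortho (U : 'M[C]_2) : U \is unitarymx -> orthomx_real (Ad U).
Proof.
move=> uU.
have e (v w : 'rV_3) : (v *m Ad U *m (w *m Ad U)^T) 0 0 = (v *m w^T) 0 0 :> R.
    apply: (mulfI (x := 2)); first by rewrite pnatr_eq0.
    apply: (@complexI R); rewrite -!herm_dot !herm_Ad //.
    by rewrite unitary_conjM // unitary_conj_tr.
apply/matrixP => i j; have := e (delta_mx 0 i) (delta_mx 0 j).
rewrite trmx_mul mulmxA -(mulmxA _ (Ad U)) trmx_delta mul_delta_mx_cond -rowE -colE.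
by rewrite !mxE mulrb; case: (i == j); rewrite ?mxE.
Qed.

Lemma det3 (K : comNzRingType) (A : 'M[K]_3) : \det A =
  A 0 0 * (A 1 1 * A ord3_2 ord3_2 - A 1 ord3_2 * A ord3_2 1)
  - A 0 1 * (A 1 0 * A ord3_2 ord3_2 - A 1 ord3_2 * A ord3_2 0)
  + A 0 ord3_2 * (A 1 0 * A ord3_2 1 - A 1 1 * A ord3_2 0).
Proof.
rewrite (expand_det_row _ 0) big_ord3 /cofactor.
have E (B : 'M[K]_2) : \det B = B 0 0 * B 1 1 - B 0 1 * B 1 0.
  by rewrite {1}[B]mx2_eta det_mx2.
rewrite !E !mxE /=.
have -> : lift (0 : 'I_3) (0 : 'I_2) = 1 by apply: val_inj.
have -> : lift (0 : 'I_3) (1 : 'I_2) = ord3_2 by apply: val_inj.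
have -> : lift (1 : 'I_3) (0 : 'I_2) = 0 by apply: val_inj.
have -> : lift (1 : 'I_3) (1 : 'I_2) = ord3_2 by apply: val_inj.
have -> : lift ord3_2 (0 : 'I_2) = 0 by apply: val_inj.
have -> : lift ord3_2 (1 : 'I_2) = 1 by apply: val_inj.
by rewrite expr0 expr1 [(-1) ^+ 2]expr2; ring.
Qed.

(** The product of the three Pauli matrices is i. *)
Lemma herm_det (A : 'M[R]_3) :
  \tr (herm (row 0 A) *m herm (row 1 A) *m herm (row ord3_2 A))
  = Complex 0 (2 * \det A).
Proof.
rewrite /herm !mx2M mxtrace2 det3 !mxE.
by apply/eqP; rewrite eq_complex /=; apply/andP; split; apply/eqP; ring.
Qed.

(** The trace of a product of three matrices is invariant under conjugation,
    and on traceless Hermitian matrices it is 2 i times their determinant as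
    vectors. *)
Lemma det_Ad (U : 'M[C]_2) : U \is unitarymx -> \det (Ad U) = 1.
Proof.
move=> uU.
have := herm_det 1%:M; rewrite !row1 det1 mulr1 => h.
have := herm_det (Ad U); rewrite !rowE !herm_Ad //.
rewrite !unitary_conjM // unitary_conj_tr // h.
case=> h2; apply/esym/(mulfI (x := 2)); first by rewrite pnatr_eq0.
by rewrite mulr1.
Qed.

End HermitianAdjoint.

(** * A character shared by two representations of dimension 2 *)

Section TensorSquare.

Variable (K : comNzRingType).

Lemma tensmx_linearl m n p q a (A A' : 'M[K]_(m, n)) (B : 'M[K]_(p, q)) :
  tensmx (a *: A + A') B = a *: tensmx A B + tensmx A' B.
Proof. by apply/matrixP => i j; rewrite !mxE; ring. Qed.

Lemma tensmx_linearr m n p q a (A : 'M[K]_(m, n)) (B B' : 'M[K]_(p, q)) :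
  tensmx A (a *: B + B') = a *: tensmx A B + tensmx A B'.
Proof. by apply/matrixP => i j; rewrite !mxE; ring. Qed.

Lemma tensmx_delta m n p q i j k l :
  tensmx (delta_mx i j : 'M[K]_(m, n)) (delta_mx k l : 'M[K]_(p, q))
  = delta_mx (mxtens_index (i, k)) (mxtens_index (j, l)).
Proof.
apply/matrixP => a b.
case: (mxtens_indexP a) => a1 a2; case: (mxtens_indexP b) => b1 b2.
rewrite tensmxE !mxE !(can_eq (@mxtens_indexK _ _)) !xpair_eqE.
by rewrite -natrM mulnb andbACA.
Qed.

Lemma tensmx1 m n : tensmx 1%:M 1%:M = 1%:M :> 'M[K]_(m * n).
Proof.
apply/matrixP => a b.
case: (mxtens_indexP a) => a1 a2; case: (mxtens_indexP b) => b1 b2.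
by rewrite tensmxE !mxE !(can_eq (@mxtens_indexK _ _)) !xpair_eqE -natrM mulnb.
Qed.

Lemma mxtrace_tens m n (A : 'M[K]_m) (B : 'M[K]_n) :
  \tr (tensmx A B) = \tr A * \tr B.
Proof. by rewrite /mxtrace mulr_sum; apply: eq_bigr => i _; rewrite mxE. Qed.

Lemma trace_mul_delta m n (A : 'M[K]_(m, n)) p q :
  \tr (A *m delta_mx p q) = A q p.
Proof.
rewrite /mxtrace (bigD1 q) //= big1 => [|i /negPf iq].
  rewrite mxE (bigD1 p) //= !mxE !eqxx mulr1 big1 => [|k /negPf kp].
    by rewrite !addr0.
  by rewrite !mxE kp mulr0.
by rewrite mxE big1 // => k _; rewrite !mxE iq andbF mulr0.
Qed.

End TensorSquare.

Section CommonCharacter.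

Variable (R : realType).
Local Notation C := R[i].
Local Notation "x %:C" := (real_complex R x).
Variable (Gamma : groupType).

Lemma urep_tens m n (V : Gamma -> 'M[C]_m) (W : Gamma -> 'M[C]_n) :
  urep V -> urep W -> urep (fun g => tensmx (V g) (W g)).
Proof.
move=> [uV V1 VM] [uW W1 WM]; split=> [g||g h].
- apply/unitarymxP; rewrite trmx_tens map_mxT tensmx_mul.
  by rewrite !(unitarymxP _) ?tensmx1.
- by rewrite V1 W1 tensmx1.
- by rewrite VM WM tensmx_mul.
Qed.

(** 1 + tr (Ad U) is the squared modulus of tr U: both are the trace of the
    conjugation by U on the space of 2 x 2 matrices. *)
Lemma Ad_trace (U : 'M[C]_2) : U \is unitarymx -> \tr U = 0 ->
  1 + \tr (Ad U) = 0.
Proof.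
have s0 : sigma R 0 = mx2 0 1 1 0.
  by rewrite /sigma /herm !mxE /=; congr mx2; apply/eqP; rewrite eq_complex /=
    ?oppr0 ?eqxx.
have s1 : sigma R 1 = mx2 0 (Complex 0 (-1)) (Complex 0 1) 0.
  by rewrite /sigma /herm !mxE /=; congr mx2; apply/eqP; rewrite eq_complex /=
    ?oppr0 ?eqxx.
have s2 : sigma R ord3_2 = mx2 1 0 0 (-1).
  by rewrite /sigma /herm !mxE /=; congr mx2; apply/eqP; rewrite eq_complex /=
    ?oppr0 ?eqxx.
have AdE i : Ad U i i = herm_coord (U ^t* *m sigma R i *m U) 0 i by rewrite mxE.
rewrite /mxtrace big_ord3 !AdE s0 s1 s2 -/(mxtrace U).
have cE (i : 'I_3) (a b c e : C) : herm_coord (mx2 a b c e) 0 i =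
    nth 0 [:: complex.Re c; complex.Im c; complex.Re a] i by rewrite !mxE.
move=> /unitarymxP; rewrite [U]mx2_eta mx2_trC !mx2M mxtrace2 mx2_scalar !cE /=.
case/mx2_inj.
case: (U 0 0) (U 0 1) (U 1 0) (U 1 1) => [a a'] [b b'] [c c'] [e e'] /=.
move=> [h1 _] _ _ [h2 _] [h3 h4]; nra.
Qed.

Section RealPart.

Variable P : C -> R.
Hypothesis P_lin : forall a z w, P (a%:C * z + w) = a * P z + P w.

Lemma real_part0 : P 0 = 0.
Proof.
have := P_lin 0 0 0; rewrite mul0r addr0 => ->; rewrite mul0r add0r.
have := P_lin 1 0 0; rewrite mulr0 addr0 mul1r => /eqP.
by rewrite -subr_eq0 opprD addrA subrr sub0r oppr_eq0 => /eqP.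
Qed.

(** In this section P is the real or the imaginary part. *)
Lemma real_functional (F : 'M[C]_2 -> C) v :
    (forall a A B, F (a *: A + B) = a * F A + F B) ->
  P (F (herm v)) = \sum_i v 0 i * P (F (sigma R i)).
Proof.
move=> Flin; have F0 : F 0 = 0.
  have := Flin 1 0 0; rewrite scale1r addr0 mul1r => /eqP.
  by rewrite -subr_eq0 opprD addrA subrr sub0r oppr_eq0 => /eqP.
rewrite -[v in LHS]mulmx1 herm_mul.
elim/big_rec2: _ => [|i r H _ <-]; first by rewrite F0 real_part0.
by rewrite row1 Flin P_lin.
Qed.

(** A functional with the equivariance d is given on traceless Hermitian
    matrices by a vector with the character d under the adjoint action, and
    there is no such vector. *)
Lemma functional_vanishes (F : 'M[C]_2 -> C) (X : Gamma -> 'M[C]_2)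
    (d : Gamma -> R) :
    (forall a A B, F (a *: A + B) = a * F A + F B) ->
    (forall g, X g \is unitarymx) -> (forall g, d g ^+ 2 = 1) ->
    (forall g A, F ((X g) ^t* *m A *m X g) = (d g)%:C * F A) ->
    (forall v : 'rV_3, (forall g, v *m Ad (X g) = d g *: v) -> v = 0) ->
  forall v, P (F (herm v)) = 0.
Proof.
move=> Flin uX d2 FX nox v; pose w := \row_i P (F (sigma R i)).
have E u : P (F (herm u)) = (u *m w^T) 0 0.
  by rewrite real_functional // mxE; apply: eq_bigr => i _; rewrite !mxE.
suff w0 : w = 0 by rewrite E w0 trmx0 mulmx0 mxE.
apply: nox => g; have OX := Ad_ortho (uX g).
have e : Ad (X g) *m w^T = d g *: w^T.
  apply/matrixP => i j; rewrite !ord1.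
  have : P (F (herm (delta_mx 0 i *m Ad (X g)))) = d g * P (F (sigma R i)).
    rewrite herm_Ad // FX.
    by have := P_lin (d g) (F (sigma R i)) 0; rewrite addr0 real_part0 addr0.
  by rewrite E -mulmxA -rowE mxE => ->; rewrite !mxE.
have := congr1 trmx e; rewrite trmx_mul trmxK linearZ /= trmxK => {}e.
have := congr1 (fun u => d g *: (u *m Ad (X g))) e.
rewrite -mulmxA (orthomx_realC OX) mulmx1 -scalemxAl scalerA -expr2 d2 scale1r.
by move=> <-.
Qed.

Lemma bilinear_matrix (G : 'M[C]_2 -> 'M[C]_2 -> C) u v :
    (forall B a A A', G (a *: A + A') B = a * G A B + G A' B) ->
    (forall A a B B', G A (a *: B + B') = a * G A B + G A B') ->
  P (G (herm u) (herm v))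
  = (u *m (\matrix_(i, j) P (G (sigma R i) (sigma R j))) *m v^T) 0 0.
Proof.
move=> Gl Gr; rewrite (real_functional u (Gl (herm v))) -mulmxA mxE.
apply: eq_bigr => i _; rewrite (real_functional v (Gr (sigma R i))) mxE.
by congr (_ * _); apply: eq_bigr => j _; rewrite !mxE mulrC.
Qed.

End RealPart.

(** A 2 x 2 matrix is a scalar plus a traceless matrix, and the latter is a
    combination of two Hermitian ones, its real and its imaginary part. *)
Lemma functional_eq0 (F : 'M[C]_2 -> C) :
    (forall a A B, F (a *: A + B) = a * F A + F B) ->
    F 1%:M = 0 -> (forall v, F (herm v) = 0) -> forall A, F A = 0.
Proof.
move=> Flin F1 Fh A.
pose z := \tr A / 2; pose A0 := A - z%:M.
pose H1 := A0 + A0 ^t*; pose H2 := 'i *: (A0 - A0 ^t*).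
have trA0 : \tr A0 = 0.
  by rewrite raddfB /= mxtrace_scalar -mulr_natr divfK ?pnatr_eq0 // subrr.
have trA0t : \tr (A0 ^t*) = 0 by rewrite trace_map_mx mxtrace_tr trA0 rmorph0.
have H1E : herm (herm_coord H1) = H1.
  apply: hermK; first by rewrite /H1 raddfD /= map_mxD trmxCK addrC.
  by rewrite raddfD /= trA0 trA0t addr0.
have H2E : herm (herm_coord H2) = H2.
  apply: hermK; last by rewrite linearZ /= raddfB /= trA0 trA0t subrr mulr0.
  rewrite /H2 linearZ /= map_mxZ raddfB /= map_mxB trmxCK conjCi.
  by rewrite scaleNr -scalerN opprB.
have F0 : F 0 = 0.
  have := Flin 1 0 0; rewrite scale1r addr0 mul1r => /eqP.
  by rewrite -subr_eq0 opprD addrA subrr sub0r oppr_eq0 => /eqP.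
have AE : A = z *: 1%:M + (2^-1 *: H1 + ((- 'i / 2) *: H2 + 0)).
  rewrite addr0 scalemx1 /H2 scalerA.
  have -> : - 'i / 2 * 'i = 2^-1 :> C.
    by rewrite mulrAC mulNr -expr2 sqrCi opprK mul1r.
  rewrite -scalerDr /H1 addrACA subrr addr0 scalerDr -scalerDl.
  have -> : 2^-1 + 2^-1 = 1 :> C by rewrite -[2^-1]mul1r -splitr.
  by rewrite scale1r addrC subrK.
by rewrite AE !Flin F1 F0 -H1E -H2E !Fh !mulr0 !addr0.
Qed.

(** X (x) Y and d X (x) Y have the same trace, hence a nonzero intertwiner T.
    The bilinear form G(A, B) = tr(T (A (x) B)) is multiplied by d when X
    conjugates A and Y conjugates B.  It vanishes at (1, 1), and at
    (A, 1) and (1, B) by the last two hypotheses, so the real or the imaginary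
    part of G is nonzero on pairs of traceless Hermitian matrices: this is the
    matrix M of [common_line]. *)
Lemma common_character (X Y : Gamma -> 'M[C]_2) (d : Gamma -> R) :
    urep X -> urep Y ->
    (forall g, d g ^+ 2 = 1) -> (forall g h, d (g * h)%g = d g * d h) ->
    (exists g, d g = -1) ->
    (forall g, d g = -1 -> \tr (X g) = 0 \/ \tr (Y g) = 0) ->
    (forall v : 'rV_3, (forall g, v *m Ad (X g) = d g *: v) -> v = 0) ->
    (forall v : 'rV_3, (forall g, v *m Ad (Y g) = d g *: v) -> v = 0) ->
  exists (l m : 'rV[R]_3) (eta : Gamma -> R),
    [/\ l != 0, m != 0, forall g, l *m Ad (X g) = eta g *: l,
        forall g, m *m Ad (Y g) = (d g * eta g) *: m
      & forall g, eta g ^+ 2 = 1].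
Proof.
move=> rX rY d2 dM [gm dgm] trXY nox noy.
have [[uX X1 XM] [uY Y1 YM]] := (rX, rY).
have d1 : d 1%g = 1.
  have := dM 1%g 1%g; rewrite mulg1 => /esym; rewrite -[RHS]mulr1 => /mulfI; apply.
  by rewrite -sqrf_eq0 d2 oner_eq0.
have dsign g : d g = 1 \/ d g = -1 by exact: sqr1_sign.
pose V g := tensmx (X g) (Y g); have rV : urep V by exact: urep_tens.
have rW : urep (fun g => (d g)%:C *: V g).
  have [uV V1 VM] := rV; split=> [g||g h].
  - apply/unitarymxP; rewrite linearZ /= map_mxZ -scalemxAl -scalemxAr scalerA.
    rewrite (unitarymxP (uV g)) [X in X *: _](_ : _ = 1) ?scale1r //.
    rewrite [X in _ * X]conj_Complex oppr0.
    by rewrite -[RHS](rmorph1 (real_complex R)) -(d2 g) expr2 rmorphM.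
  - by rewrite d1 V1 rmorph1 scale1r.
  - by rewrite dM VM rmorphM -scalemxAl -scalemxAr scalerA.
have trVW g : \tr (V g) = \tr ((d g)%:C *: V g).
  rewrite linearZ /= mxtrace_tens; have [->|dg] := dsign g.
    by rewrite rmorph1 mul1r.
  by have [->|->] := trXY g dg; rewrite ?mul0r !mulr0.
have [T T0 VT] := intertwiner_of_trace rV rW isT trVW.
pose G A B := \tr (T *m tensmx A B).
have Gl B a A A' : G (a *: A + A') B = a * G A B + G A' B.
  by rewrite /G tensmx_linearl mulmxDr -scalemxAr raddfD /= linearZ.
have Gr A a B B' : G A (a *: B + B') = a * G A B + G A B'.
  by rewrite /G tensmx_linearr mulmxDr -scalemxAr raddfD /= linearZ.
have GXY g A B : G ((X g) ^t* *m A *m X g) ((Y g) ^t* *m B *m Y g)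
    = (d g)%:C * G A B.
  rewrite /G -!tensmx_mul -[tensmx (X g) (Y g)]/(V g).
  have -> : tensmx ((X g) ^t*) ((Y g) ^t*) = (V g) ^t*.
    by rewrite trmx_tens map_mxT.
  rewrite !mulmxA mxtrace_mulC !mulmxA VT -scalemxAr -!scalemxAl linearZ /=.
  have [uV _ _] := rV; have /unitarymxP VV := uV g.
  by rewrite -(mulmxA T) VV mulmx1.
have Re_lin (a : R) (z w : C) :
    complex.Re (a%:C * z + w) = a * complex.Re z + complex.Re w.
  by case: z w => [? ?] [? ?] /=; ring.
have Im_lin (a : R) (z w : C) :
    complex.Im (a%:C * z + w) = a * complex.Im z + complex.Im w.
  by case: z w => [? ?] [? ?] /=; ring.
have UU n (U : 'M[C]_n) : U \is unitarymx -> U ^t* *m 1%:M *m U = 1%:M.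
  by rewrite mulmx1 -trmxC_unitary => /unitarymxP; rewrite trmxCK.
have G11 : G 1%:M 1%:M = 0.
  have := GXY gm 1%:M 1%:M; rewrite !UU // dgm => /eqP.
  rewrite rmorphN rmorph1 mulN1r -subr_eq0 opprK -mulr2n -mulr_natl mulf_eq0.
  by rewrite pnatr_eq0 /= => /eqP.
have cplx0 (z : C) : complex.Re z = 0 -> complex.Im z = 0 -> z = 0.
  by case: z => /= ? ? -> ->.
have Gh1 v : G (herm v) 1%:M = 0.
  have inv g A : G ((X g) ^t* *m A *m X g) 1%:M = (d g)%:C * G A 1%:M.
    by rewrite -GXY UU.
  apply: cplx0.
    exact: (functional_vanishes Re_lin (Gl 1%:M) uX d2 inv nox).
  exact: (functional_vanishes Im_lin (Gl 1%:M) uX d2 inv nox).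
have G1h v : G 1%:M (herm v) = 0.
  have inv g A : G 1%:M ((Y g) ^t* *m A *m Y g) = (d g)%:C * G 1%:M A.
    by rewrite -GXY UU.
  apply: cplx0.
    exact: (functional_vanishes Re_lin (Gr 1%:M) uY d2 inv noy).
  exact: (functional_vanishes Im_lin (Gr 1%:M) uY d2 inv noy).
have line (P : C -> R) (P_lin : forall a z w, P (a%:C * z + w) = a * P z + P w) :
    (exists u v, P (G (herm u) (herm v)) != 0) ->
  exists (l m : 'rV[R]_3) (eta : Gamma -> R),
    [/\ l != 0, m != 0, forall g, l *m Ad (X g) = eta g *: l,
        forall g, m *m Ad (Y g) = (d g * eta g) *: m
      & forall g, eta g ^+ 2 = 1].
  move=> [u0 [v0 Puv]].
  pose M := \matrix_(i, j) P (G (sigma R i) (sigma R j)).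
  have ME u v : P (G (herm u) (herm v)) = (u *m M *m v^T) 0 0.
    exact: (bilinear_matrix P_lin u v Gl Gr).
  have M0 : M != 0.
    by apply: contraNneq Puv => M0; rewrite ME M0 mulmx0 mul0mx mxE.
  have xMy g : Ad (X g) *m M = d g *: (M *m Ad (Y g)).
    have e : Ad (X g) *m M *m (Ad (Y g))^T = d g *: M.
      apply/matrixP => i j.
      have := ME (delta_mx 0 i *m Ad (X g)) (delta_mx 0 j *m Ad (Y g)).
      rewrite !herm_Ad // GXY.
      have := P_lin (d g) (G (sigma R i) (sigma R j)) 0.
      rewrite addr0 (real_part0 P_lin) addr0 => ->.
      have -> : P (G (sigma R i) (sigma R j)) = M i j by rewrite mxE.
      rewrite trmx_mul trmx_delta !mulmxA -!(mulmxA (delta_mx 0 i)) -rowE -colE.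
      by rewrite !mxE => ->; apply: eq_bigr => k _; rewrite !mxE.
    have := congr1 (mulmx^~ (Ad (Y g))) e.
    by rewrite -mulmxA (orthomx_realC (Ad_ortho (uY g))) mulmx1 -scalemxAl.
  have [] := @common_line R Gamma (fun g => Ad (X g)) (fun g => Ad (Y g)) d M.
  - by move=> g; apply: Ad_ortho.
  - by move=> g; apply: Ad_ortho.
  - by move=> g h; rewrite XM Ad_mul.
  - exact: dM.
  - by move=> g; apply: det_Ad.
  - by move=> g; apply: det_Ad.
  - exact: d2.
  - by exists gm.
  - by move=> g /trXY[tr0|tr0]; rewrite (Ad_trace _ tr0) ?mul0r ?mulr0.
  - exact: nox.
  - exact: M0.
  - exact: xMy.
  move=> l [eta [lM lX eta2]]; exists l, (l *m M), eta; split=> // [|g].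
    by apply: contraNneq lM => ->; rewrite mul0mx.
  rewrite -mulmxA; have -> : M *m Ad (Y g) = d g *: (Ad (X g) *m M).
    by rewrite xMy scalerA -expr2 d2 scale1r.
  by rewrite -scalemxAr mulmxA lX -scalemxAl scalerA.
have [ex|nex] := pselect (exists u v, complex.Re (G (herm u) (herm v)) != 0).
  exact: line Re_lin ex.
have [ex'|nex'] := pselect (exists u v, complex.Im (G (herm u) (herm v)) != 0).
  exact: line Im_lin ex'.
have Ghh u v : G (herm u) (herm v) = 0.
  apply: cplx0; apply/eqP/negPn/negP => h; [apply: nex|apply: nex'];
    by exists u, v.
have GA B A : G A B = 0.
  apply: (functional_eq0 (Gl B)) => [|u].
    exact: (functional_eq0 (Gr 1%:M) G11 G1h).
  exact: (functional_eq0 (Gr (herm u)) (Gh1 u) (Ghh u)).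
case/eqP: T0; apply/matrixP => a b.
case: (mxtens_indexP a) => a1 a2; case: (mxtens_indexP b) => b1 b2.
by have := GA (delta_mx b2 a2) (delta_mx b1 a1);
  rewrite /G tensmx_delta trace_mul_delta mxE.
Qed.

End CommonCharacter.

(** * Elements of U(2) that commute with J2 up to a sign *)

Section Monomial.

Variable (R : realType).
Local Notation C := R[i].
Local Notation "x %:C" := (real_complex R x).

(** The quarter turn: the unitary matrices that commute with it up to a sign
    are those of GO(2). *)
Definition J2 : 'M[C]_2 := mx2 0 1 (-1) 0.

Lemma J2_unitary : J2 \is unitarymx.
Proof.
apply/unitarymxP; rewrite /J2 mx2_trC mx2M mx2_scalar !rmorphN !rmorph0 !rmorph1.
by congr mx2; ring.
Qed.

(** T is diagonalizable with eigenvalues l and -l, and the eigenvalues of J2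
    are i and -i. *)
Lemma traceless_hermitian_basis (T : 'M[C]_2) :
    T ^t* = T -> \tr T = 0 -> T != 0 ->
  exists2 B : 'M[C]_2, B \is unitarymx
    & exists2 mu : C, mu != 0 & T = B ^t* *m (mu *: J2) *m B.
Proof.
move=> Th tT T0.
have /orthomx_spectralP : T \is normalmx by apply/normalmxP; rewrite Th.
set P := spectralmx T; set D := spectral_diag T => TE.
have uP : P \is unitarymx by exact: spectral_unitarymx.
have PV : invmx P = P ^t* by rewrite invmx_unitary.
pose l := D 0 0.
have DE : diag_mx D = mx2 l 0 0 (- l).
  have : \tr (diag_mx D) = 0.
    by move: tT; rewrite {1}TE PV unitary_conj_tr.
  rewrite /mxtrace !big_ord_recl big_ord0 addr0 !mxE !eqxx !mulr1n.
  rewrite (_ : lift ord0 ord0 = 1); last exact: val_inj.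
  move=> /eqP; rewrite addrC addr_eq0 => /eqP D1.
  by apply: mx2P; rewrite !mxE ?mulr0n ?mulr1n.
have l0 : l != 0.
  apply: contraNneq T0 => l0; rewrite TE DE l0 oppr0.
  by rewrite (_ : mx2 0 0 0 0 = 0) ?mulmx0 ?mul0mx //; apply: mx2P; rewrite !mxE.
pose s : C := (sqrtC 2)^-1.
have ss : s * s = 2^-1 by rewrite -invfM -expr2 sqrtCK.
have sc : s^* = s by rewrite geC0_conj // invr_ge0 sqrtC_ge0 ler0n.
(* The columns of K are eigenvectors of J2. *)
pose K : 'M[C]_2 := s *: mx2 1 1 'i (- 'i).
have KtE : K ^t* = s *: mx2 1 (- 'i) 1 'i.
  rewrite /K linearZ /= map_mxZ mx2_trC rmorphN /= conjCi opprK rmorph1.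
  by rewrite sc.
have ii : 'i * 'i = -1 :> C by rewrite -expr2 sqrCi.
have uK : K \is unitarymx.
  apply/unitarymxP; rewrite KtE /K -scalemxAl -scalemxAr scalerA ss mx2M.
  rewrite mx2Z mx2_scalar; congr mx2; rewrite ?mulrN ?mulNr ?ii; by field.
exists (K *m P); first exact: mul_unitarymx.
exists (- 'i * l).
  by rewrite mulf_neq0 // oppr_eq0 neq0Ci.
suff KJ : K ^t* *m ((- 'i * l) *: J2) *m K = mx2 l 0 0 (- l).
  by rewrite TE PV DE -KJ trmxC_mul !mulmxA.
rewrite KtE /K -!scalemxAr -!scalemxAl !scalerA.
rewrite [X in X *: _](_ : _ = - 'i * l / 2); last first.
  by rewrite -ss; ring.
rewrite /J2 !mx2M mx2Z; congr mx2.
- by transitivity (- ('i * 'i) * l); [field | rewrite ii; ring].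
- by ring.
- by ring.
- by transitivity ('i * 'i * l); [field | rewrite ii; ring].
Qed.

Lemma J2_commute_shape (g : 'M[C]_2) (eta : C) : eta ^+ 2 = 1 ->
    J2 *m g = eta *: (g *m J2) ->
  g = mx2 (g 0 0) (g 0 1) (- eta * g 0 1) (eta * g 0 0).
Proof.
move=> e2; rewrite {1 2}[g]mx2_eta /J2 !mx2M mx2Z => /mx2_inj[h1 h2 h3 h4].
rewrite {1}[g]mx2_eta; congr mx2.
  by have := h1; rewrite !mulr0 !mul0r !mul1r add0r => ->; ring.
by have := h2; rewrite !mulr0 !mul0r !mul1r add0r => ->; ring.
Qed.

Lemma J2_commute_quad (g : 'M[C]_2) (eta : C) v : eta ^+ 2 = 1 ->
    J2 *m g = eta *: (g *m J2) ->
  quad (g *m v) = (eta * \det g) * quad v.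
Proof.
move=> e2 /(J2_commute_shape e2) ->; set a := g 0 0; set b := g 0 1.
rewrite det_mx2 /quad !mxE !big_ord_recl !big_ord0 !mxE /=.
rewrite (_ : lift ord0 ord0 = 1); last exact: val_inj.
transitivity ((a * v 0 0 + b * v 1 0) ^+ 2
  + eta ^+ 2 * (a * v 1 0 - b * v 0 0) ^+ 2); first by ring.
transitivity (eta ^+ 2 * (a ^+ 2 + b ^+ 2) * (v 0 0 ^+ 2 + v 1 0 ^+ 2)).
  by rewrite e2; ring.
by ring.
Qed.

Lemma J2_commute_simil (g : 'M[C]_2) (eta : C) : eta ^+ 2 = 1 ->
  J2 *m g = eta *: (g *m J2) -> simil g = eta * \det g.
Proof.
move=> e2 Jg; rewrite /simil (J2_commute_quad _ e2 Jg) /quad !mxE /=.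
by rewrite expr1n expr0n addr0 mulr1.
Qed.

Lemma J2_commute_GO2 (g : 'M[C]_2) (eta : C) : eta ^+ 2 = 1 ->
  J2 *m g = eta *: (g *m J2) -> g \is unitarymx -> GO2 g.
Proof.
move=> e2 Jg ug; split=> //; split; first exact: unitarymx_unit.
by exists (eta * \det g) => v; apply: J2_commute_quad.
Qed.

(** The isotropic lines of x^2 + y^2 are the eigenlines of J2, for i and -i;
    g fixes them or exchanges them according to eta. *)
Lemma J2_commute_sign (g : 'M[C]_2) (eta : C) : eta ^+ 2 = 1 ->
  J2 *m g = eta *: (g *m J2) -> g \is unitarymx -> simil_sign g = eta.
Proof.
move=> e2 Jg ug; have gE := J2_commute_shape e2 Jg.
have /unitarymx_unit := ug; rewrite unitmxE unitfE {1}gE det_mx2.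
set a := g 0 0; set b := g 0 1 => det0.
pose ci : C := Complex 0 1.
have cii : ci * ci = -1 by apply/eqP; rewrite eq_complex /= ; apply/andP; split;
  apply/eqP; ring.
have ci0 : ci != 0 by apply/eqP => h; have /eqP := cii;
  rewrite h mul0r eq_sym oppr_eq0 oner_eq0.
have lineE (e : C) (k : 'I_2) : e ^+ 2 = 1 -> (-1) ^+ k = e ->
    isotropic_line R k = \row_j (if j == 0 then 1 else e * ci).
  by move=> _ <-.
have lineg (e : C) : e ^+ 2 = 1 ->
    (\row_j (if j == 0 then 1 else e * ci) : 'rV_2) *m g^T =
    (a + e * ci * b) *: \row_j (if j == 0 then 1 else eta * e * ci).
  move=> ee; apply/rowP; rewrite gE mx2_tr; elim/ord2P.
    rewrite !mxE !big_ord_recl big_ord0 !mxE /=.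
    by rewrite -/a -/b; ring.
  rewrite !mxE !big_ord_recl big_ord0 !mxE /= -/a -/b.
  transitivity (e ^+ 2 * (ci * ci) * (eta * b) + eta * e * ci * a); last by ring.
  by rewrite ee cii; ring.
have nz (e : C) : e ^+ 2 = 1 -> a + e * ci * b != 0.
  move=> ee; apply: contraNneq det0 => h.
  have -> : a * (eta * a) - b * (- eta * b)
          = eta * ((a + e * ci * b) * (a - e * ci * b)).
    transitivity (eta * (a * a - e ^+ 2 * (ci * ci) * (b * b))); last by ring.
    by rewrite ee cii; ring.
  by rewrite h mul0r mulr0.
have line_neq (e e' c : C) : \row_j (if j == 0 then 1 else e * ci) =
    c *: (\row_j (if j == 0 then 1 else e' * ci) : 'rV_2) -> e = e'.
  move=> /rowP h; have := h 0; rewrite !mxE /= mulr1 => h0; have := h 1.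
  by rewrite !mxE /= -h0 mul1r => /(mulIf ci0).
have sg (k : 'I_2) : ((-1) ^+ k : C) ^+ 2 = 1 by rewrite sqrr_sign.
have image (k k' : 'I_2) : (isotropic_line R k *m g^T == isotropic_line R k')%MS =
    ((-1) ^+ k' == eta * (-1) ^+ k :> C).
  rewrite (lineE _ k (sg k) erefl) (lineE _ k' (sg k') erefl) lineg //.
  apply/idP/eqP => [/andP[/sub_rVP[c h] _]|->].
    apply: (@line_neq _ _ (c^-1 * (a + (-1) ^+ k * ci * b))).
    have c0 : c != 0.
      apply: contraNneq (nz _ (sg k)) => c0; move: h; rewrite c0 scale0r.
      by move=> /rowP/(_ 0); rewrite !mxE /= mulr1 => ->.
    by rewrite -scalerA h scalerA mulVf // scale1r.
  by apply/andP; split; rewrite ?scalemx_sub // (eqmx_scale _ (nz _ (sg k))).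
rewrite /simil_sign; case: pickP => [s /forallP hs|none].
  have n1 : (1 == -1 :> C) = false by rewrite -subr_eq0 opprK -mulr2n pnatr_eq0.
  have n1' : (-1 == 1 :> C) = false by rewrite eq_sym.
  have s0 := hs 0; have s1 := hs 1; rewrite !image !expr0 !expr1 in s0 s1.
  have sE (k c : 'I_2) : ((-1) ^+ s k == (-1) ^+ c :> C) -> s k = c.
    move: (s k) c; elim/ord2P; elim/ord2P => //=;
      by rewrite ?expr0 ?expr1 ?n1 ?n1'.
  have [e1|e1] := sqr1_sign e2; rewrite e1 ?mulr1 ?mul1r ?mulrNN ?mulr1 in s0 s1 *.
    suff -> : s = 1%g by rewrite odd_perm1.
    by apply/permP; elim/ord2P; rewrite perm1; apply: sE.
  suff -> : s = tperm 0 1 by rewrite odd_tperm.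
  by apply/permP; elim/ord2P; rewrite ?tpermL ?tpermR; apply: sE.
have [e1|e1] := sqr1_sign e2.
  have /negP[] := none 1%g; apply/forallP => k.
  by rewrite image perm1 e1 mul1r.
have /negP[] := none (tperm 0 1); apply/forallP; elim/ord2P; rewrite image e1.
  by rewrite tpermL /= expr0 expr1 mulr1.
by rewrite tpermR /= expr0 expr1 mulrNN mulr1.
Qed.

End Monomial.

(** * Pairs of morphisms to SU(4) with conjugate values *)

Lemma conj_relation (C : numClosedFieldType) n (U B J T : 'M[C]_n) (chi mu : C) :
    U \is unitarymx -> B \is unitarymx -> mu != 0 ->
    T = B ^t* *m (mu *: J) *m B -> U ^t* *m T *m U = chi *: T ->
  J *m (B *m U *m B ^t*) = chi *: ((B *m U *m B ^t*) *m J).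
Proof.
move=> uU uB mu0 TE TU; have BB : B *m B ^t* = 1%:M by apply/unitarymxP.
have UU : U *m U ^t* = 1%:M by apply/unitarymxP.
have {}TU : T *m U = chi *: (U *m T).
  have := congr1 (mulmx U) TU; rewrite !mulmxA UU mul1mx => ->.
  by rewrite -scalemxAr.
have e1 : mu *: (J *m (B *m U *m B ^t*)) = B *m (T *m U) *m B ^t*.
  rewrite TE !mulmxA BB mul1mx -!scalemxAl.
  by [].
apply: (scalerI mu0); rewrite e1 TU TE -scalemxAr -scalemxAl scalerA mulrC -scalerA.
congr (_ *: _); rewrite -!scalemxAr -!scalemxAl -!scalemxAr !mulmxA -!scalemxAl.
by rewrite -(mulmxA _ B (B ^t*)) BB mulmx1.
Qed.

Section Adjugate.

Variable R : realType.

Lemma mul_mx2_adj (K : comNzRingType) (M : 'M[K]_2) :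
  M *m mx2 (M 1 1) (- M 0 1) (- M 1 0) (M 0 0) = (\det M)%:M.
Proof.
have adj (a b c e : K) :
    mx2 a b c e *m mx2 e (- b) (- c) a = (\det (mx2 a b c e))%:M.
  by rewrite det_mx2 mx2M mx2_scalar; congr mx2; ring.
by have := adj (M 0 0) (M 0 1) (M 1 0) (M 1 1); rewrite -mx2_eta.
Qed.

Lemma mx2_adj_J2 (a b c e : R[i]) :
  mx2 e (- c) (- b) a *m J2 R = J2 R *m mx2 a b c e.
Proof. by rewrite /J2 !mx2M; congr mx2; ring. Qed.

End Adjugate.

Lemma twist_of_basis (C : numClosedFieldType) n (g B J : 'M[C]_n) (chi : C) :
    B \is unitarymx -> B ^t* *m B = 1%:M -> chi ^+ 2 = 1 ->
    J *m (B *m g *m B ^t*) = chi *: ((B *m g *m B ^t*) *m J) ->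
  g *m (B ^t* *m J *m B) = (B ^t* *m J *m B) *m (chi *: g).
Proof.
move=> /unitarymxP BB BtB chi2 Jg.
have := congr1 (fun M => B ^t* *m (chi *: M) *m B) Jg.
rewrite scalerA -expr2 chi2 scale1r !mulmxA BtB mul1mx -scalemxAr -scalemxAl.
rewrite !mulmxA -(mulmxA _ (B ^t*) B) BtB mulmx1 => <-.
by rewrite -scalemxAr.
Qed.

Section Classification.

Variable (R : realType).
Local Notation C := R[i].
Local Notation "x %:C" := (real_complex R x).
Variable (Gamma : groupType).

Definition twist n (chi : Gamma -> R) (V : Gamma -> 'M[C]_n) g :=
  (chi g)%:C *: V g.

Lemma uequiv_ext n (V W : Gamma -> 'M[C]_n) : V =1 W -> uequiv V W.
Proof.
move=> VW; have [P [uP uPt P3]] := uequiv_refl V.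
by exists P; split=> // g; rewrite -VW.
Qed.

Lemma uequiv_twist m n chi (V : Gamma -> 'M[C]_m) (W : Gamma -> 'M[C]_n) :
  uequiv V W -> uequiv (twist chi V) (twist chi W).
Proof.
move=> [P [uP uPt P3]]; exists P; split=> // g.
by rewrite /twist -scalemxAl P3 -scalemxAr.
Qed.

Lemma conj_small n (V : Gamma -> 'M[C]_n) : (n <= 1)%N ->
  (forall g, (\det (V g))^* = \det (V g)) -> conjrep V =1 V.
Proof.
case: n V => [|[|//]] V _ Vreal g; first exact: flatmx0_eq.
apply/matrixP => i j; rewrite !ord1 mxE.
by have := Vreal g; rewrite !det_mx11.
Qed.

Lemma line_basis (X : Gamma -> 'M[C]_2) (l : 'rV_3) (chi : Gamma -> R) :
    (forall g, X g \is unitarymx) -> l != 0 -> (forall g, chi g ^+ 2 = 1) ->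
    (forall g, l *m Ad (X g) = chi g *: l) ->
  exists2 B : 'M[C]_2, B \is unitarymx
    & forall g, J2 R *m (B *m X g *m B ^t*)
              = (chi g)%:C *: ((B *m X g *m B ^t*) *m J2 R).
Proof.
move=> uX l0 chi2 lX.
have h0 : herm l != 0 by rewrite herm_eq0.
have [B uB [mu mu0 hE]] :=
  traceless_hermitian_basis (herm_trC l) (herm_trace l) h0.
exists B => // g.
apply: conj_relation (uX g) uB mu0 hE _.
by rewrite -(herm_Ad l (uX g)) lX hermZ.
Qed.

(** X conjugates a traceless Hermitian matrix to chi times itself, so an
    invertible multiple of that matrix intertwines X and chi X. *)
Lemma line_twist (X : Gamma -> 'M[C]_2) (l : 'rV_3) (chi : Gamma -> R) :
    (forall g, X g \is unitarymx) -> l != 0 -> (forall g, chi g ^+ 2 = 1) ->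
    (forall g, l *m Ad (X g) = chi g *: l) ->
  uequiv X (twist chi X).
Proof.
move=> uX l0 chi2 /(line_basis uX l0 chi2)[B uB JB].
have uP : B ^t* *m J2 R *m B \is unitarymx.
  by rewrite !mul_unitarymx ?trmxC_unitary ?J2_unitary.
exists (B ^t* *m J2 R *m B); split=> [||g]; first exact: uP.
  by rewrite trmxC_unitary.
have BtB : B ^t* *m B = 1%:M.
  exact: (unitary_trC_mul uB).
apply: (twist_of_basis uB BtB _ (JB g)).
by rewrite -rmorphXn chi2 rmorph1.
Qed.

(** For g in U(2) the transpose of the inverse is J2 g J2^-1 / det g. *)
Lemma conj_twist (Y : Gamma -> 'M[C]_2) (d : Gamma -> R) :
    (forall g, Y g \is unitarymx) -> (forall g, \det (Y g) = (d g)%:C) ->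
  uequiv (conjrep Y) (twist d Y).
Proof.
move=> uY dY; exists (J2 R); split=> [||g]; rewrite ?trmxC_unitary ?J2_unitary //.
have YY : (Y g) ^t* = invmx (Y g) by rewrite invmx_unitary.
have -> : conjrep Y g = ((Y g) ^t*)^T by rewrite -map_trmx trmxK.
have dd : \det (Y g) * \det (Y g) = 1.
  have := congr1 determinant (unitarymxP (uY g)).
  rewrite det_mulmx det1 det_map_mx det_tr dY.
  by rewrite [X in _ * X]conj_Complex oppr0.
have e : (Y g) ^t* = \det (Y g) *: mx2 (Y g 1 1) (- Y g 0 1) (- Y g 1 0) (Y g 0 0).
  rewrite YY; apply: (can_inj (mulKmx (unitarymx_unit (uY g)))).
  rewrite mulmxV ?unitarymx_unit // -scalemxAr mul_mx2_adj scale_scalar_mx.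
  by rewrite dd.
rewrite e linearZ /= mx2_tr /twist -scalemxAl -scalemxAr mx2_adj_J2.
by rewrite -mx2_eta dY.
Qed.

(** Decompose r = X + Y and r' = X + conj Y, apply [common_character] to X
    and Y, and use orthonormal bases in which the two stable lines are spanned
    by i J2. *)
Lemma su4_classification (r r' : Gamma -> 'M[C]_4) :
    urep r -> urep r' ->
    (forall g, \det (r g) = 1) -> (forall g, \det (r' g) = 1) ->
    (forall g, \tr (r' g) = \tr (r g) \/ \tr (r' g) = (\tr (r g))^* ) ->
    ~ uequiv r r' -> ~ uequiv (conjrep r) r' ->
  exists f : Gamma -> 'M[C]_2 * 'M[C]_2,
    [/\ group_morphism (@groupG R) f,
        uequiv r (fun g => rho (f g)),
        uequiv r' (fun g => upsilon (f g) *: rho (f g))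
      & [/\ order2_character (fun g => upsilon (f g)),
            order2_character (fun g => detG (f g))
          & exists g, upsilon (f g) != detG (f g)]].
Proof.
move=> rr rr' dr dr' tr_alt nrr' nrbr'.
have re_tr g : \tr (r g) + (\tr (r g))^* = \tr (r' g) + (\tr (r' g))^*.
  by have [->|->] := tr_alt g; rewrite ?conjCK // addrC.
have [k [l [X [Y [rX rY rE r'E]]]]] := real_trace_decomposition rr rr' re_tr.
have dXY g : \det (X g) * \det (Y g) = 1.
  by rewrite -(dr g) -(uequiv_det g rE) /dsum det_ublock.
have dXYb g : \det (X g) * (\det (Y g))^* = 1.
  rewrite -(dr' g) -(uequiv_det g r'E) /dsum det_ublock.
  by rewrite /conjrep det_map_mx.
have dX0 g : \det (X g) != 0.
  by apply/eqP => h; have /eqP := dXY g; rewrite h mul0r eq_sym oner_eq0.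
have Yreal g : (\det (Y g))^* = \det (Y g).
  by apply: (mulfI (dX0 g)); rewrite dXY dXYb.
have dXE g : \det (X g) = (\det (Y g))^-1.
  have Y0 : \det (Y g) != 0.
    by apply/eqP => h; have /eqP := dXY g; rewrite h mulr0 eq_sym oner_eq0.
  by apply: (mulIf Y0); rewrite dXY mulVf.
have Xreal g : (\det (X g))^* = \det (X g) by rewrite dXE fmorphV /= Yreal.
(* Otherwise r and r' would be equivalent. *)
have notYY : ~ uequiv Y (conjrep Y).
  move=> YY; apply: nrr'; apply: uequiv_trans (uequiv_sym rE) _.
  exact: uequiv_trans (uequiv_dsum (uequiv_refl _) YY) r'E.
(* Otherwise conj r and r' would be equivalent. *)
have notXX : ~ uequiv (conjrep X) X.
  move=> XX; apply: nrbr'; apply: uequiv_trans (uequiv_conj (uequiv_sym rE)) _.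
  apply: uequiv_trans r'E.
  apply: (@uequiv_trans _ _ _ _ _ _ (dsum (conjrep X) (conjrep Y))).
    by apply: uequiv_ext => g; rewrite dsum_conj.
  exact: uequiv_dsum XX (uequiv_refl _).
have k1 : (1 < k)%N.
  rewrite ltnNge; apply/negP => k1; apply: notXX; apply: uequiv_ext.
  exact: conj_small.
have l1 : (1 < l)%N.
  rewrite ltnNge; apply/negP => l1; apply: notYY; apply/uequiv_sym/uequiv_ext.
  exact: conj_small.
have kl := uequiv_dim rE.
have [k2 l2] : k = 2 /\ l = 2 by clear -kl k1 l1; split; lia.
subst k l; clear kl k1 l1 re_tr.
have [[uX X1 XM] [uY Y1 YM]] := (rX, rY).
pose d g := complex.Re (\det (X g)).
have dXd g : \det (X g) = (d g)%:C.
  rewrite /d; have := Xreal g; case: (\det (X g)) => a b.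
  rewrite conj_Complex => -[h] /=; congr Complex; lra.
have det2 g : \det (X g) ^+ 2 = 1.
  have := congr1 determinant (unitarymxP (uX g)).
  by rewrite det_mulmx det1 det_map_mx det_tr /= Xreal expr2.
have d2 g : d g ^+ 2 = 1.
  by apply: (@complexI R); rewrite rmorphXn /= -dXd det2 rmorph1.
have dYd g : \det (Y g) = (d g)%:C.
  by apply: (mulfI (dX0 g)); rewrite dXY -dXd -expr2 det2.
have dM g h : d (g * h)%g = d g * d h.
  by apply: (@complexI R); rewrite rmorphM /= -!dXd XM det_mulmx.
have cX := conj_twist uX dXd; have cY := conj_twist uY dYd.
have nox (v : 'rV_3) : (forall g, v *m Ad (X g) = d g *: v) -> v = 0.
  move=> vX; apply/eqP/negPn/negP => v0; apply: notXX.
  exact: uequiv_trans cX (uequiv_sym (line_twist uX v0 d2 vX)).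
have noy (v : 'rV_3) : (forall g, v *m Ad (Y g) = d g *: v) -> v = 0.
  move=> vY; apply/eqP/negPn/negP => v0; apply: notYY.
  exact: uequiv_trans (line_twist uY v0 d2 vY) (uequiv_sym cY).
have d_sign g : d g = 1 \/ d g = -1 by exact: sqr1_sign.
have [gm dgm] : exists g, d g = -1.
  apply: contrapT => /forallNP nd; apply: notYY.
  apply: uequiv_trans (uequiv_sym cY); apply: uequiv_ext => g.
  by rewrite /twist; have [->|/nd//] := d_sign g; rewrite rmorph1 scale1r.
have trXY g : d g = -1 -> \tr (X g) = 0 \/ \tr (Y g) = 0.
  move=> dg; have := tr_alt g; rewrite -(uequiv_tr g rE) -(uequiv_tr g r'E).
  (* As conj Y is equivalent to - Y at g, and similarly for X, traces are
     imaginary there. *)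
  have tY : (\tr (Y g))^* = - \tr (Y g).
    by have := uequiv_tr g cY; rewrite /twist dg rmorphN rmorph1 scaleN1r
         raddfN /= => <-; rewrite -trace_map_mx.
  have tX : (\tr (X g))^* = - \tr (X g).
    by have := uequiv_tr g cX; rewrite /twist dg rmorphN rmorph1 scaleN1r
         raddfN /= => <-; rewrite -trace_map_mx.
  have tYb : \tr (conjrep Y g) = (\tr (Y g))^* by rewrite -trace_map_mx.
  have half (z : C) : z = - z -> z = 0.
    by move=> /eqP; rewrite -subr_eq0 opprK -mulr2n -mulr_natl mulf_eq0
      pnatr_eq0 => /eqP.
  rewrite !tr_dsum tYb rmorphD /= tX tY => -[/addrI h|/addIr h].
    by right; apply: half.
  by left; apply: half.
have [lx [ly [eta [lx0 ly0 Xeta Yeta eta2]]]] :=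
  common_character rX rY d2 dM (ex_intro _ gm dgm) trXY nox noy.
have deta2 g : (d g * eta g) ^+ 2 = 1 by rewrite exprMn d2 eta2 mulr1.
have [Bx uBx Jx] := line_basis uX lx0 eta2 Xeta.
have [By uBy Jy] := line_basis uY ly0 deta2 Yeta.
have etaM g h : eta (g * h)%g = eta g * eta h.
  have := Xeta (g * h)%g; rewrite XM (Ad_mul (uX g) (uX h)) mulmxA (Xeta g).
  rewrite -scalemxAl (Xeta h) scalerA => /eqP; rewrite -subr_eq0 -scalerBl scaler_eq0 (negPf lx0).
  by rewrite orbF subr_eq0 => /eqP.
have eta1 : eta 1%g = 1.
  have := etaM 1%g 1%g; rewrite mulg1 -{1}[eta 1%g]mulr1 => /mulfI <- //.
  by rewrite -sqrf_eq0 eta2 oner_eq0.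
have d1 : d 1%g = 1.
  have := dM 1%g 1%g; rewrite mulg1 -{1}[d 1%g]mulr1 => /mulfI <- //.
  by rewrite -sqrf_eq0 d2 oner_eq0.
pose gx g := Bx *m X g *m Bx ^t*; pose gy g := By *m Y g *m By ^t*.
have [[ugx gx1 gxM] xeq] := urep_basis rX uBx.
have [[ugy gy1 gyM] yeq] := urep_basis rY uBy.
rewrite -/gx -/gy in xeq yeq.
have etaC2 g : ((eta g)%:C) ^+ 2 = 1 :> C by rewrite -rmorphXn /= eta2 rmorph1.
have detaC2 g : ((d g * eta g)%:C) ^+ 2 = 1 :> C.
  by rewrite -rmorphXn /= deta2 rmorph1.
have dgx g : \det (gx g) = (d g)%:C.
  by rewrite -(uequiv_det g xeq).
have dgy g : \det (gy g) = (d g)%:C.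
  by rewrite -(uequiv_det g yeq).
have upsE g : simil_sign (gx g) = (eta g)%:C.
  exact: J2_commute_sign (etaC2 g) (Jx g) (ugx g).
have simx g : simil (gx g) = (eta g * d g)%:C.
  by rewrite (J2_commute_simil (etaC2 g) (Jx g)) dgx -rmorphM.
have simy g : simil (gy g) = (eta g)%:C.
  rewrite (J2_commute_simil (detaC2 g) (Jy g)) dgy -rmorphM /=.
  by rewrite mulrAC -expr2 d2 mul1r.
have signC (a : R) : a ^+ 2 = 1 -> a%:C = 1 :> C \/ a%:C = -1 :> C.
  by case/sqr1_sign => ->; [left; rewrite rmorph1|right; rewrite rmorphN rmorph1].
exists (fun g => (gx g, gy g)); split.
- split=> [g||g h].
  + split=> /=.
    * split; first exact: J2_commute_GO2 (etaC2 g) (Jx g) (ugx g).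
      by rewrite simx; apply: signC; rewrite exprMn d2 eta2 mulr1.
    * split; first exact: J2_commute_GO2 (detaC2 g) (Jy g) (ugy g).
      by rewrite simy; apply: signC.
    * by rewrite dgx dgy.
    * by rewrite simy upsE.
  + by congr (_, _); [exact: gx1|exact: gy1].
  + by congr (_, _); [exact: gxM|exact: gyM].
- exact: uequiv_trans (uequiv_sym rE) (uequiv_dsum xeq yeq).
- apply: uequiv_trans (uequiv_sym r'E) _.
  apply: (@uequiv_trans _ _ _ _ _ _ (dsum (twist eta gx) (twist eta gy))).
    apply: uequiv_dsum.
      exact: uequiv_trans (line_twist uX lx0 eta2 Xeta) (uequiv_twist _ xeq).
    (* conj Y ~ d Y ~ d (d eta) Y = eta Y. *)
    apply: uequiv_trans cY _.
    apply: uequiv_trans (uequiv_twist d (line_twist uY ly0 deta2 Yeta)) _.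
    apply: uequiv_trans (uequiv_twist _ yeq).
    apply: uequiv_ext => g; rewrite /twist scalerA -rmorphM mulrA -expr2 d2.
    by rewrite mul1r.
  apply: uequiv_ext => g; rewrite /dsum /twist /upsilon upsE /rho /=.
  by rewrite (scale_block_mx (eta g)%:C (gx g) 0 0 (gy g)) !scaler0.
have sq0 (a : R) : a ^+ 2 = 1 -> a%:C != 0 :> C.
  by move=> a2; rewrite fmorph_eq0 -sqrf_eq0 a2 oner_eq0.
split.
- split=> [|g|]; rewrite /upsilon /=.
  + split=> [g||g h]; first by rewrite upsE; apply: sq0.
      by rewrite upsE eta1 rmorph1.
    by rewrite !upsE etaM rmorphM.
  + by rewrite upsE.
  + apply: contrapT => /forallNP ne; have /eqP := ly0; apply.
    apply: noy => g; rewrite Yeta; congr (_ *: _).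
    have /negP/negPn/eqP := ne g; rewrite upsE => h.
    by rewrite (_ : eta g = 1) ?mulr1 //; apply: (@complexI R); rewrite h rmorph1.
- split=> [|g|]; rewrite /detG /=.
  + split=> [g||g h]; first by rewrite dgx; apply: sq0.
      by rewrite dgx d1 rmorph1.
    by rewrite !dgx dM rmorphM.
  + by rewrite dgx -rmorphXn /= d2 rmorph1.
  + exists gm; rewrite dgx dgm rmorphN rmorph1 eq_sym -subr_eq0 opprK -mulr2n.
    by rewrite pnatr_eq0.
- apply: contrapT => /forallNP ne; have /eqP := lx0; apply.
  apply: nox => g; rewrite Xeta; congr (_ *: _); apply: (@complexI R).
  by have /negP/negPn/eqP := ne g; rewrite /upsilon /detG /= upsE dgx.
Qed.

End Classification.

(** * Clifford algebra and spin group *)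

Section CliffordGroup.

Variables (R : realType) (n : nat).
Local Notation Cl := (clifford R n).
Local Notation cv := (@clifford_vec R n).
Implicit Types (u v w : 'rV[R]_n) (s t : seq 'rV[R]_n) (x y z : Cl).

Lemma set1_inj_eq (i j : 'I_n) : ([set i] == [set j]) = (i == j).
Proof. by rewrite (inj_eq set1_inj). Qed.

Lemma clifford_vec_coord v i : cv v [set i] = v 0 i.
Proof.
rewrite ffunE (bigD1 i) //= eqxx big1 ?addr0 // => j ji.
by rewrite set1_inj_eq eq_sym (negPf ji).
Qed.

Lemma clifford_vec_linear : linear cv.
Proof.
move=> a u v; apply/ffunP=> A; rewrite !ffunE scaler_sumr -big_split /=.
apply: eq_bigr => i _; case: ifP => _; rewrite ?mxE //.
by rewrite scaler0 addr0.
Qed.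

HB.instance Definition _ :=
  GRing.isLinear.Build R 'rV[R]_n Cl *:%R cv clifford_vec_linear.

Lemma clifford_vec_polar u v :
  cv u * cv v + cv v * cv u = (- 2 * (u *m v^T) 0 0) *: (1 : Cl).
Proof.
have := clifford_vec_sqr (u + v); rewrite linearD /= mulrDl !mulrDr.
rewrite !clifford_vec_sqr => e.
have /esym/eqP := e; rewrite -addrA [X in _ == X]addrC -subr_eq addrA -subr_eq.
move=> /eqP <-.
rewrite -!scalerBl; congr (_ *: _); rewrite /sqnorm mxE mulr_sumr -!sumrN.
rewrite -!big_split /=; apply: eq_bigr => i _; rewrite !mxE; ring.
Qed.


Lemma clifford_unit_sqr v : sqnorm v = 1 -> cv v * cv v = -1.
Proof. by move=> v1; rewrite clifford_vec_sqr v1 scaleN1r. Qed.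

Lemma clifford_unit_unit v : sqnorm v = 1 -> cv v \is a GRing.unit.
Proof.
move=> /clifford_unit_sqr vv; apply/unitrP; exists (- cv v).
by rewrite mulNr mulrN vv opprK.
Qed.

Lemma clifford_unitV v : sqnorm v = 1 -> (cv v)^-1 = - cv v.
Proof.
move=> v1; apply: (mulrI (clifford_unit_unit v1)).
by rewrite mulrV ?clifford_unit_unit // mulrN clifford_unit_sqr // opprK.
Qed.

(** Up to sign, unit vectors act by conjugation as reflections. *)
Lemma clifford_reflection v u : sqnorm v = 1 ->
  cv v * cv u * cv v = cv (u *m reflection v).
Proof.
move=> v1; have e := clifford_vec_polar u v.
have -> : cv v * cv u = (- 2 * (u *m v^T) 0 0) *: (1 : Cl) - cv u * cv v.
  by rewrite -e addrAC subrr add0r.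
rewrite mulrBl -scalerAl mul1r -mulrA clifford_unit_sqr // mulrN1 opprK.
rewrite /reflection mulmxBr mulmx1 linearB /= addrC; congr (_ + _).
rewrite -scalemxAr mulmxA [u *m v^T]mx11_scalar mul_scalar_mx scalerA.
by rewrite linearZ /= mxE eqxx mulr1n mulNr scaleNr.
Qed.

Definition vec_prod s : Cl := \prod_(v <- s) cv v.

Definition unitary_seq s := all (fun v => sqnorm v == 1) s.

(** The action by conjugation of the product of the vectors of s. *)
Fixpoint vec_rot s : 'M[R]_n :=
  if s is v :: s' then vec_rot s' *m (- reflection v) else 1%:M.

Lemma vec_prod_cons v s : vec_prod (v :: s) = cv v * vec_prod s.
Proof. exact: big_cons. Qed.

Lemma vec_prod_cat s t : vec_prod (s ++ t) = vec_prod s * vec_prod t.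
Proof. exact: big_cat. Qed.

Lemma vec_prod_unit s : unitary_seq s -> vec_prod s \is a GRing.unit.
Proof.
elim: s => [_|v s IHs /= /andP[/eqP v1 us]]; first by rewrite /vec_prod big_nil unitr1.
by rewrite vec_prod_cons rpredM ?IHs ?clifford_unit_unit.
Qed.

Lemma vec_prod_vec_rot s u : unitary_seq s -> vec_prod s * cv u = cv (u *m vec_rot s) * vec_prod s.
Proof.
elim: s u => [|v s IHs] u /=; first by rewrite /vec_prod big_nil mulr1 mul1r mulmx1.
move=> /andP[/eqP v1 us]; rewrite vec_prod_cons -mulrA IHs // !mulrA; congr (_ * _).
rewrite mulmxA mulmxN linearN /= -clifford_reflection //.
by rewrite mulNr -[_ * cv v * cv v]mulrA clifford_unit_sqr // mulrN1 opprK.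
Qed.

Lemma vec_prod_conj s u : unitary_seq s -> vec_prod s * cv u * (vec_prod s)^-1 = cv (u *m vec_rot s).
Proof. by move=> us; rewrite vec_prod_vec_rot // mulrK ?vec_prod_unit. Qed.

Lemma spin_action_vec_prod s : unitary_seq s -> spin_action (vec_prod s) = vec_rot s.
Proof.
move=> us; apply/matrixP => i j.
by rewrite mxE vec_prod_conj // clifford_vec_coord -rowE mxE.
Qed.

Lemma vec_rot_ortho s : unitary_seq s -> orthomx_real (vec_rot s).
Proof.
elim: s => [_|v s IHs /= /andP[/eqP v1 us]].
  by rewrite /orthomx_real /= trmx1 mulmx1.
rewrite /orthomx_real trmx_mul mulmxA -(mulmxA (vec_rot s)) raddfN /= mulmxN mulNmx.
by rewrite opprK (reflection_ortho v1) mulmx1 IHs.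
Qed.

Lemma vec_rot_cat s t : vec_rot (s ++ t) = vec_rot t *m vec_rot s.
Proof. by elim: s => [|v s IHs] /=; rewrite ?mulmx1 // IHs mulmxA. Qed.

Lemma sign_scale b x : (-1) ^+ b * x = (-1) ^+ b *: x.
Proof.
by rewrite -signr_odd -[in RHS]signr_odd; case: odd;
  rewrite ?expr1 ?expr0 ?mulN1r ?mul1r ?scaleN1r ?scale1r.
Qed.

Lemma vec_prod_inv s : unitary_seq s -> (vec_prod s)^-1 = (-1) ^+ size s *: vec_prod (rev s).
Proof.
move=> us; apply: (mulrI (vec_prod_unit us)); rewrite mulrV ?vec_prod_unit // -scalerAr.
have -> : vec_prod s * vec_prod (rev s) = (-1) ^+ size s *: 1.
  rewrite -sign_scale mulr1; elim: s us => [_|v s IHs /= /andP[/eqP v1 us]].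
    by rewrite /vec_prod !big_nil mulr1.
  rewrite rev_cons -cats1 vec_prod_cat vec_prod_cons /vec_prod big_seq1 -!mulrA.
  rewrite [X in cv v * X]mulrA -/(vec_prod s) -/(vec_prod (rev s)) IHs //.
  rewrite mulrA commr_sign -mulrA clifford_unit_sqr // mulrN1.
  by rewrite exprS mulN1r.
by rewrite scalerA -expr2 sqrr_sign scale1r.
Qed.

Lemma vec_prod_rev s : unitary_seq s -> ~~ odd (size s) -> (vec_prod s)^-1 = vec_prod (rev s).
Proof.
by move=> us es; rewrite vec_prod_inv // -signr_odd (negPf es) expr0 scale1r.
Qed.

Lemma spinM x y : spin x -> spin y -> spin (x * y).
Proof.
move=> [s [es us ->]] [t [et ut ->]]; exists (s ++ t).
by rewrite size_cat oddD (negPf es) all_cat us ut big_cat.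
Qed.

Lemma spinV x : spin x -> spin x^-1.
Proof.
move=> [s [es us ->]]; exists (rev s).
by rewrite size_rev all_rev; split=> //; apply: vec_prod_rev.
Qed.

Lemma spin_unit x : spin x -> x \is a GRing.unit.
Proof. by move=> [s [_ us ->]]; apply: vec_prod_unit. Qed.

Lemma spin_actionM x y : spin x -> spin y ->
  spin_action (x * y) = spin_action y *m spin_action x.
Proof.
move=> [s [es us ->]] [t [et ut ->]]; rewrite -big_cat.
rewrite -/(vec_prod s) -/(vec_prod t) -/(vec_prod (s ++ t)) !spin_action_vec_prod ?vec_rot_cat //.
by rewrite /unitary_seq all_cat us.
Qed.

Lemma spin_action_conj x u : spin x ->
  x * cv u * x^-1 = cv (u *m spin_action x).
Proof. by move=> [s [es us ->]]; rewrite spin_action_vec_prod // vec_prod_conj. Qed.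

Lemma spin_action_ortho x : spin x -> orthomx_real (spin_action x).
Proof. by move=> [s [es us ->]]; rewrite spin_action_vec_prod //; apply: vec_rot_ortho. Qed.

Definition parity (b : bool) x := forall A : {set 'I_n}, odd #|A| != b -> x A = 0.

Local Notation e_ i := (cv (delta_mx 0 i)).

Lemma basis_vecE i A : e_ i A = (A == [set i])%:R.
Proof.
rewrite ffunE (bigD1 i) //= big1 ?addr0 => [|j /negPf ji]; rewrite !mxE ?eqxx.
  by case: eqP.
by rewrite ji; case: eqP.
Qed.

Lemma basis_mull i x A :
  (e_ i * x) A = clifford_sign R [set i] (symdiff [set i] A) * x (symdiff [set i] A).
Proof.
rewrite ffunE (bigD1 [set i]) //= big1 ?addr0 => [|B /negPf Bi].
  by rewrite basis_vecE eqxx mul1r.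
by rewrite basis_vecE Bi mul0r mulr0.
Qed.

Lemma basis_mulr i x A :
  (x * e_ i) A = clifford_sign R (symdiff [set i] A) [set i] * x (symdiff [set i] A).
Proof.
have BA B : (symdiff B A == [set i]) = (B == symdiff [set i] A).
  by apply/eqP/eqP => [<-|->]; rewrite -symdiffA symdiffv symdiff0.
rewrite ffunE (bigD1 (symdiff [set i] A)) //= big1 ?addr0 => [|B Bi].
  have /eqP -> : symdiff (symdiff [set i] A) A == [set i] by rewrite BA.
  by rewrite basis_vecE eqxx mulr1.
by rewrite basis_vecE BA (negPf Bi) !mulr0.
Qed.

Lemma odd_symdiff (A B : {set 'I_n}) :
  odd #|symdiff A B| = odd #|A| (+) odd #|B|.
Proof.
apply: (@signr_inj R); rewrite signr_addb !signr_odd.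
have := @prod_symdiff R n A B predT (fun=> -1) (fun=> etrans (mulrNN 1 1) (mulr1 1)).
by rewrite !(eq_bigl _ _ (fun i => andbT _)) !prodr_const.
Qed.

Lemma parity_basis_mul b i x : parity b x -> parity (~~ b) (e_ i * x).
Proof.
move=> px A oA; rewrite basis_mull px ?mulr0 // odd_symdiff cards1 /=.
by move: oA; case: odd; case: b {px}.
Qed.

Lemma parity_clifford_vec b v x : parity b x -> parity (~~ b) (cv v * x).
Proof.
move=> px A oA; rewrite [v]row_sum_delta linear_sum mulr_suml sum_ffunE.
rewrite big1 // => i _; rewrite linearZ /= -scalerAl ffunE.
by rewrite (parity_basis_mul i px oA) scaler0.
Qed.

Lemma parity_vec_prod s : parity (odd (size s)) (vec_prod s).
Proof.
elim: s => [|v s IHs]; last by rewrite vec_prod_cons /=; apply: parity_clifford_vec.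
move=> A; rewrite /vec_prod big_nil ffunE; case: (A =P set0) => [->|//].
by rewrite cards0.
Qed.

Lemma clifford_sign1_sym i (A : {set 'I_n}) : i \in A ->
  clifford_sign R [set i] A * clifford_sign R A [set i] = (-1) ^+ #|A|.-1.
Proof.
move=> iA; rewrite /clifford_sign big_set1 big_mkcondr /=.
have -> : \prod_(a in A) \prod_(b in [set i] | (b <= a)%N) (-1)
        = \prod_(a in A) (if (i <= a)%N then -1 else 1) :> R.
  by apply: eq_bigr => a _; rewrite big_mkcondr big_set1.
rewrite -big_split /= (bigD1 i) //= leqnn mulrNN mulr1 mul1r.
rewrite (eq_bigr (fun=> -1)) => [|a /andP[_ ai]]; last first.
  by have := ai; rewrite -(inj_eq val_inj) /=; case: ltngtP; rewrite ?mulr1 ?mul1r.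
rewrite prodr_const; congr (_ ^+ _).
by rewrite (cardsD1 i A) iA /=; apply: eq_card => a; rewrite [RHS]in_setD1 andbC.
Qed.

Lemma parityZ b a x : parity b x -> parity b (a *: x).
Proof. by move=> px A oA; rewrite ffunE px // scaler0. Qed.

Lemma parity_mul b b' x y : parity b x -> parity b' y -> parity (b (+) b') (x * y).
Proof.
move=> px py A oA; rewrite ffunE big1 // => B _.
have [oB|oB] := eqVneq (odd #|B|) b; last by rewrite px ?mul0r ?mulr0.
rewrite (py (symdiff B A)) ?mulr0 // odd_symdiff oB.
by move: oA; case: odd; case: (b); case: (b').
Qed.

(** Comparing the coefficients of both sides on the basis, for i in A the
    coefficient of x on A is equal to its opposite. *)
Lemma parity_commute b x : parity b x ->
    (forall i, e_ i * x = (-1) ^+ b * (x * e_ i)) ->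
  x = (if b then 0 else x set0) *: 1.
Proof.
move=> px ex.
have x0 (A : {set 'I_n}) i : i \in A -> x A = 0.
  move=> iA; have [oA|] := eqVneq (odd #|A|) b; last exact: px.
  have /ffunP/(_ (symdiff [set i] A)) := ex i.
  rewrite sign_scale.
  rewrite basis_mull ffunE basis_mulr symdiffK => e.
  have {e} : clifford_sign R [set i] A * clifford_sign R A [set i] * x A
      = (-1) ^+ b * (clifford_sign R A [set i] * clifford_sign R A [set i]) * x A.
    by rewrite mulrAC e /=; rewrite -[_ *: _]/(_ * _); ring.
  rewrite clifford_sign1_sym // -clifford_sign_symdiffr symdiffv clifford_sign0r.
  have A0 : (0 < #|A|)%N by apply/card_gt0P; exists i.
  have -> : (-1) ^+ #|A|.-1 = - (-1) ^+ b :> R.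
    by rewrite -oA signr_odd -[in RHS](prednK A0) exprS mulN1r opprK.
  move=> /eqP; rewrite mulr1 mulNr eq_sym -addr_eq0 -mulr2n -mulr_natl !mulf_eq0.
  by rewrite pnatr_eq0 signr_eq0 => /eqP.
apply/ffunP => A; rewrite !ffunE.
have [->|/set0Pn[i iA]] := eqVneq A set0; last first.
  by rewrite (x0 A i iA) [X in _ *: X](_ : _ = 0) ?scaler0.
case: b px {ex} => [/(_ set0)->|_]; rewrite ?cards0 ?scale0r //.
by rewrite -[RHS]/(_ * _) mulr1.
Qed.

End CliffordGroup.

(** * The theorem of Cartan and Dieudonne *)

Section CartanDieudonne.

Variable (R : realType).

Lemma det_reflection n (v : 'rV[R]_n.+1) : sqnorm v = 1 ->
  \det (reflection v) = -1.
Proof.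
move=> v1; have [O OO rO] := ortho_with_row v1.
have -> : \det (reflection v) = \det (O *m reflection v *m O^T).
  by rewrite !det_mulmx mulrC mulrA -det_mulmx (orthomx_realC OO) det1 mul1r.
have vO : v *m O^T = delta_mx 0 0 by rewrite -rO -row_mul OO row1.
have -> : O *m reflection v *m O^T =
    block_mx (- 1%:M : 'M_1) (0 : 'M_(1, n)) (0 : 'M_(n, 1)) 1%:M.
  rewrite /reflection mulmxBr mulmx1 mulmxBl OO -scalemxAr -scalemxAl mulmxA.
  rewrite -(mulmxA _ v) vO -[O in O *m v^T]trmxK -trmx_mul vO trmx_delta.
  rewrite mul_delta_mx.
  apply/matrixP => i j; rewrite !mxE.
  case: splitP => i' ei; rewrite mxE; case: splitP => j' ej; rewrite mxE;
    rewrite -!(inj_eq val_inj) /= ei ej /= ?ord1 ?mulr1n ?mulr0n ?mulr0 ?subr0 //=.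
  by rewrite !mxE eqxx mulr1n; ring.
by rewrite (det_ublock (- 1%:M : 'M[R]_1)) det1 mulr1 det_mx11 !mxE.
Qed.

Lemma det_vec_rot (s : seq 'rV[R]_7) : unitary_seq s -> \det (vec_rot s) = 1.
Proof.
elim: s => [_|v s IHs /= /andP[/eqP v1 us]]; first by rewrite det1.
rewrite det_mulmx IHs // mul1r -scaleN1r detZ det_reflection //.
by rewrite -signr_odd /= expr1 mulrNN mulr1.
Qed.

Lemma reflection_fix n (u v : 'rV[R]_n) : v *m u^T = 0 -> u *m reflection v = u.
Proof.
move=> vu; rewrite /reflection mulmxBr mulmx1 -scalemxAr mulmxA.
have -> : u *m v^T = 0 by rewrite -[u]trmxK -trmx_mul vu trmx0.
by rewrite mul0mx scaler0 subr0.
Qed.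

(** Induction on the dimension of the space on which g is not yet known to be
    trivial.  The sign is there because vectors act in the Clifford algebra by
    the opposites of reflections. *)
Lemma cartan_dieudonne n (O g : 'M[R]_n) k :
    orthomx_real O -> orthomx_real g -> (k <= n)%N ->
    (forall i : 'I_n, (i < k)%N -> row i O *m g = row i O) ->
  exists s, [/\ unitary_seq s,
    forall v, v \in s -> forall i : 'I_n, (i < k)%N -> v *m (row i O)^T = 0
    & g = (-1) ^+ size s *: vec_rot s].
Proof.
move=> OO; move km: (n - k)%N => m; elim: m k km g => [|m IHm] k km g og kn fix_g.
  have -> : g = 1%:M.
    rewrite -[g]mul1mx -(orthomx_realC OO) -mulmxA; congr (_ *m _).
    apply/row_matrixP => i; rewrite row_mul fix_g //.
    by apply: leq_trans (ltn_ord i) _; rewrite -subn_eq0 km.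
  by exists [::]; split=> //=; rewrite expr0 scale1r.
have lt_kn : (k < n)%N by rewrite -subn_gt0 km.
pose j := Ordinal lt_kn; pose r := row j O.
have kmS : (n - k.+1)%N = m by rewrite subnS km.
have lt_cases (i : 'I_n) : (i < k.+1)%N -> i = j \/ (i < k)%N.
  by rewrite ltnS leq_eqVlt => /orP[/eqP ij|]; [left; apply: val_inj|right].
have [rg|rg] := eqVneq (r *m g) r.
  have [|s [us so ge]] := IHm k.+1 kmS g og lt_kn.
    by move=> i /lt_cases[->|/fix_g].
  by exists s; split=> // v vs i ik; apply: so => //; apply: ltnW.
have [w [w1 rw [c wE]]] := reflection_swap (sqnorm_ortho r og) rg.
(* The axis of the reflection is along r g - r, and g fixes the first rows. *)
have wO (i : 'I_n) : (i < k)%N -> w *m (row i O)^T = 0.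
  move=> ik; rewrite wE -scalemxAl mulmxBl -{1}(fix_g i ik) trmx_mul.
  by rewrite mulmxA -(mulmxA r) og mulmx1 subrr scaler0.
pose g' := g *m reflection w.
have og' : orthomx_real g'.
  by rewrite /orthomx_real trmx_mul mulmxA -(mulmxA g) (reflection_ortho w1) mulmx1.
have [|s [us so g'E]] := IHm k.+1 kmS g' og' lt_kn.
  move=> i /lt_cases[->|ik]; first by rewrite mulmxA rw.
  by rewrite mulmxA fix_g // reflection_fix ?wO.
exists (w :: s); split.
- by rewrite /= w1 eqxx.
- move=> v; rewrite inE => /orP[/eqP->|vs] i ik; first exact: wO.
  by apply: so => //; apply: ltnW.
- rewrite /= exprS mulN1r mulmxN scaleNr scalerN opprK scalemxAl -g'E -mulmxA.
  have rr := reflection_ortho w1.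
  have rt : (reflection w)^T = reflection w.
    by rewrite /reflection raddfB /= trmx1 linearZ /= trmx_mul trmxK.
  by rewrite /orthomx_real rt in rr; rewrite rr mulmx1.
Qed.

End CartanDieudonne.

(** * The stabilizer N of a line, and its subgroup N^0 *)

Lemma even_seq_ind (T : Type) (P : seq T -> Prop) :
    P [::] -> (forall v w s, ~~ odd (size s) -> P s -> P (v :: w :: s)) ->
  forall s, ~~ odd (size s) -> P s.
Proof.
move=> P0 PS s; have [m] := ubnP (size s); elim: m s => // m IHm [|v [|w s]] //=.
by rewrite !ltnS negbK => /ltnW ms es; apply: PS => //; apply: IHm.
Qed.

Lemma det_conjugate (K : fieldType) p n (P : 'M[K]_(p, n)) (g : 'M_n) (G : 'M_p) :
  p = n -> row_free P -> P *m g = G *m P -> \det g = \det G.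
Proof.
move=> pn; subst p; rewrite row_free_unit unitmxE unitfE => P0.
by move=> /(congr1 determinant); rewrite !det_mulmx mulrC => /(mulIf P0).
Qed.

Section Stabilizer.

Variables (R : realType) (L F : 'M[R]_7).
Hypothesis LF : line_decomposition L F.
Local Notation Cl := (clifford R 7).
Local Notation cv := (@clifford_vec R 7).

Lemma line_generator : exists2 e0 : 'rV[R]_7, sqnorm e0 = 1 & (e0 :=: L)%MS.
Proof.
have [rL _ _] := LF.
have : L != 0 by rewrite -mxrank_eq0 rL.
case/rowV0Pn => v vL v0; have [c c0 c1] := unit_multiple v0.
exists (c *: v) => //; apply/eqmxP.
have cvL : (c *: v <= L)%MS by rewrite scalemx_sub.
by rewrite -mxrank_leqif_eq // rL rank_rV scaler_eq0 negb_or c0 v0.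
Qed.

Variable e0 : 'rV[R]_7.
Hypotheses (e01 : sqnorm e0 = 1) (e0L : (e0 :=: L)%MS).

Lemma rank_F : \rank F = 6%N /\ F *m e0^T = 0.
Proof.
have [rL LFt full] := LF.
have Fe0 : F *m e0^T = 0.
  have /submxP[D ->] : (e0 <= L)%MS by rewrite e0L.
  by rewrite -[F]trmxK -trmx_mul -mulmxA LFt mulmx0 trmx0.
split=> //; apply/eqP; rewrite eqn_leq; apply/andP; split.
  have /mxrankS : (F <= kermx e0^T)%MS by apply/sub_kermxP.
  by rewrite mxrank_ker mxrank_tr e0L rL.
have := mxrank_adds_leqif L F; move=> /leqif_trans => _.
have [le _] := mxrank_adds_leqif L F.
by move: full le; rewrite /row_full => /eqP ->; rewrite rL.
Qed.

Lemma sub_F m (v : 'M[R]_(m, 7)) : (v <= F)%MS = (v *m e0^T == 0).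
Proof.
have [rF Fe0] := rank_F; have [rL _ _] := LF.
have FK : (F <= kermx e0^T)%MS by apply/sub_kermxP.
have /eqmxP FE : (F == kermx e0^T)%MS.
  by rewrite -mxrank_leqif_eq // mxrank_ker mxrank_tr e0L rL rF.
by rewrite FE; apply/sub_kermxP/eqP.
Qed.

Definition perp_seq (s : seq 'rV[R]_7) :=
  unitary_seq s && all (fun v => v *m e0^T == 0) s.

Lemma perp_unitary s : perp_seq s -> unitary_seq s.
Proof. by case/andP. Qed.

Lemma perp_cons v s :
  perp_seq (v :: s) = [&& sqnorm v == 1, v *m e0^T == 0 & perp_seq s].
Proof. by rewrite /perp_seq /= -!andbA; congr andb; rewrite andbCA. Qed.

(** The matrix of g is block diagonal in e0 followed by a basis of F. *)
Lemma det_restrict (g : 'M[R]_7) c :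
    orthomx_real g -> e0 *m g = c *: e0 ->
  \det g = c * \det (mxred.restrictmx F g).
Proof.
move=> og eg; have [rF Fe0] := rank_F; have [rL _ _] := LF.
have e0n0 : e0 != 0 by rewrite -sqnorm_eq0 e01 oner_eq0.
have c2 := ortho_scale og e0n0 eg.
have ge : g *m e0^T = c *: e0^T.
  have := congr1 (mulmx^~ g^T) eg; rewrite -mulmxA og mulmx1 -scalemxAl => e.
  have := congr1 trmx (congr1 ( *:%R c) e).
  by rewrite scalerA -expr2 c2 scale1r trmx_mul trmxK linearZ => <-.
set rB := row_base F; set G := mxred.restrictmx F g.
have rBg : rB *m g = G *m rB.
  rewrite /G /conjmx mulmxKpV // eq_row_base sub_F -mulmxA ge -scalemxAr.
  have /eqP -> : rB *m e0^T == 0 by rewrite -sub_F eq_row_base.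
  by rewrite scaler0.
pose P := col_mx e0 rB.
have Pg : P *m g = block_mx c%:M 0 0 G *m P.
  rewrite /P mul_col_mx mul_block_col !mul0mx addr0 add0r rBg eg.
  by rewrite mul_scalar_mx.
have dimP : (1 + \rank F)%N = 7%N by rewrite rF.
rewrite (det_conjugate dimP _ Pg) ?det_ublock ?det_scalar1 //.
rewrite /row_free -addsmxE dimP (adds_eqmx e0L (eq_row_base F)).
by have [_ _ full] := LF.
Qed.

Lemma spinN_line x : spinN L x ->
  exists2 c, e0 *m spin_action x = c *: e0 & c ^+ 2 = 1.
Proof.
move=> [sx st]; have /sub_rVP[c e] : (e0 *m spin_action x <= e0)%MS.
  by rewrite (eqmxMr _ e0L) e0L.
exists c => //; apply: ortho_scale (spin_action_ortho sx) _ e.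
by rewrite -sqnorm_eq0 e01 oner_eq0.
Qed.

Lemma line_spinN x c : spin x -> e0 *m spin_action x = c *: e0 -> spinN L x.
Proof.
move=> sx e; split=> //.
by rewrite -(eqmxMr _ e0L) -e0L e scalemx_sub.
Qed.

Lemma det_spin_action (x : Cl) : spin x -> \det (spin_action x) = 1.
Proof. by move=> [s [_ us ->]]; rewrite spin_action_vec_prod // det_vec_rot. Qed.

(** In odd dimension spin elements act with determinant 1, so the condition
    on the determinant on F amounts to fixing the line L pointwise. *)
Lemma spinN0P x : spinN0 L F x <-> spin x /\ e0 *m spin_action x = e0.
Proof.
split=> [[Nx dx]|[sx ex]].
  have [c ec _] := spinN_line Nx; have [sx _] := Nx; split=> //.
  have := det_restrict (spin_action_ortho sx) ec.
  by rewrite dx det_spin_action // mulr1 => c1; rewrite ec -c1 scale1r.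
have e1 : e0 *m spin_action x = 1 *: e0 by rewrite scale1r.
split; first exact: line_spinN sx e1.
have := det_restrict (spin_action_ortho sx) e1.
by rewrite mul1r det_spin_action.
Qed.

Lemma spinN0M (x y : Cl) : spinN0 L F x -> spinN0 L F y -> spinN0 L F (x * y).
Proof.
move=> /spinN0P[sx ex] /spinN0P[sy ey]; apply/spinN0P; split.
  exact: spinM.
by rewrite spin_actionM // mulmxA ey.
Qed.

Lemma spin_actionV (x : Cl) : spin x -> spin_action x *m spin_action x^-1 = 1%:M.
Proof.
move=> sx; rewrite -(spin_actionM (spinV sx) sx) mulVr ?spin_unit //.
by have := @spin_action_vec_prod R 7 [::] isT; rewrite /vec_prod big_nil.
Qed.

Lemma spinN0V (x : Cl) : spinN0 L F x -> spinN0 L F x^-1.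
Proof.
move=> /spinN0P[sx ex]; apply/spinN0P; split; first exact: spinV.
by rewrite -{1}ex -mulmxA spin_actionV // mulmx1.
Qed.

Lemma spinN_M (x y : Cl) : spinN L x -> spinN L y -> spinN L (x * y).
Proof.
move=> Nx Ny; have [c ec _] := spinN_line Nx.
have [c' ec' _] := spinN_line Ny; have [sx _] := Nx; have [sy _] := Ny.
apply: (line_spinN (spinM sx sy) (c := c' * c)).
by rewrite spin_actionM // mulmxA ec' -scalemxAl ec scalerA.
Qed.

Lemma spinN_V (x : Cl) : spinN L x -> spinN L x^-1.
Proof.
move=> Nx; have [c ec c2] := spinN_line Nx; have [sx _] := Nx.
apply: (line_spinN (spinV sx) (c := c)).
have e : e0 = c *: (e0 *m spin_action x) by rewrite ec scalerA -expr2 c2 scale1r.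
by rewrite {1}e -scalemxAl -mulmxA spin_actionV // mulmx1.
Qed.

Lemma vec_rot_e0 s : perp_seq s -> e0 *m vec_rot s = (-1) ^+ size s *: e0.
Proof.
elim: s => [|v s IHs]; first by rewrite mulmx1 expr0 scale1r.
rewrite perp_cons => /and3P[v1 /eqP ve ps] /=; rewrite mulmxA IHs // mulmxN.
by rewrite -scalemxAl reflection_fix // exprS mulN1r scaleNr.
Qed.

Lemma perp_spinN0 s : perp_seq s -> ~~ odd (size s) -> spinN0 L F (vec_prod s).
Proof.
move=> ps es; apply/spinN0P; split; first by exists s; split=> //; apply: perp_unitary.
by rewrite spin_action_vec_prod ?perp_unitary // vec_rot_e0 // -signr_odd (negPf es)
  expr0 scale1r.
Qed.

(** The rotation induced by x fixes e0, so it is a product of reflections in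
    vectors orthogonal to e0.  The product of these vectors differs from x by
    an element that commutes with all vectors up to a common sign, hence by a
    scalar; the number of vectors is even, as otherwise this scalar would
    be 0. *)
Lemma spinN0_perp x : spinN0 L F x ->
  exists s c, [/\ perp_seq s, ~~ odd (size s) & x = c *: vec_prod s].
Proof.
move=> /spinN0P[sx ex]; have [O OO rO] := ortho_with_row e01.
have ox := spin_action_ortho sx.
have [|s [us so ge]] := cartan_dieudonne OO ox (isT : (1 <= 7)%N).
  move=> i; rewrite ltnS leqn0 => /eqP i0.
  by rewrite (_ : i = 0) ?rO //; apply: val_inj.
have ps : perp_seq s.
  rewrite /perp_seq us; apply/allP => v vs; rewrite -rO.
  by rewrite (so v vs 0).
set b := odd (size s).
have [t [et ut xt]] := sx.
pose z := (vec_prod s)^-1 * x.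
have us1 := vec_prod_unit us; have ux := spin_unit sx.
have zcomm u : cv u * z = (-1) ^+ b * (z * cv u).
  have xu : x * cv u = (-1) ^+ b *: (vec_prod s * cv u * (vec_prod s)^-1 * x).
    have := spin_action_conj u sx; rewrite ge -scalemxAr linearZ /= -vec_prod_conj //.
    rewrite -signr_odd -/b => /(congr1 ( *%R^~ x)); rewrite mulrVK // => ->.
    by rewrite -scalerAl.
  rewrite sign_scale /z -[_ * x * cv u]mulrA xu -scalerAr scalerA -expr2 sqrr_sign.
  by rewrite scale1r !mulrA mulVr // mul1r.
have pz : parity b z.
  rewrite /z vec_prod_inv // -scalerAl xt; apply: parityZ.
  have := parity_mul (@parity_vec_prod R 7 (rev s)) (@parity_vec_prod R 7 t).
  by rewrite size_rev (negPf et) addbF.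
have zE := parity_commute pz (fun i => zcomm _).
have xE : x = (if b then 0 else z set0) *: vec_prod s.
  by rewrite -[LHS](mulVKr us1) -/z {1}zE -scalerAr mulr1.
move: xE; case bE : b => [] xE; last by exists s, (z set0); rewrite -/b bE.
by move: ux; rewrite xE scale0r unitr0.
Qed.

End Stabilizer.

(** * Skew matrices of size 4 and Euclidean space of dimension 6 *)

Section SkewMatrices.

Variable K : comNzRingType.

(** All skew matrices of size 4 are of this form; the Pfaffian is
    z1 z1' + z2 z2' + z3 z3', and exchanging z and z' is the duality for which
    a matrix times its dual is the opposite of the Pfaffian. *)
Definition skew (z1 z1' z2 z2' z3 z3' : K) : 'M[K]_(2 + 2) :=
  block_mx (mx2 0 z1 (- z1) 0) (mx2 z2 z3 z3' (- z2'))
           (mx2 (- z2) (- z3') (- z3) z2') (mx2 0 z1' (- z1') 0).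

Lemma skew_polar z1 z1' z2 z2' z3 z3' w1 w1' w2 w2' w3 w3' :
  skew z1 z1' z2 z2' z3 z3' *m skew w1' w1 w2' w2 w3' w3
  + skew w1 w1' w2 w2' w3 w3' *m skew z1' z1 z2' z2 z3' z3
  = (- (z1 * w1' + z1' * w1 + (z2 * w2' + z2' * w2) + (z3 * w3' + z3' * w3)))%:M.
Proof.
rewrite /skew !mulmx_block add_block_mx !mx2M !mx2D scalar_mx_block !mx2_scalar.
by congr block_mx; first [congr mx2; ring|apply: mx2P; rewrite !mxE; ring].
Qed.

Lemma skew_tr z1 z1' z2 z2' z3 z3' :
  (skew z1 z1' z2 z2' z3 z3')^T = - skew z1 z1' z2 z2' z3 z3'.
Proof.
rewrite /skew tr_block_mx opp_block_mx !mx2_tr !mx2N !oppr0 !opprK.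
by [].
Qed.

(** The value on two rows of the alternating form whose matrix is skew. *)
Definition minor_form (a0 a1 a2 a3 b0 b1 b2 b3 z1 z1' z2 z2' z3 z3' : K) :=
  (a0 * b1 - a1 * b0) * z1 + (a0 * b2 - a2 * b0) * z2
  + (a0 * b3 - a3 * b0) * z3 + (a1 * b2 - a2 * b1) * z3'
  - (a1 * b3 - a3 * b1) * z2' + (a2 * b3 - a3 * b2) * z1'.

Definition mx4 (a0 a1 a2 a3 b0 b1 b2 b3 c0 c1 c2 c3 e0 e1 e2 e3 : K) :
    'M[K]_(2 + 2) :=
  block_mx (mx2 a0 a1 b0 b1) (mx2 a2 a3 b2 b3)
           (mx2 c0 c1 e0 e1) (mx2 c2 c3 e2 e3).

Lemma skew_congruence a0 a1 a2 a3 b0 b1 b2 b3 c0 c1 c2 c3 e0 e1 e2 e3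
    z1 z1' z2 z2' z3 z3' :
  let U := mx4 a0 a1 a2 a3 b0 b1 b2 b3 c0 c1 c2 c3 e0 e1 e2 e3 in
  let m x0 x1 x2 x3 y0 y1 y2 y3 :=
    minor_form x0 x1 x2 x3 y0 y1 y2 y3 z1 z1' z2 z2' z3 z3' in
  U *m skew z1 z1' z2 z2' z3 z3' *m U^T
  = skew (m a0 a1 a2 a3 b0 b1 b2 b3) (m c0 c1 c2 c3 e0 e1 e2 e3)
         (m a0 a1 a2 a3 c0 c1 c2 c3) (- m b0 b1 b2 b3 e0 e1 e2 e3)
         (m a0 a1 a2 a3 e0 e1 e2 e3) (m b0 b1 b2 b3 c0 c1 c2 c3).
Proof.
rewrite /= /mx4 /skew tr_block_mx !mx2_tr !mulmx_block !mx2M !mx2D !mx2M !mx2D.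
by rewrite /minor_form; congr block_mx; congr mx2; ring.
Qed.

(** The right factor on the right-hand side is the determinant expanded along
    the first row. *)
Lemma pfaffian_congruence a0 a1 a2 a3 b0 b1 b2 b3 c0 c1 c2 c3 e0 e1 e2 e3
    z1 z1' z2 z2' z3 z3' :
  let m x0 x1 x2 x3 y0 y1 y2 y3 :=
    minor_form x0 x1 x2 x3 y0 y1 y2 y3 z1 z1' z2 z2' z3 z3' in
  m a0 a1 a2 a3 b0 b1 b2 b3 * m c0 c1 c2 c3 e0 e1 e2 e3
  + m a0 a1 a2 a3 c0 c1 c2 c3 * (- m b0 b1 b2 b3 e0 e1 e2 e3)
  + m a0 a1 a2 a3 e0 e1 e2 e3 * m b0 b1 b2 b3 c0 c1 c2 c3
  = (a0 * (b1 * (c2 * e3 - c3 * e2) - b2 * (c1 * e3 - c3 * e1) + b3 * (c1 * e2 - c2 * e1))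
   - a1 * (b0 * (c2 * e3 - c3 * e2) - b2 * (c0 * e3 - c3 * e0) + b3 * (c0 * e2 - c2 * e0))
   + a2 * (b0 * (c1 * e3 - c3 * e1) - b1 * (c0 * e3 - c3 * e0) + b3 * (c0 * e1 - c1 * e0))
   - a3 * (b0 * (c1 * e2 - c2 * e1) - b1 * (c0 * e2 - c2 * e0) + b2 * (c0 * e1 - c1 * e0)))
   * (z1 * z1' + z2 * z2' + z3 * z3').
Proof. by rewrite /= /minor_form; ring. Qed.

End SkewMatrices.

Section Det4.

Variable K : comNzRingType.

Definition q0 : 'I_(2 + 2) := lshift 2 0.
Definition q1 : 'I_(2 + 2) := lshift 2 1.
Definition q2 : 'I_(2 + 2) := rshift 2 0.
Definition q3 : 'I_(2 + 2) := rshift 2 1.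

Lemma mx4_eta (A : 'M[K]_(2 + 2)) : A =
  mx4 (A q0 q0) (A q0 q1) (A q0 q2) (A q0 q3)
      (A q1 q0) (A q1 q1) (A q1 q2) (A q1 q3)
      (A q2 q0) (A q2 q1) (A q2 q2) (A q2 q3)
      (A q3 q0) (A q3 q1) (A q3 q2) (A q3 q3).
Proof.
by rewrite -[LHS]submxK; congr block_mx; rewrite [LHS]mx2_eta !mxE.
Qed.

Lemma det4 (A : 'M[K]_(2 + 2)) : \det A =
  A q0 q0 * (A q1 q1 * (A q2 q2 * A q3 q3 - A q2 q3 * A q3 q2)
    - A q1 q2 * (A q2 q1 * A q3 q3 - A q2 q3 * A q3 q1)
    + A q1 q3 * (A q2 q1 * A q3 q2 - A q2 q2 * A q3 q1))
  - A q0 q1 * (A q1 q0 * (A q2 q2 * A q3 q3 - A q2 q3 * A q3 q2)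
    - A q1 q2 * (A q2 q0 * A q3 q3 - A q2 q3 * A q3 q0)
    + A q1 q3 * (A q2 q0 * A q3 q2 - A q2 q2 * A q3 q0))
  + A q0 q2 * (A q1 q0 * (A q2 q1 * A q3 q3 - A q2 q3 * A q3 q1)
    - A q1 q1 * (A q2 q0 * A q3 q3 - A q2 q3 * A q3 q0)
    + A q1 q3 * (A q2 q0 * A q3 q1 - A q2 q1 * A q3 q0))
  - A q0 q3 * (A q1 q0 * (A q2 q1 * A q3 q2 - A q2 q2 * A q3 q1)
    - A q1 q1 * (A q2 q0 * A q3 q2 - A q2 q2 * A q3 q0)
    + A q1 q2 * (A q2 q0 * A q3 q1 - A q2 q1 * A q3 q0)).
Proof.
rewrite (expand_det_row _ q0) big_split_ord !big_ord_recl !big_ord0 /=.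
have -> : lift ord0 ord0 = 1 :> 'I_2 by apply: val_inj.
rewrite -/q0 -/q1 -/q2 -/q3 /cofactor !det3 !mxE.
have L (i : 'I_4) (j k : nat) (lj : (j < 3)%N) (lk : (k < 4)%N) :
    bump i j = k -> lift i (Ordinal lj) = Ordinal lk.
  by move=> e; apply: val_inj.
have E0 : (0 : 'I_3) = @Ordinal 3 0 isT by apply: val_inj.
have E1 : (1 : 'I_3) = @Ordinal 3 1 isT by apply: val_inj.
have Q0 : q0 = @Ordinal 4 0 isT by apply: val_inj.
have Q1 : q1 = @Ordinal 4 1 isT by apply: val_inj.
have Q2 : q2 = @Ordinal 4 2 isT by apply: val_inj.
have Q3 : q3 = @Ordinal 4 3 isT by apply: val_inj.
rewrite Q0 Q1 Q2 Q3 E0 E1 /ord3_2.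
rewrite !(L (@Ordinal 4 0 isT) 0 1 isT isT erefl) !(L (@Ordinal 4 0 isT) 1 2 isT isT erefl).
rewrite !(L (@Ordinal 4 0 isT) 2 3 isT isT erefl).
rewrite !(L (@Ordinal 4 1 isT) 0 0 isT isT erefl) !(L (@Ordinal 4 1 isT) 1 2 isT isT erefl).
rewrite !(L (@Ordinal 4 1 isT) 2 3 isT isT erefl).
rewrite !(L (@Ordinal 4 2 isT) 0 0 isT isT erefl) !(L (@Ordinal 4 2 isT) 1 1 isT isT erefl).
rewrite !(L (@Ordinal 4 2 isT) 2 3 isT isT erefl).
rewrite !(L (@Ordinal 4 3 isT) 0 0 isT isT erefl) !(L (@Ordinal 4 3 isT) 1 1 isT isT erefl).
rewrite !(L (@Ordinal 4 3 isT) 2 2 isT isT erefl) /=.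
by ring.
Qed.

Lemma skew_congruence_det (U : 'M[K]_(2 + 2)) z1 z1' z2 z2' z3 z3' :
  exists s1 s1' s2 s2' s3 s3',
    U *m skew z1 z1' z2 z2' z3 z3' *m U^T = skew s1 s1' s2 s2' s3 s3' /\
    s1 * s1' + s2 * s2' + s3 * s3'
      = \det U * (z1 * z1' + z2 * z2' + z3 * z3').
Proof.
have := skew_congruence
    (U q0 q0) (U q0 q1) (U q0 q2) (U q0 q3)
    (U q1 q0) (U q1 q1) (U q1 q2) (U q1 q3)
    (U q2 q0) (U q2 q1) (U q2 q2) (U q2 q3)
    (U q3 q0) (U q3 q1) (U q3 q2) (U q3 q3)
    z1 z1' z2 z2' z3 z3'.
rewrite /= -mx4_eta => e; do 6! eexists; split; first exact: e.
by rewrite det4; apply: pfaffian_congruence.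
Qed.

End Det4.

Section StandardModel.

Variable R : realType.
Local Notation C := R[i].
Local Notation "x %:C" := (real_complex R x).

Definition o6 k : 'I_6 := inord k.

Lemma big_ord6 (V : nmodType) (G : 'I_6 -> V) :
  \sum_i G i = G (o6 0) + G (o6 1) + (G (o6 2) + G (o6 3)) + (G (o6 4) + G (o6 5)).
Proof.
rewrite !big_ord_recl big_ord0 addr0 !addrA.
by do 5?congr (_ + _); congr (G _); apply: val_inj; rewrite /= ?inordK.
Qed.

(** An isometry from R^6 to the skew matrices whose dual is their complex
    conjugate: the Pfaffian is the squared norm. *)
Definition spinor_mx (u : 'rV[R]_6) : 'M[C]_(2 + 2) :=
  skew (Complex (u 0 (o6 0)) (u 0 (o6 1))) (Complex (u 0 (o6 0)) (- u 0 (o6 1)))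
       (Complex (u 0 (o6 2)) (u 0 (o6 3))) (Complex (u 0 (o6 2)) (- u 0 (o6 3)))
       (Complex (u 0 (o6 4)) (u 0 (o6 5))) (Complex (u 0 (o6 4)) (- u 0 (o6 5))).

Lemma skew_conj (z1 z1' z2 z2' z3 z3' : C) :
  map_mx conjC (skew z1 z1' z2 z2' z3 z3')
  = skew z1^* z1'^* z2^* z2'^* z3^* z3'^*.
Proof.
by rewrite /skew map_block_mx !map_mx2 !rmorphN !rmorph0.
Qed.

Lemma spinor_mx_conj u : map_mx conjC (spinor_mx u) =
  skew (Complex (u 0 (o6 0)) (- u 0 (o6 1))) (Complex (u 0 (o6 0)) (u 0 (o6 1)))
       (Complex (u 0 (o6 2)) (- u 0 (o6 3))) (Complex (u 0 (o6 2)) (u 0 (o6 3)))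
       (Complex (u 0 (o6 4)) (- u 0 (o6 5))) (Complex (u 0 (o6 4)) (u 0 (o6 5))).
Proof. by rewrite skew_conj !conj_Complex !opprK. Qed.

(** Hence u |-> A(u) conj A(w) satisfies the relations of the even Clifford
    algebra. *)
Lemma spinor_mx_polar u w :
  spinor_mx u *m map_mx conjC (spinor_mx w) + spinor_mx w *m map_mx conjC (spinor_mx u)
  = ((- 2 * (u *m w^T) 0 0)%:C)%:M.
Proof.
rewrite !spinor_mx_conj skew_polar mxE big_ord6 !mxE; congr (_ %:M).
by apply/eqP; rewrite eq_complex /=; apply/andP; split; apply/eqP; ring.
Qed.

Lemma spinor_mx_linear a u w :
  spinor_mx (a *: u + w) = a%:C *: spinor_mx u + spinor_mx w.
Proof.
rewrite /spinor_mx /skew scale_block_mx add_block_mx !mx2Z !mx2D !mxE.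
by congr block_mx; congr mx2; apply/eqP; rewrite eq_complex /=; apply/andP; split;
  apply/eqP; ring.
Qed.

Lemma spinor_mx_tr u : (spinor_mx u)^T = - spinor_mx u.
Proof. exact: skew_tr. Qed.

End StandardModel.

(** * Gamma matrices *)

(** The values of A(e_k) conj A(e_0), by [spinor_gamma_mx]; imag stands for i. *)
Definition gamma_mx (K : comNzRingType) (imag : K) (k : nat) : 'M[K]_(2 + 2) :=
  match k with
  | 1 => mx4 (- imag) 0 0 0   0 (- imag) 0 0   0 0 imag 0   0 0 0 imag
  | 2 => mx4 0 0 0 1   0 0 1 0   0 (-1) 0 0   (-1) 0 0 0
  | 3 => mx4 0 0 0 imag   0 0 (- imag) 0   0 (- imag) 0 0   imag 0 0 0
  | 4 => mx4 0 0 (-1) 0   0 0 0 1   1 0 0 0   0 (-1) 0 0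
  | 5 => mx4 0 0 (- imag) 0   0 0 0 (- imag)   (- imag) 0 0 0   0 (- imag) 0 0
  | _ => (-1)%:M
  end.

Section NormalForm.

Variable R : realType.
Local Notation C := R[i].
Local Notation "x %:C" := (real_complex R x).

Definition imag : C := Complex 0 1.

Lemma imag2 : imag * imag = -1.
Proof. by apply/eqP; rewrite eq_complex /=; apply/andP; split; apply/eqP; ring. Qed.

Lemma imag_neq0 : imag != 0.
Proof.
by apply/eqP => h; have /eqP := imag2; rewrite h mul0r eq_sym oppr_eq0 oner_eq0.
Qed.

Lemma conj_imag : imag^* = - imag.
Proof. by rewrite conj_Complex; apply/eqP; rewrite eq_complex /= oppr0 !eqxx. Qed.

Lemma o6_eq j k : (j < 6)%N -> (k < 6)%N -> (o6 j == o6 k) = (j == k).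
Proof. by move=> lj lk; rewrite -(inj_eq val_inj) /= !inordK. Qed.

Lemma mx4_mul (K : comNzRingType)
  (a0 a1 a2 a3 b0 b1 b2 b3 c0 c1 c2 c3 e0 e1 e2 e3 : K)
  (a0' a1' a2' a3' b0' b1' b2' b3' c0' c1' c2' c3' e0' e1' e2' e3' : K) :
  mx4 a0 a1 a2 a3 b0 b1 b2 b3 c0 c1 c2 c3 e0 e1 e2 e3 *m
  mx4 a0' a1' a2' a3' b0' b1' b2' b3' c0' c1' c2' c3' e0' e1' e2' e3' =
  let f x0 x1 x2 x3 y0 y1 y2 y3 := x0 * y0 + x1 * y1 + (x2 * y2 + x3 * y3) in
  mx4 (f a0 a1 a2 a3 a0' b0' c0' e0') (f a0 a1 a2 a3 a1' b1' c1' e1')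
      (f a0 a1 a2 a3 a2' b2' c2' e2') (f a0 a1 a2 a3 a3' b3' c3' e3')
      (f b0 b1 b2 b3 a0' b0' c0' e0') (f b0 b1 b2 b3 a1' b1' c1' e1')
      (f b0 b1 b2 b3 a2' b2' c2' e2') (f b0 b1 b2 b3 a3' b3' c3' e3')
      (f c0 c1 c2 c3 a0' b0' c0' e0') (f c0 c1 c2 c3 a1' b1' c1' e1')
      (f c0 c1 c2 c3 a2' b2' c2' e2') (f c0 c1 c2 c3 a3' b3' c3' e3')
      (f e0 e1 e2 e3 a0' b0' c0' e0') (f e0 e1 e2 e3 a1' b1' c1' e1')
      (f e0 e1 e2 e3 a2' b2' c2' e2') (f e0 e1 e2 e3 a3' b3' c3' e3').
Proof. by rewrite /mx4 mulmx_block !mx2M !mx2D. Qed.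

Lemma mx4_scalar (K : comNzRingType) (a : K) :
  a%:M = mx4 a 0 0 0 0 a 0 0 0 0 a 0 0 0 0 a.
Proof.
rewrite /mx4 scalar_mx_block -!mx2_scalar; congr block_mx;
  by apply: mx2P; rewrite !mxE.
Qed.

Lemma skew_mx4 (K : comNzRingType) (z1 z1' z2 z2' z3 z3' : K) :
  skew z1 z1' z2 z2' z3 z3' =
  mx4 0 z1 z2 z3  (- z1) 0 z3' (- z2')  (- z2) (- z3') 0 z1'  (- z3) z2' (- z1') 0.
Proof. by []. Qed.

Lemma spinor_gamma_mx k : (k < 6)%N ->
  spinor_mx (delta_mx 0 (o6 k)) *m map_mx conjC (spinor_mx (delta_mx 0 (o6 0)))
  = gamma_mx imag k.
Proof.
have E i j : (i < 6)%N -> (j < 6)%N ->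
    (delta_mx 0 (o6 i) : 'rV[R]_6) 0 (o6 j) = (j == i)%:R.
  by move=> li lj; rewrite mxE eqxx o6_eq.
have C0 : Complex 0 0 = 0 :> C by [].
have Cj : Complex 0 1 = imag by [].
have CNj : Complex 0 (-1) = - imag.
  by apply/eqP; rewrite eq_complex /= oppr0 !eqxx.
have C1 : Complex 1 0 = 1 :> C by [].
move=> lk; rewrite spinor_mx_conj /spinor_mx !E // /=.
case: k lk => [|[|[|[|[|[|//]]]]]] _ /=; rewrite ?oppr0 ?C0 ?C1 ?CNj ?Cj !skew_mx4
  mx4_mul ?mx4_scalar /gamma_mx /=; congr mx4; ring.
Qed.

End NormalForm.

Section Columns.

Variable K : comNzRingType.

Definition cols (v0 v1 v2 v3 : 'cV[K]_(2 + 2)) : 'M[K]_(2 + 2) :=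
  row_mx (row_mx v0 v1 : 'M_(2 + 2, 1 + 1)) (row_mx v2 v3 : 'M_(2 + 2, 1 + 1)).

Lemma cols_mull (M : 'M[K]_(2 + 2)) v0 v1 v2 v3 :
  M *m cols v0 v1 v2 v3 = cols (M *m v0) (M *m v1) (M *m v2) (M *m v3).
Proof. by rewrite /cols (mul_mx_row M) !(@mul_mx_row _ _ _ 1 1). Qed.

Lemma mx2_block (a b c e : K) :
  mx2 a b c e = block_mx (a%:M : 'M_1) (b%:M : 'M_1) (c%:M : 'M_1) (e%:M : 'M_1).
Proof.
rewrite -[LHS](@submxK _ 1 1 1 1); congr (@block_mx K 1 1 1 1 _ _ _ _);
  by apply/matrixP => i j; rewrite !ord1 !mxE.
Qed.

Lemma row_mx2 (p q : 'cV[K]_(2 + 2)) a b c e :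
  (row_mx p q : 'M_(2 + 2, 1 + 1)) *m mx2 a b c e
  = row_mx (a *: p + c *: q) (b *: p + e *: q).
Proof.
by rewrite mx2_block (@mul_row_block _ _ 1 1 1 1) !mul_mx_scalar.
Qed.

Lemma cols_mx4 v0 v1 v2 v3
    (a0 a1 a2 a3 b0 b1 b2 b3 c0 c1 c2 c3 e0 e1 e2 e3 : K) :
  let f (x0 x1 x2 x3 : K) := x0 *: v0 + x1 *: v1 + (x2 *: v2 + x3 *: v3) in
  cols v0 v1 v2 v3 *m mx4 a0 a1 a2 a3 b0 b1 b2 b3 c0 c1 c2 c3 e0 e1 e2 e3
  = cols (f a0 b0 c0 e0) (f a1 b1 c1 e1) (f a2 b2 c2 e2) (f a3 b3 c3 e3).
Proof.
rewrite /cols /mx4 mul_row_block !row_mx2.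
by rewrite !(@add_row_mx _ _ 1 1).
Qed.

Lemma cols_q0 v0 v1 v2 v3 i : cols v0 v1 v2 v3 i q0 = v0 i 0.
Proof.
rewrite /cols /q0 (@row_mxEl _ _ 2 2).
have -> : (0 : 'I_2) = lshift 1 (0 : 'I_1) by apply: val_inj.
by rewrite (@row_mxEl _ _ 1 1).
Qed.

End Columns.

Section NormalForm.

Variables (C : numClosedFieldType) (j : C).
Hypotheses (j2 : j * j = -1) (conj_j : j^* = - j).

Lemma mx4_inj (K : comNzRingType)
  (a0 a1 a2 a3 b0 b1 b2 b3 c0 c1 c2 c3 e0 e1 e2 e3 : K)
  (a0' a1' a2' a3' b0' b1' b2' b3' c0' c1' c2' c3' e0' e1' e2' e3' : K) :
  mx4 a0 a1 a2 a3 b0 b1 b2 b3 c0 c1 c2 c3 e0 e1 e2 e3 =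
  mx4 a0' a1' a2' a3' b0' b1' b2' b3' c0' c1' c2' c3' e0' e1' e2' e3' ->
  [/\ [/\ a0 = a0', a1 = a1', a2 = a2' & a3 = a3'],
      [/\ b0 = b0', b1 = b1', b2 = b2' & b3 = b3'],
      [/\ c0 = c0', c1 = c1', c2 = c2' & c3 = c3']
    & [/\ e0 = e0', e1 = e1', e2 = e2' & e3 = e3']].
Proof.
by move=> /eq_block_mx[] /mx2_inj[-> -> -> ->] /mx2_inj[-> -> -> ->]
  /mx2_inj[-> -> -> ->] /mx2_inj[-> -> -> ->].
Qed.

Lemma j_neq0 : j != 0.
Proof. by apply/eqP => h; have /eqP := j2; rewrite h mul0r eq_sym oppr_eq0 oner_eq0. Qed.

Lemma mx4_trC (a0 a1 a2 a3 b0 b1 b2 b3 c0 c1 c2 c3 e0 e1 e2 e3 : C) :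
  (mx4 a0 a1 a2 a3 b0 b1 b2 b3 c0 c1 c2 c3 e0 e1 e2 e3) ^t* =
  mx4 a0^* b0^* c0^* e0^* a1^* b1^* c1^* e1^*
      a2^* b2^* c2^* e2^* a3^* b3^* c3^* e3^*.
Proof. by rewrite /mx4 tr_block_mx map_block_mx !mx2_tr !map_mx2. Qed.

(** Irreducibility of the spin representation: solve the linear equations on
    the 16 entries of M. *)
Lemma gamma_mx_commutant (M : 'M[C]_(2 + 2)) :
  (forall k, (0 < k < 5)%N -> M *m gamma_mx j k = gamma_mx j k *m M) ->
  exists c, M = c%:M.
Proof.
move=> Mg; have m1 := Mg 1 isT; have m2 := Mg 2 isT; have m3 := Mg 3 isT.
have m4 := Mg 4 isT; move: m1 m2 m3 m4 {Mg}; rewrite [M]mx4_eta.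
move: (M q0 q0) (M q0 q1) (M q0 q2) (M q0 q3) => a0 a1 a2 a3.
move: (M q1 q0) (M q1 q1) (M q1 q2) (M q1 q3) => b0 b1 b2 b3.
move: (M q2 q0) (M q2 q1) (M q2 q2) (M q2 q3) => c0 c1 c2 c3.
move: (M q3 q0) (M q3 q1) (M q3 q2) (M q3 q3) => e0 e1 e2 e3.
have two0 (z : C) : j * (z + z) = 0 -> z = 0.
  move/eqP; rewrite mulf_eq0 (negPf j_neq0) -mulr2n -mulr_natl mulf_eq0.
  by rewrite pnatr_eq0 => /eqP.
have jE (x y : C) : x * j = - j * y -> j * (x + y) = 0.
  by rewrite mulrDr mulrC => ->; rewrite mulNr addNr.
rewrite /gamma_mx !mx4_mul /= !(mulr0, mul0r, addr0, add0r, mulr1, mul1r, mulrN,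
  mulNr, mulrN1, mulN1r).
move=> /mx4_inj[[_ _ h02 h03] [_ _ h12 h13] [h20 h21 _ _] [h30 h31 _ _]].
move=> /mx4_inj[[p00 p01 p02 p03] [p10 p11 p12 p13] [p20 p21 p22 p23]
                [p30 p31 p32 p33]].
move=> /mx4_inj[[r00 r01 r02 r03] [r10 r11 r12 r13] [r20 r21 r22 r23]
                [r30 r31 r32 r33]].
move=> /mx4_inj[[s00 s01 s02 s03] [s10 s11 s12 s13] [s20 s21 s22 s23]
                [s30 s31 s32 s33]].
have z2 (x : C) : x * j = - (j * x) -> x = 0.
  by move=> h; apply: two0; apply: jE; rewrite h mulNr.
have z2' (x : C) : - (x * j) = j * x -> x = 0.
  by move=> h; apply: z2; rewrite -h opprK.
have a1E : a1 = 0 by apply: z2'; rewrite r02 -p02.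
have b0E : b0 = 0 by apply: z2; rewrite r13 -p13.
exists a0; rewrite mx4_scalar.
rewrite -p02 -p13 -p03 p12 s20 a1E b0E (z2 _ h02) (z2 _ h03) (z2 _ h12) (z2 _ h13).
by rewrite (z2' _ h20) (z2' _ h21) (z2' _ h30) (z2' _ h31).
Qed.

Lemma gamma_mx_trC k : (0 < k < 6)%N -> (gamma_mx j k) ^t* = - gamma_mx j k.
Proof.
have N (a0 a1 a2 a3 b0 b1 b2 b3 c0 c1 c2 c3 e0 e1 e2 e3 : C) :
    - mx4 a0 a1 a2 a3 b0 b1 b2 b3 c0 c1 c2 c3 e0 e1 e2 e3 =
    mx4 (- a0) (- a1) (- a2) (- a3) (- b0) (- b1) (- b2) (- b3)
        (- c0) (- c1) (- c2) (- c3) (- e0) (- e1) (- e2) (- e3).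
  by rewrite /mx4 opp_block_mx !mx2N.
case: k => [|[|[|[|[|[|k]]]]]] // _;
  by rewrite /gamma_mx mx4_trC N !rmorphN ?rmorph0 ?rmorph1 /= ?conj_j ?opprK ?oppr0.
Qed.

End NormalForm.

(** * Normal form of five anticommuting unitary matrices *)

Section GammaMatrices.

Variables (C : numClosedFieldType) (j : C).
Hypotheses (j2 : j * j = -1) (conj_j : j^* = - j).

Variable K : nat -> 'M[C]_(2 + 2).
Hypothesis K_sqr : forall a, (0 < a < 6)%N -> K a *m K a = (-1)%:M.
Hypothesis K_anti : forall a b, (0 < a < 6)%N -> (0 < b < 6)%N -> a != b ->
  K a *m K b = - (K b *m K a).
Hypothesis K_trC : forall a, (0 < a < 6)%N -> (K a) ^t* = - K a.
Hypothesis K_vol : K 1 *m K 2 *m K 3 *m K 4 *m K 5 = (j)%:M.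

Let KK a (x : 'cV_(2 + 2)) : (0 < a < 6)%N -> K a *m (K a *m x) = - x.
Proof. by move=> la; rewrite mulmxA K_sqr // mul_scalar_mx scaleN1r. Qed.

Let Kswap a b (x : 'cV_(2 + 2)) : (0 < a < 6)%N -> (0 < b < 6)%N -> a != b ->
  K a *m (K b *m x) = - (K b *m (K a *m x)).
Proof. by move=> la lb ab; rewrite !mulmxA K_anti // mulNmx. Qed.

(** The matrices i K1 and -i K2 K3 are commuting involutions.  K1, K2 K3
    and K1 K2 K3 are traceless, so the product of (1 + i K1) and (1 - i K2 K3)
    has trace 4 and is nonzero; its columns are the required vectors. *)
Lemma lowest_weight_vector : exists v : 'cV[C]_(2 + 2),
  [/\ v != 0, K 1 *m v = - j *: v & K 2 *m (K 3 *m v) = j *: v].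
Proof.
pose P := (1%:M + j *: K 1) *m (1%:M + (- j) *: (K 2 *m K 3)).
have trN (M N : 'M[C]_(2 + 2)) : M *m N = - (N *m M) -> \tr (M *m N) = 0.
  move=> MN; have := congr1 mxtrace MN; rewrite raddfN /= [X in - X]mxtrace_mulC.
  move=> /eqP; rewrite -subr_eq0 opprK -mulr2n -mulr_natl mulf_eq0 pnatr_eq0.
  by move=> /eqP.
have tr_flip (M : 'M[C]_(2 + 2)) a : (0 < a < 6)%N -> K a *m M = - (M *m K a) ->
    \tr M = 0.
  move=> la aM; have e : M = K a *m (M *m K a).
    by rewrite mulmxA aM mulNmx -mulmxA K_sqr // mul_mx_scalar scaleN1r opprK.
  by rewrite e; apply: trN; rewrite mulmxA aM mulNmx.
have t1 : \tr (K 1) = 0 by apply: (@tr_flip _ 2) => //; apply: K_anti.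
have t23 : \tr (K 2 *m K 3) = 0 by apply: trN; apply: K_anti.
have t123 : \tr (K 1 *m (K 2 *m K 3)) = 0.
  apply: (@tr_flip _ 4) => //; rewrite !mulmxA (K_anti (a := 4) (b := 1)) //.
  rewrite !mulNmx; congr (- _); rewrite -!mulmxA; congr (_ *m _).
  rewrite !mulmxA (K_anti (a := 4) (b := 2)) // mulNmx -(mulmxA (K 2) (K 4)).
  by rewrite (K_anti (a := 4) (b := 3)) // mulmxN opprK mulmxA.
have trP : \tr P = (2 + 2)%:R.
  rewrite /P mulmxDl !mulmxDr !mul1mx mulmx1 -!scalemxAr -!scalemxAl scalerA.
  rewrite mxtraceD (mxtraceD 1%:M) (mxtraceD (_ *: K 1)) 3!mxtraceZ.
  rewrite mxtrace1.
  rewrite t1 t23 t123.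
  by rewrite !mulr0 !addr0.
have K1P : K 1 *m P = - j *: P.
  rewrite /P mulmxA [RHS]scalemxAl; congr (_ *m _).
  rewrite mulmxDr mulmx1 -scalemxAr K_sqr // scalerDr scalerA mulNr j2 opprK.
  by rewrite scale1r addrC scale_scalar_mx mulrN1 scalemx1.
have comm1 : K 2 *m K 3 *m K 1 = K 1 *m (K 2 *m K 3).
  rewrite -mulmxA (K_anti (a := 3) (b := 1)) // mulmxN !mulmxA.
  by rewrite (K_anti (a := 2) (b := 1)) // mulNmx opprK.
have sq23 : K 2 *m K 3 *m (K 2 *m K 3) = (-1)%:M.
  rewrite !mulmxA -(mulmxA (K 2)) (K_anti (a := 3) (b := 2)) // mulmxN mulNmx.
  by rewrite mulmxA K_sqr // -mulmxA K_sqr // -scalar_mxM mulrNN mulr1 raddfN.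
have K23P : K 2 *m K 3 *m P = j *: P.
  have -> : P = (1%:M + (- j) *: (K 2 *m K 3)) *m (1%:M + j *: K 1).
    rewrite /P !mulmxDl !mulmxDr !mul1mx !mulmx1 -!scalemxAl -!scalemxAr comm1.
    by rewrite !scalerA [j * _]mulrC -!addrA; congr (_ + _); rewrite addrCA.
  rewrite mulmxA [RHS]scalemxAl; congr (_ *m _).
  rewrite mulmxDr mulmx1 -scalemxAr sq23 scalerDr scalerA mulrN j2 opprK.
  by rewrite scale1r addrC scale_scalar_mx mulNr mulrN1 opprK scalemx1.
have [i Pi] : exists i, col i P != 0.
  apply/existsP; rewrite -negb_forall; apply/negP => /forallP P0.
  have P00 : P = 0.
    apply/matrixP => a b; have /eqP/colP/(_ a) := P0 b; by rewrite !mxE.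
  by move/eqP: trP; rewrite P00 mxtrace0 eq_sym pnatr_eq0.
have colE (M : 'M[C]_(2 + 2)) a : M *m P = a *: P -> M *m col i P = a *: col i P.
  by move=> MP; rewrite !colE mulmxA MP -scalemxAl.
by exists (col i P); split=> //; [apply: colE|rewrite mulmxA; apply: colE].
Qed.

(** The relations determine all K's on v, K2 K4 v, K4 v and - K2 v.  The Gram
    matrix of these vectors commutes with the gamma matrices, so it is a
    scalar, and they are an orthogonal basis. *)
Lemma gamma_normal_form : exists2 W : 'M[C]_(2 + 2), W \is unitarymx
  & forall a, (0 < a < 6)%N -> K a *m W = W *m gamma_mx j a.
Proof.
have [v [v0 k1 k23]] := lowest_weight_vector.
have k3 : K 3 *m v = - j *: (K 2 *m v).
  have := congr1 (mulmx (K 2)) k23; rewrite KK // -scalemxAr => /eqP.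
  by rewrite eqr_oppLR -scaleNr => /eqP.
pose w := K 4 *m v.
have k5 : K 5 *m v = - j *: w.
  have e : K 1 *m (K 2 *m (K 3 *m (K 4 *m (K 5 *m v)))) = j *: v.
    by rewrite !mulmxA K_vol mul_scalar_mx.
  have := congr1 (fun x => K 4 *m (K 3 *m (K 2 *m (K 1 *m x)))) e.
  rewrite !KK // !(mulmxN, KK, opprK) // -!scalemxAr k1 -!scalemxAr.
  rewrite (Kswap (a := 3) (b := 2)) // k23 mulmxN -scalemxAr => ->.
  by rewrite !scalerN !scalerA mulrN j2 opprK mul1r -scaleNr.
(* The images of v under K's span; the order and the sign match gamma_mx. *)
pose W0 := cols v (K 2 *m w) w (- (K 2 *m v)).
have K1W : K 1 *m W0 = W0 *m gamma_mx j 1.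
  rewrite cols_mull cols_mx4; congr cols; rewrite ?scale0r ?addr0 ?add0r //.
  - rewrite Kswap // /w (Kswap (a := 1) (b := 4)) // k1 !(mulmxN, opprK).
    by rewrite -!scalemxAr.
  - by rewrite /w Kswap // k1 -scalemxAr scaleNr opprK.
  - by rewrite mulmxN Kswap // k1 opprK -scalemxAr scaleNr scalerN.
have K2W : K 2 *m W0 = W0 *m gamma_mx j 2.
  rewrite cols_mull cols_mx4; congr cols;
    rewrite ?scale0r ?addr0 ?add0r ?scale1r ?scaleN1r ?opprK ?KK //.
  by rewrite mulmxN KK // opprK.
have K4W : K 4 *m W0 = W0 *m gamma_mx j 4.
  rewrite cols_mull cols_mx4; congr cols;
    rewrite ?scale0r ?addr0 ?add0r ?scale1r ?scaleN1r ?opprK //.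
  - by rewrite Kswap // /w KK // mulmxN opprK.
  - by rewrite /w KK.
  - by rewrite mulmxN Kswap // opprK.
have K3W : K 3 *m W0 = W0 *m gamma_mx j 3.
  have k3w : K 3 *m w = - j *: (K 2 *m w).
    rewrite /w Kswap // k3 -scalemxAr (Kswap (a := 4) (b := 2)) //.
    by rewrite scalerN opprK.
  rewrite cols_mull cols_mx4; congr cols; rewrite ?scale0r ?addr0 ?add0r.
  - by rewrite k3 scaleNr scalerN.
  - by rewrite Kswap // k3w -scalemxAr KK // scalerN opprK.
  - by rewrite k3w.
  - by rewrite mulmxN Kswap // k23 opprK.
have K5W : K 5 *m W0 = W0 *m gamma_mx j 5.
  have k5w : K 5 *m w = - j *: v.
    by rewrite /w Kswap // k5 -scalemxAr /w KK // scalerN opprK scaleNr.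
  rewrite cols_mull cols_mx4; congr cols; rewrite ?scale0r ?addr0 ?add0r.
  - by rewrite k5 .
  - by rewrite Kswap // k5w -scalemxAr scalerN.
  - by rewrite k5w.
  - by rewrite mulmxN Kswap // k5 opprK -scalemxAr.
have KW a : (0 < a < 6)%N -> K a *m W0 = W0 *m gamma_mx j a.
  by case: a => [|[|[|[|[|[|a]]]]]].
pose M := W0 ^t* *m W0.
have Mherm : M ^t* = M by rewrite trmxC_mul trmxCK.
have Mgen a : (0 < a < 6)%N -> M *m gamma_mx j a = gamma_mx j a *m M.
  move=> la; have gt : (gamma_mx j a) ^t* = - gamma_mx j a.
    by apply: gamma_mx_trC => //.
  have := congr1 (fun N => N ^t*) (KW a la); rewrite !trmxC_mul K_trC // gt.
  rewrite mulmxN mulNmx => /oppr_inj e.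
  by rewrite /M -mulmxA -KW // mulmxA e mulmxA.
have [c Mc] : exists c, M = c%:M.
  apply: (gamma_mx_commutant j2) => a /andP[a0 a5]; apply: Mgen.
  by rewrite a0 ltnW.
have c_gt0 : 0 < c.
  have : (v ^t* *m v) 0 0 = c.
    transitivity (M q0 q0); last by rewrite Mc mxE eqxx mulr1n.
    rewrite [LHS]mxE [RHS]mxE; apply: eq_bigr => i _.
    have E : W0 i q0 = v i 0 by exact: cols_q0.
    rewrite E; congr (_ * _); rewrite [LHS]mxE [RHS]mxE; congr (_^*).
    by rewrite [LHS]mxE [RHS]mxE E.
  move=> <-; rewrite lt_def; apply/andP; split.
    apply: contraNneq v0 => h; rewrite -[v]trmxCK.
    suff -> : v ^t* = 0 by rewrite trmx0 map_mx0.
    by apply: dotmx_eq0; rewrite trmxCK.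
  by rewrite mxE; apply: sumr_ge0 => i _; rewrite !mxE mulrC mul_conjC_ge0.
pose s := (sqrtC c)^-1.
have s_ge0 : 0 <= s by rewrite invr_ge0 sqrtC_ge0 ltW.
exists (s *: W0) => [|a la]; last by rewrite -scalemxAr KW // scalemxAl.
rewrite -trmxC_unitary; apply/unitarymxP; rewrite trmxCK.
rewrite [(s *: W0)^T]linearZ /= map_mxZ /= -scalemxAl -scalemxAr scalerA -/M Mc.
rewrite geC0_conj // -expr2 exprVn sqrtCK scale_scalar_mx mulVf //.
by rewrite gt_eqF.
Qed.

End GammaMatrices.

(** * SU(4) acts on the skew matrices by rotations *)

Lemma unitary_trmx_conj (C : numClosedFieldType) n (U : 'M[C]_n) :
  U \is unitarymx -> U^T *m map_mx conjC U = 1%:M.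
Proof.
move=> uU; have := unitary_trC_mul uU => /(congr1 (map_mx conjC)).
rewrite map_mxM map_mx1 /= => <-; congr (_ *m _).
by apply/matrixP => i j; rewrite !mxE conjCK.
Qed.

Lemma congruence_conj_mul (C : numClosedFieldType) n (N A B : 'M[C]_n) :
  N \is unitarymx ->
  (N *m A *m N^T) *m map_mx conjC (N *m B *m N^T)
  = N *m (A *m map_mx conjC B) *m N ^t*.
Proof.
move=> uN; rewrite !map_mxM /= !mulmxA -(mulmxA _ N^T) unitary_trmx_conj //.
by rewrite mulmx1.
Qed.

Section SpinorRotations.

Variable R : realType.
Local Notation C := R[i].
Local Notation "x %:C" := (real_complex R x).
Local Notation A := (@spinor_mx R).
Local Notation cA u := (map_mx conjC (spinor_mx u)).

Lemma skew_inj (K : comNzRingType)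
    (z1 z1' z2 z2' z3 z3' w1 w1' w2 w2' w3 w3' : K) :
  skew z1 z1' z2 z2' z3 z3' = skew w1 w1' w2 w2' w3 w3' ->
  [/\ z1 = w1, z1' = w1', z2 = w2, z2' = w2' & z3 = w3 /\ z3' = w3'].
Proof.
move=> /eq_block_mx[/mx2_inj[_ e1 _ _]] /mx2_inj[e2 e3 e3' e2'] _
  /mx2_inj[_ e1' _ _]; split=> //.
exact: oppr_inj.
Qed.

Lemma skew_star (K : comNzRingType) (z1 z1' z2 z2' z3 z3' : K) :
  skew z1 z1' z2 z2' z3 z3' *m skew z1' z1 z2' z2 z3' z3
  = (- (z1 * z1' + z2 * z2' + z3 * z3'))%:M.
Proof.
rewrite /skew mulmx_block !mx2M !mx2D scalar_mx_block !mx2_scalar.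
by congr block_mx; first [congr mx2; ring|apply: mx2P; rewrite !mxE; ring].
Qed.

Lemma spinor_mx_sqr u : A u *m cA u = (- (sqnorm u)%:C)%:M.
Proof.
rewrite spinor_mx_conj skew_star; congr ((- _)%:M).
rewrite /sqnorm big_ord6; apply/eqP; rewrite eq_complex /=.
by apply/andP; split; apply/eqP; ring.
Qed.

Lemma spinor_mx_sqr' u : cA u *m A u = (- (sqnorm u)%:C)%:M.
Proof.
have := congr1 (map_mx conjC) (spinor_mx_sqr u); rewrite map_mxM /=.
have -> : map_mx conjC (cA u) = A u by apply/matrixP => i j; rewrite !mxE conjCK.
move=> ->; rewrite map_scalar_mx /= rmorphN; congr ((- _)%:M).
by rewrite [LHS]conj_Complex oppr0.
Qed.

Lemma spinor_mxB u v : A (u - v) = A u - A v.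
Proof.
have := spinor_mx_linear (-1) v u; rewrite scaleN1r addrC => ->.
by rewrite rmorphN rmorph1 scaleN1r addrC.
Qed.

Lemma spinor_mx0 : A 0 = 0.
Proof. by have := spinor_mxB 0 0; rewrite subrr subrr. Qed.

Lemma spinor_mxZ a u : A (a *: u) = a%:C *: A u.
Proof. by rewrite -[a *: u]addr0 spinor_mx_linear spinor_mx0 addr0. Qed.

Lemma spinor_mx_inj : injective A.
Proof.
move=> u v uv; apply/eqP; rewrite -subr_eq0 -sqnorm_eq0.
have := spinor_mx_sqr (u - v); rewrite spinor_mxB uv subrr mul0mx.
move=> /matrixP/(_ q0 q0); rewrite !mxE eqxx mulr1n => /esym/eqP.
by rewrite oppr_eq0 fmorph_eq0.
Qed.

Lemma spinor_mx_mul n (v : 'rV[R]_n) (B : 'M[R]_(n, 6)) :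
  A (v *m B) = \sum_i (v 0 i)%:C *: A (row i B).
Proof.
rewrite mulmx_sum_row; elim/big_rec2: _ => [|i H u _ <-]; first exact: spinor_mx0.
by rewrite spinor_mx_linear.
Qed.

Lemma spinor_mx_unitary u : sqnorm u = 1 -> A u \is unitarymx.
Proof.
move=> u1; apply/unitarymxP; rewrite spinor_mx_tr map_mxN mulmxN spinor_mx_sqr u1.
by rewrite raddfN /= opprK rmorph1.
Qed.

(** Apply the Pfaffian identity to A conj A A^T = A. *)
Lemma det_spinor_mx u : sqnorm u = 1 -> \det (A u) = 1.
Proof.
move=> u1; set z1 := Complex (u 0 (o6 0)) (u 0 (o6 1)).
have := skew_congruence_det (A u)
  (Complex (u 0 (o6 0)) (- u 0 (o6 1))) (Complex (u 0 (o6 0)) (u 0 (o6 1)))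
  (Complex (u 0 (o6 2)) (- u 0 (o6 3))) (Complex (u 0 (o6 2)) (u 0 (o6 3)))
  (Complex (u 0 (o6 4)) (- u 0 (o6 5))) (Complex (u 0 (o6 4)) (u 0 (o6 5))).
rewrite -spinor_mx_conj spinor_mx_sqr u1 rmorph1 spinor_mx_tr mulmxN.
rewrite raddfN /= mulNmx opprK mul1mx.
move=> [s1 [s1' [s2 [s2' [s3 [s3' [/skew_inj[<- <- <- <- [<- <-]] pf]]]]]]].
have pf1 : Complex (u 0 (o6 0)) (- u 0 (o6 1)) * Complex (u 0 (o6 0)) (u 0 (o6 1))
  + Complex (u 0 (o6 2)) (- u 0 (o6 3)) * Complex (u 0 (o6 2)) (u 0 (o6 3))
  + Complex (u 0 (o6 4)) (- u 0 (o6 5)) * Complex (u 0 (o6 4)) (u 0 (o6 5)) = 1 :> C.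
  rewrite -[RHS](rmorph1 (real_complex R)) -u1 /sqnorm big_ord6.
  by apply/eqP; rewrite eq_complex /=; apply/andP; split; apply/eqP; ring.
move: pf; rewrite pf1 mulr1 => <-; rewrite -[RHS]pf1.
by congr (_ + _ + _); rewrite mulrC.
Qed.

(** U A(u) U^T is skew of Pfaffian 1, and S conj S = -1 because U is unitary;
    so conj S is the dual of S, that is, S is in the image of A. *)
Lemma su4_spinor (U : 'M[C]_(2 + 2)) u : U \is unitarymx -> \det U = 1 ->
  sqnorm u = 1 -> exists u', U *m A u *m U^T = A u'.
Proof.
move=> uU dU u1.
have [s1 [s1' [s2 [s2' [s3 [s3' [SE pf]]]]]]] := skew_congruence_det U
  (Complex (u 0 (o6 0)) (u 0 (o6 1))) (Complex (u 0 (o6 0)) (- u 0 (o6 1)))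
  (Complex (u 0 (o6 2)) (u 0 (o6 3))) (Complex (u 0 (o6 2)) (- u 0 (o6 3)))
  (Complex (u 0 (o6 4)) (u 0 (o6 5))) (Complex (u 0 (o6 4)) (- u 0 (o6 5))).
have {}pf : s1 * s1' + s2 * s2' + s3 * s3' = 1.
  rewrite pf dU mul1r -[RHS](rmorph1 (real_complex R)) -u1 /sqnorm big_ord6.
  by apply/eqP; rewrite eq_complex /=; apply/andP; split; apply/eqP; ring.
rewrite -/(A u) in SE; set S := skew _ _ _ _ _ _ in SE.
have SS : S *m map_mx conjC S = (-1)%:M.
  rewrite -SE (congruence_conj_mul _ _ uU) spinor_mx_sqr u1 rmorph1.
  by rewrite raddfN /= mulmxN mulmx1 mulNmx (unitarymxP uU).
have SS' : S *m skew s1' s1 s2' s2 s3' s3 = (-1)%:M by rewrite skew_star pf.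
have Su : S \in unitmx.
  have : S *m (- map_mx conjC S) = 1%:M by rewrite mulmxN SS raddfN /= opprK.
  by case/mulmx1_unit.
have : map_mx conjC S = skew s1' s1 s2' s2 s3' s3.
  by apply: (can_inj (mulKmx Su)); rewrite SS SS'.
rewrite skew_conj => /skew_inj[c1 _ c2 _ [c3 _]].
exists (\row_i nth 0 [:: complex.Re s1; complex.Im s1; complex.Re s2;
  complex.Im s2; complex.Re s3; complex.Im s3] i).
rewrite SE /S -c1 -c2 -c3 /spinor_mx !mxE !inordK //=.
by case: s1 s2 s3 {S SE pf SS SS' Su c1 c2 c3} => [a1 b1] [a2 b2] [a3 b3].
Qed.

(** The scalar product on R^6 is recovered from the products A(u) conj A(w),
    which are conjugated by U. *)
Lemma su4_rotation (U : 'M[C]_(2 + 2)) : U \is unitarymx -> \det U = 1 ->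
  exists2 g : 'M[R]_6, orthomx_real g &
    forall u, U *m A u *m U^T = A (u *m g).
Proof.
move=> uU dU.
have e1 i : sqnorm (delta_mx 0 i : 'rV[R]_6) = 1.
  rewrite /sqnorm (bigD1 i) //= big1 => [|k /negPf ki]; rewrite !mxE ?eqxx.
    by rewrite expr1n addr0.
  by rewrite ki expr0n.
have /choice[gr grE] : forall i : 'I_6, exists u',
    U *m A (delta_mx 0 i) *m U^T = A u'.
  by move=> i; apply: su4_spinor.
pose g := \matrix_i gr i.
have gE u : U *m A u *m U^T = A (u *m g).
  rewrite spinor_mx_mul -[u in LHS]mulmx1 spinor_mx_mul mulmx_sumr mulmx_suml.
  by apply: eq_bigr => i _; rewrite rowK -grE row1 -scalemxAr -scalemxAl.
exists g => //; apply/matrixP => i k.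
have := spinor_mx_polar (delta_mx 0 i *m g) (delta_mx 0 k *m g).
rewrite -!gE (congruence_conj_mul (A (delta_mx 0 i)) (A (delta_mx 0 k)) uU).
rewrite (congruence_conj_mul (A (delta_mx 0 k)) (A (delta_mx 0 i)) uU) -mulmxDl -mulmxDr spinor_mx_polar.
rewrite mul_mx_scalar -scalemxAl (unitarymxP uU) scalemx1.
move=> /matrixP/(_ q0 q0); rewrite [LHS]mxE [RHS]mxE eqxx !mulr1n.
move=> /(@complexI R) e; have {e} := mulfI _ e; rewrite oppr_eq0 pnatr_eq0.
move=> /(_ isT) e.
transitivity (((delta_mx 0 i : 'rV_6) *m g *m ((delta_mx 0 k : 'rV_6) *m g)^T) 0 0).
  rewrite trmx_mul mulmxA -(mulmxA (delta_mx 0 i)) trmx_delta -rowE -colE.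
  by rewrite [RHS]mxE [RHS]mxE.
rewrite -e trmx_delta mul_delta_mx_cond mxE.
by case: eqP => _; rewrite ?mulr1n ?mulr0n mxE ?eqxx.
Qed.

End SpinorRotations.

(** * The half-spin representation in coordinates *)

Section AnticommutingFamily.

Variables (A : nzRingType) (p : nat -> A).
Hypothesis pp : forall a, (0 < a < 6)%N -> p a * p a = -1.
Hypothesis pC : forall a b, (0 < a < 6)%N -> (0 < b < 6)%N -> a != b ->
  p a * p b = - (p b * p a).

Lemma volume_sqr : (p 1 * p 2 * p 3 * p 4 * p 5) * (p 1 * p 2 * p 3 * p 4 * p 5) = -1.
Proof.
have sq (x y : A) (s : bool) : x * x = -1 -> y * x = (-1) ^+ s * (x * y) ->
    (x * y) * (x * y) = - ((-1) ^+ s * (y * y)).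
  move=> xx yx; rewrite mulrA -(mulrA x y x) yx.
  case: s {yx}; rewrite ?expr1 ?expr0 ?mulN1r ?mul1r ?mulrN ?mulNr !mulrA xx.
    by rewrite mulN1r mulNr.
  by rewrite mulN1r mulNr.
have C a b x (s : bool) : (0 < a < 6)%N -> (0 < b < 6)%N -> b != a ->
    x * p a = (-1) ^+ s * (p a * x) ->
    (p b * x) * p a = (-1) ^+ (~~ s) * (p a * (p b * x)).
  move=> la lb ba xa; rewrite -mulrA xa; case: s {xa} => /=.
    by rewrite expr1 expr0 mulN1r mul1r mulrN (mulrA (p b)) (pC lb la ba) mulNr opprK -mulrA.
  by rewrite expr1 expr0 mulN1r mul1r (mulrA (p b)) (pC lb la ba) mulNr -mulrA.
have C1 a b : (0 < a < 6)%N -> (0 < b < 6)%N -> b != a ->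
    p b * p a = (-1) ^+ true * (p a * p b).
  by move=> la lb ba; rewrite expr1 mulN1r -pC.
have -> : p 1 * p 2 * p 3 * p 4 * p 5 = p 1 * (p 2 * (p 3 * (p 4 * p 5))).
  by rewrite !mulrA.
rewrite (sq _ _ false (@pp 1 isT) (C 1 2 _ true isT isT isT
  (C 1 3 _ false isT isT isT (C 1 4 _ true isT isT isT (C1 1 5 isT isT isT))))).
rewrite (sq _ _ true (@pp 2 isT) (C 2 3 _ false isT isT isT
  (C 2 4 _ true isT isT isT (C1 2 5 isT isT isT)))).
rewrite (sq _ _ false (@pp 3 isT) (C 3 4 _ true isT isT isT (C1 3 5 isT isT isT))).
rewrite (sq _ _ true (@pp 4 isT) (C1 4 5 isT isT isT)) pp //.
by rewrite expr1 expr0 !mul1r !mulN1r !opprK.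
Qed.

End AnticommutingFamily.

Section HalfSpin.

Variables (R : realType) (L F : 'M[R]_7).
Hypothesis LF : line_decomposition L F.
Variable h : clifford R 7 -> 'M[R[i]]_(2 + 2).
Hypothesis hh : unitary_half_spin L F h.
Variable e0 : 'rV[R]_7.
Hypotheses (e01 : sqnorm e0 = 1) (e0L : (e0 :=: L)%MS).
Local Notation Cl := (clifford R 7).
Local Notation cv := (@clifford_vec R 7).
Local Notation C := R[i].
Local Notation "x %:C" := (real_complex R x).
Local Notation Ev := (even_clifford F).

Lemma vec_even (v w : 'rV[R]_7) : v *m e0^T = 0 -> w *m e0^T = 0 -> cv v * cv w \in Ev.
Proof.
move=> /eqP; rewrite -(sub_F LF e0L) => /submxP[D ->].
move=> /eqP; rewrite -(sub_F LF e0L) => /submxP[D' ->].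
apply: (subvP (sub_agenv _)).
rewrite !mulmx_sum_row !linear_sum mulr_suml; apply: memv_suml => i _.
rewrite mulr_sumr; apply: memv_suml => k _.
rewrite !linearZ -scalerAl -scalerAr; do 2!apply: memvZ.
by apply: memv_span; apply/allpairsP; exists (i, k); rewrite !mem_enum.
Qed.

Lemma one_even : 1 \in Ev.
Proof. exact: (subvP (sub1_agenv _)) (memv_line _). Qed.

Lemma mul_even x y : x \in Ev -> y \in Ev -> x * y \in Ev.
Proof. exact: memvM. Qed.

Lemma half_spin1 : h 1 = 1%:M.
Proof. exact: (half_spin_one hh). Qed.

Lemma half_spinM x y : x \in Ev -> y \in Ev -> h (x * y) = h x *m h y.
Proof. by move=> xE yE; apply: (half_spin_mul hh). Qed.

Lemma half_spin0 : h 0 = 0.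
Proof.
have := half_spin_linear hh 1 (mem0v Ev) (mem0v Ev).
rewrite scaler0 addr0 rmorph1 scale1r => e.
by apply: (addrI (h 0)); rewrite addr0 -e.
Qed.

Lemma half_spinD x y : x \in Ev -> y \in Ev -> h (x + y) = h x + h y.
Proof.
move=> xE yE; have := half_spin_linear hh 1 xE yE.
by rewrite scale1r rmorph1 scale1r.
Qed.

Lemma half_spinZ a x : x \in Ev -> h (a *: x) = a%:C *: h x.
Proof.
move=> xE; have := half_spin_linear hh a xE (mem0v Ev).
by rewrite addr0 half_spin0 addr0.
Qed.

Lemma half_spinN x : x \in Ev -> h (- x) = - h x.
Proof. by move=> xE; rewrite -scaleN1r half_spinZ // rmorphN rmorph1 scaleN1r. Qed.

Lemma half_spin_sum (I : finType) (G : I -> Cl) : (forall i, G i \in Ev) ->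
  h (\sum_i G i) = \sum_i h (G i).
Proof.
move=> GE; suff [] : h (\sum_i G i) = \sum_i h (G i) /\ \sum_i G i \in Ev by [].
elim/big_rec2: _ => [|i x y _ [e yE]]; first by rewrite half_spin0 mem0v.
by rewrite half_spinD // e rpredD.
Qed.

(** The rows of E are an orthonormal basis of F. *)
Definition frame (E : 'M[R]_(6, 7)) := E *m E^T = 1%:M /\ E *m e0^T = 0.

Lemma frame_exists : exists E, frame E.
Proof.
have [O OO rO] := ortho_with_row e01; pose P : 'M_(1 + 6, 7) := O.
have PP : P *m P^T = 1%:M by [].
have uP : usubmx P = e0.
  by rewrite -rO; apply/matrixP => i k; rewrite !mxE !ord1; congr (O _ _); apply: val_inj.
move: PP; rewrite -(vsubmxK P) tr_col_mx mul_col_row uP scalar_mx_block.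
by move=> /eq_block_mx[_ _ e1 e2]; exists (dsubmx P).
Qed.

Section Frame.

Variable E : 'M[R]_(6, 7).
Hypothesis fE : frame E.

Definition fvec (u : 'rV[R]_6) : Cl := cv (u *m E).
Local Notation d k := (delta_mx 0 (o6 k) : 'rV[R]_6).

Lemma fvec_polar u w : fvec u * fvec w + fvec w * fvec u = (- 2 * (u *m w^T) 0 0) *: 1.
Proof.
rewrite clifford_vec_polar trmx_mul mulmxA -(mulmxA u).
by have [-> _] := fE; rewrite mulmx1.
Qed.

Lemma basis_dot a b : (a < 6)%N -> (b < 6)%N -> (d a *m (d b)^T) 0 0 = (a == b)%:R.
Proof.
move=> la lb; rewrite trmx_delta mul_delta_mx_cond o6_eq // mulmxnE mxE !eqxx.
by case: eqP.
Qed.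

Lemma frame_perp (u : 'rV[R]_6) : u *m E *m e0^T = 0.
Proof. by rewrite -mulmxA; have [_ ->] := fE; rewrite mulmx0. Qed.

Lemma frame_coord (v : 'rV[R]_7) : v *m e0^T = 0 -> v = v *m E^T *m E.
Proof.
move=> ve; have [EE Ee] := fE.
have rE : row_free E.
  by apply/row_freeP; exists E^T.
have EF : (E <= F)%MS by rewrite (sub_F LF e0L) Ee.
have FE : (F <= E)%MS.
  have [rF _] := rank_F LF e0L.
  by rewrite -(mxrank_leqif_sup EF) rF.
have /submxP[D ->] : (v <= E)%MS.
  by apply: submx_trans FE; rewrite (sub_F LF e0L) ve.
by rewrite -(mulmxA D) EE mulmx1.
Qed.

Lemma fvec_even u w : fvec u * fvec w \in Ev.
Proof. by apply: vec_even; apply: frame_perp. Qed.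

Let p (a : nat) := fvec (d a) * fvec (d 0).

Lemma fvec_basisC a b : (a < 6)%N -> (b < 6)%N -> a != b ->
  fvec (d a) * fvec (d b) = - (fvec (d b) * fvec (d a)).
Proof.
move=> la lb ab; apply/eqP; rewrite -addr_eq0 fvec_polar basis_dot // (negPf ab).
by rewrite mulr0 scale0r.
Qed.

Lemma frame_sqnorm u : sqnorm (u *m E) = sqnorm u.
Proof.
have [EE _] := fE; have := sqnormE (u *m E).
rewrite trmx_mul mulmxA -(mulmxA u) EE mulmx1 sqnormE.
by move=> /matrixP/(_ 0 0); rewrite !mxE !eqxx.
Qed.

Lemma sqnorm_basis a : (a < 6)%N -> sqnorm (d a) = 1.
Proof.
by move=> la; have := basis_dot la la; rewrite sqnormE mxE !eqxx.
Qed.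

Lemma fvec_basis_sqr a : (a < 6)%N -> fvec (d a) * fvec (d a) = -1.
Proof. by move=> la; rewrite clifford_unit_sqr // frame_sqnorm sqnorm_basis. Qed.

Lemma bivec_mul u b : (0 < b < 6)%N -> fvec u * fvec (d 0) * p b = fvec u * fvec (d b).
Proof.
move=> /andP[b0 lb]; rewrite /p mulrA -(mulrA (fvec u)) fvec_basisC // 1?eq_sym -?lt0n //.
by rewrite mulrN mulrA mulNr -mulrA fvec_basis_sqr // mulrN1 opprK.
Qed.

Lemma bivec_sqr a : (0 < a < 6)%N -> p a * p a = -1.
Proof. by move=> la; rewrite bivec_mul // fvec_basis_sqr //; case/andP: la. Qed.

Lemma bivec_anticomm a b : (0 < a < 6)%N -> (0 < b < 6)%N -> a != b ->
  p a * p b = - (p b * p a).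
Proof.
move=> la lb ab; rewrite !bivec_mul // fvec_basisC //; first by case/andP: la.
by case/andP: lb.
Qed.

Definition volume := p 1 * p 2 * p 3 * p 4 * p 5.

(** The vector e_b anticommutes with one of the two factors of e_a e_0 if b is
    a or 0, and with both otherwise. *)
Lemma fvec_bivec b a : (b < 6)%N -> (0 < a < 6)%N ->
  fvec (d b) * p a = (-1) ^+ ((b == a) || (b == 0)) * (p a * fvec (d b)).
Proof.
move=> lb /andP[a0 la]; rewrite /p; case: (eqVneq b a) => [->|ba] /=.
  rewrite expr1 mulN1r -!mulrA [fvec (d 0) * _]fvec_basisC // 1?eq_sym -?lt0n //.
  by rewrite !mulrN opprK.
case: (eqVneq b 0%N) => [->|b0] /=.
  by rewrite expr1 mulN1r mulrA fvec_basisC // 1?eq_sym -?lt0n // mulNr.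
rewrite expr0 mul1r mulrA fvec_basisC // mulNr -!mulrA [fvec (d b) * _]fvec_basisC //.
by rewrite mulrN opprK.
Qed.

Lemma fvec_volume u : fvec u * volume = - (volume * fvec u).
Proof.
have db b : (b < 6)%N -> fvec (d b) * volume = - (volume * fvec (d b)).
  move=> lb; pose s a := (b == a) || (b == 0%N).
  have st x a (t : bool) : (0 < a < 6)%N -> fvec (d b) * x = (-1) ^+ t * (x * fvec (d b)) ->
      fvec (d b) * (x * p a) = (-1) ^+ (t (+) s a) * (x * p a * fvec (d b)).
    move=> la bx; rewrite mulrA bx -!mulrA fvec_bivec // -/(s a) signr_addb -mulrA.
    by congr (_ * _); rewrite !mulrA commr_sign.
  have := st _ 5 _ isT (st _ 4 _ isT (st _ 3 _ isT (st _ 2 _ isT (fvec_bivec lb (isT : (0 < 1 < 6)%N))))).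
  rewrite -/volume => ->.
  have -> : s 1 (+) s 2 (+) s 3 (+) s 4 (+) s 5 = true.
    by rewrite /s; case: b lb {s st} => [|[|[|[|[|[|]]]]]].
  by rewrite expr1 mulN1r.
rewrite [u]row_sum_delta /fvec mulmx_suml linear_sum mulr_suml mulr_sumr -sumrN.
apply: eq_bigr => i _; rewrite -scalemxAl linearZ /= -scalerAl -scalerAr -scalerN.
by congr (_ *: _); have := db i (ltn_ord i); rewrite /o6 inord_val.
Qed.

Lemma bivec_even a : p a \in Ev.
Proof. exact: fvec_even. Qed.

Lemma volume_even : volume \in Ev.
Proof.
by rewrite /volume; do 4!(apply: mul_even; last exact: bivec_even); apply: bivec_even.
Qed.

(** Each basis vector anticommutes with the five others, hence vectors of F
    anticommute with the volume element; products of two vectors commute with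
    it, and they generate. *)
Lemma volume_central x : x \in Ev -> x * volume = volume * x.
Proof.
have rowF i : exists u, cv (row i F) = fvec u.
  exists (row i F *m E^T); rewrite /fvec -frame_coord //.
  by apply/eqP; rewrite -(sub_F LF e0L) row_sub.
have EvC : (Ev <= 'C[volume])%VS.
  rewrite /even_clifford; set G := <<_>>%VS.
  suff GC : (G <= 'C[volume])%VS.
    apply: agenv_sub_modl; first by rewrite -memvE; apply: cent1v1.
    apply/prodvP => a b /(subvP GC) aC bC; exact: memvM.
  apply/span_subvP => _ /allpairsP[[i k] [_ _ ->]]; apply/cent1vP => /=.
  have [u ->] := rowF i; have [w ->] := rowF k.
  by rewrite -mulrA fvec_volume mulrN mulrA fvec_volume mulNr opprK mulrA.
by move=> /(subvP EvC)/cent1vP.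
Qed.

(** The eigenspaces of a central element are stable, so irreducibility makes it
    a scalar. *)
Lemma volume_scalar : exists2 c, h volume = c%:M & (c == imag R) || (c == - imag R).
Proof.
have [c ec] : exists c, eigenvalue (h volume)^T c by apply: eigenvalue_closed.
have ZE : h volume = c%:M.
  have st x : x \in Ev -> stablemx (eigenspace (h volume)^T c) (h x)^T.
    move=> xE; apply: comm_mx_stable_eigenspace; rewrite /comm_mx -!trmx_mul.
    by rewrite -!half_spinM ?volume_even // volume_central.
  have [] := half_spin_irr hh st.
    by move=> /eqP; rewrite mxrank_eq0; move: ec; rewrite /eigenvalue => /negPf ->.
  move=> r4; have full : row_full (eigenspace (h volume)^T c) by apply/eqP.
  have /eigenspaceP := submx_full 1%:M full; rewrite mul1mx scalemx1.
  by move=> /(congr1 trmx); rewrite trmxK tr_scalar_mx.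
exists c => //; have : h volume *m h volume = (-1)%:M.
  rewrite -half_spinM ?volume_even // volume_sqr.
  - by rewrite half_spinN ?one_even // half_spin1 raddfN.
  - exact: bivec_sqr.
  - exact: bivec_anticomm.
rewrite ZE -scalar_mxM => /matrixP/(_ q0 q0); rewrite !mxE eqxx !mulr1n => cc.
have : (c - imag R) * (c + imag R) = 0 by rewrite -subr_sqr !expr2 cc imag2 subrr.
by move=> /eqP; rewrite mulf_eq0 subr_eq0 addr_eq0.
Qed.

Lemma fvec_perp_seq us : unitary_seq us -> perp_seq e0 [seq u *m E | u <- us].
Proof.
elim: us => [//|u us IHus] /andP[/eqP u1 /IHus ps].
by rewrite perp_cons ps frame_sqnorm u1 frame_perp !eqxx.
Qed.

(** The product e_a e_0 is in N^0, so its image is unitary; as its square is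
    -1, it is skew-Hermitian. *)
Lemma half_spin_bivec_star a : (0 < a < 6)%N -> (h (p a)) ^t* = - h (p a).
Proof.
move=> la; have la6 : (a < 6)%N by case/andP: la.
have up : h (p a) \is unitarymx.
  have := @fvec_perp_seq [:: d a; d 0]; rewrite /= !sqnorm_basis // !eqxx => /(_ isT) ps.
  have := half_spin_unitary hh (perp_spinN0 LF e01 e0L ps isT).
  by rewrite vec_prod_cons vec_prod_cons /vec_prod big_nil mulr1.
have pp : h (p a) *m h (p a) = - 1%:M.
  by rewrite -half_spinM ?bivec_even // bivec_sqr // half_spinN ?one_even // half_spin1.
have := unitary_trC_mul up => /(congr1 (mulmx^~ (h (p a)))).
by rewrite -mulmxA pp mul1mx mulmxN mulmx1 => /(congr1 -%R); rewrite opprK.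
Qed.

Local Notation A := (@spinor_mx R).
Local Notation cA u := (map_mx conjC (spinor_mx u)).

(** It suffices to compare on the products e_a e_0, because u w is
    (u e_0) (w e_0) up to a multiple of u e_0, on both sides. *)
Lemma half_spin_normal_form : h volume = (imag R)%:M ->
  exists2 W, W \is unitarymx &
    forall u w, h (fvec u * fvec w) *m W = W *m (A u *m cA w).
Proof.
move=> hv; have [] := @gamma_normal_form _ (imag R) _ _ (fun a => h (p a)).
- exact: imag2.
- exact: conj_imag.
- by move=> a la; rewrite -half_spinM ?bivec_even // bivec_sqr // half_spinN ?one_even // half_spin1 raddfN.
- move=> a b la lb ab; rewrite -half_spinM ?bivec_even // -half_spinM ?bivec_even // bivec_anticomm //.
  by rewrite half_spinN //; apply: mul_even; apply: bivec_even.
- exact: half_spin_bivec_star.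
- by rewrite -!half_spinM; do ?[exact: hv|exact: bivec_even|apply: mul_even].
move=> W uW KW; exists W => //.
have K0 u : h (fvec u * fvec (d 0)) *m W = W *m (A u *m cA (d 0)).
  rewrite -[u]mulmx1 spinor_mx_mul mulmx_suml mulmx_sumr.
  rewrite /fvec mulmx1 {1}[u]row_sum_delta mulmx_suml linear_sum mulr_suml.
  rewrite half_spin_sum; last first.
    by move=> i; rewrite -scalemxAl linearZ /= -scalerAl memvZ ?fvec_even.
  rewrite mulmx_suml; apply: eq_bigr => i _.
  rewrite -scalemxAl linearZ /= -scalerAl half_spinZ ?fvec_even //.
  rewrite row1 -(inord_val i) -!scalemxAl -scalemxAr; congr (_ *: _).
  rewrite spinor_gamma_mx //; case: (posnP i) => [->|i0].
    by rewrite fvec_basis_sqr // half_spinN ?one_even // half_spin1 /= raddfN /= mulNmx mulmxN mul1mx mulmx1.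
  by apply: KW; rewrite i0 ltn_ord.
move=> u w.
pose c := - 2 * (d 0 *m w^T) 0 0.
have cE : fvec u * fvec w
    = (fvec u * fvec (d 0)) * (fvec w * fvec (d 0)) + (- c) *: (fvec u * fvec (d 0)).
  have fw : fvec (d 0) * fvec w = c *: 1 - fvec w * fvec (d 0).
    by rewrite -(fvec_polar (d 0) w) addrK.
  rewrite mulrA -(mulrA (fvec u) _ (fvec w)) fw mulrBr mulrBl -scalerAr mulr1.
  rewrite -scalerAl -!mulrA fvec_basis_sqr // mulrN1 mulrN opprK scaleNr.
  by rewrite addrC addrA addNr add0r.
have mE : A u *m cA w
    = (A u *m cA (d 0)) *m (A w *m cA (d 0)) + (- c)%:C *: (A u *m cA (d 0)).
  have fw : cA (d 0) *m A w = c%:C%:M - cA w *m A (d 0).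
    have := congr1 (map_mx conjC) (spinor_mx_polar (d 0) w).
    rewrite map_mxD !map_mxM /= map_scalar_mx /= conj_Complex oppr0.
    have K v : map_mx conjC (cA v) = A v by apply/matrixP => i k; rewrite !mxE conjCK.
    by rewrite !K => <-; rewrite addrK.
  rewrite mulmxA -(mulmxA (A u) _ (A w)) fw mulmxBr mulmxBl mul_mx_scalar.
  rewrite -scalemxAl -!mulmxA spinor_mx_sqr sqnorm_basis // rmorph1 raddfN /=.
  rewrite !mulmxN mulmx1 opprK rmorphN scaleNr.
  by rewrite addrC addrA addNr add0r.
rewrite cE mE half_spinD; last 2 first.
- by apply: mul_even; apply: fvec_even.
- by rewrite memvZ ?fvec_even.
rewrite half_spinM ?fvec_even // half_spinZ ?fvec_even // mulmxDl mulmxDr; congr (_ + _).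
  by rewrite -[LHS]mulmxA K0 [LHS]mulmxA K0 -[LHS]mulmxA.
by rewrite -scalemxAl K0 -scalemxAr.
Qed.

End Frame.
Local Notation d k := (delta_mx 0 (o6 k) : 'rV[R]_6).

(** Reversing the last vector of the frame changes the sign of the volume
    element. *)
Lemma oriented_frame : exists2 E, frame E & h (volume E) = (imag R)%:M.
Proof.
have [E fE] := frame_exists; have [c hv /orP[]/eqP cE] := volume_scalar fE.
  by exists E => //; rewrite hv cE.
have d5 : sqnorm (d 5) = 1 by rewrite (sqnorm_basis (a := 5)).
exists (reflection (d 5) *m E).
  have [EE Ee] := fE; split; last by rewrite -mulmxA Ee mulmx0.
  by rewrite trmx_mul mulmxA -(mulmxA _ E) EE mulmx1; apply: reflection_ortho.
have cFE a : (a < 5)%N -> fvec (reflection (d 5) *m E) (d a) = fvec E (d a).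
  move=> la; rewrite /fvec mulmxA reflection_fix // trmx_delta mul_delta_mx_cond.
  rewrite o6_eq //; last by apply: ltnW.
  by rewrite gtn_eqF.
have cF5 : fvec (reflection (d 5) *m E) (d 5) = - fvec E (d 5).
  rewrite /fvec mulmxA /reflection mulmxBr mulmx1 -scalemxAr mulmxA sqnormE d5 mul1mx.
  by rewrite scaler_nat mulr2n opprD addrA subrr add0r mulNmx linearN.
by rewrite /volume cF5 !cFE // !mulNr mulrN half_spinN ?volume_even // hv cE -raddfN opprK.
Qed.

Lemma spin_model : exists E W, [/\ frame E, W \is unitarymx,
  h (volume E) = (imag R)%:M & forall u w, h (fvec E u * fvec E w) *m W
      = W *m (spinor_mx u *m map_mx conjC (spinor_mx w))].
Proof.
have [E fE hv] := oriented_frame; have [W uW hW] := half_spin_normal_form fE hv.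
by exists E, W.
Qed.

End HalfSpin.

(** * N^0 is SU(4), and the other coset acts by complex conjugation *)

(** Polarization, as in the Clifford algebra: A(v) conj A(u) A(v) is the
    analogue of v u v. *)
Lemma spinor_mx_reflection (R : realType) (v u : 'rV[R]_6) : sqnorm v = 1 ->
  spinor_mx v *m map_mx conjC (spinor_mx u) *m spinor_mx v
  = spinor_mx (u *m reflection v).
Proof.
move=> v1; have e := spinor_mx_polar v u.
have {e} -> : spinor_mx v *m map_mx conjC (spinor_mx u)
    = (real_complex R (- 2 * (v *m u^T) 0 0))%:M
      - spinor_mx u *m map_mx conjC (spinor_mx v) by rewrite -e addrK.
rewrite mulmxBl -mulmxA spinor_mx_sqr' v1 rmorph1 raddfN /= mulmxN mulmx1 opprK.
rewrite mul_scalar_mx /reflection mulmxBr mulmx1 -scalemxAr mulmxA.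
rewrite [u *m v^T]mx11_scalar mul_scalar_mx scalerA spinor_mxB spinor_mxZ addrC.
rewrite -scaleNr -rmorphN; congr (_ + real_complex R _ *: _).
rewrite mulNr; congr (- (_ * _)).
by rewrite -[v *m u^T]trmxK trmx_mul trmxK mxE.
Qed.

Lemma sandwich_mul (K : comNzRingType) n (B B' X Y Z : 'M[K]_n) :
    B *m B' = - 1%:M -> B' *m B = - 1%:M ->
  (B *m X *m B) *m (B' *m Y *m B') *m (B *m Z *m - B')
  = B *m (X *m Y *m Z) *m - B'.
Proof.
move=> BB' B'B; rewrite -!mulmxA; do 2!congr (_ *m _).
rewrite (mulmxA B B') BB' mulNmx mul1mx (mulmxA B' B) B'B.
by rewrite !mulNmx mul1mx !mulmxN opprK.
Qed.

Section SpinModel.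

Variables (R : realType) (L F : 'M[R]_7).
Hypothesis LF : line_decomposition L F.
Variable h : clifford R 7 -> 'M[R[i]]_(2 + 2).
Hypothesis hh : unitary_half_spin L F h.
Variable e0 : 'rV[R]_7.
Hypotheses (e01 : sqnorm e0 = 1) (e0L : (e0 :=: L)%MS).
Local Notation Cl := (clifford R 7).
Local Notation cv := (@clifford_vec R 7).
Local Notation C := R[i].
Local Notation "x %:C" := (real_complex R x).
Local Notation Ev := (even_clifford F).
Local Notation A := (@spinor_mx R).
Local Notation cA u := (map_mx conjC (spinor_mx u)).
Local Notation d k := (delta_mx 0 (o6 k) : 'rV[R]_6).

Variables (E : 'M[R]_(6, 7)) (W : 'M[C]_(2 + 2)).
Hypotheses (fE : frame e0 E) (uW : W \is unitarymx).
Hypothesis hv : h (volume E) = (imag R)%:M.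
Hypothesis hW : forall u w, h (fvec E u * fvec E w) *m W = W *m (A u *m cA w).
Local Notation lift := (map (fun u => mulmx u E)).
Let n0 := fvec E (d 0) * cv e0.

Lemma even_vec_prod us : ~~ odd (size us) -> vec_prod (lift us) \in Ev.
Proof.
move: us; apply: even_seq_ind => [|v w us _ IHus] /=.
  by rewrite /vec_prod big_nil one_even.
by rewrite !vec_prod_cons mulrA mul_even // (fvec_even LF e0L fE).
Qed.

Lemma frame_reflection m (u : 'M_(m, 6)) (v : 'rV[R]_6) :
  u *m E *m reflection (v *m E) = u *m reflection v *m E.
Proof.
have [EE _] := fE; rewrite /reflection !mulmxBr !mulmx1 mulmxBl; congr (_ - _).
rewrite -!scalemxAr -scalemxAl trmx_mul !mulmxA; congr (_ *: (_ *m E)).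
by rewrite -(mulmxA u E) EE mulmx1.
Qed.

Lemma conjmxK (M : 'M[C]_(2 + 2)) : map_mx conjC (map_mx conjC M) = M.
Proof. by apply/matrixP => i k; rewrite !mxE conjCK. Qed.

(** The spin element and its image in SU(4) act compatibly, on vectors by
    conjugation and on skew matrices by congruence. *)
Lemma model_even us : unitary_seq us -> ~~ odd (size us) ->
  exists M G, [/\ h (vec_prod (lift us)) *m W = W *m M, M \is unitarymx, \det M = 1,
    E *m vec_rot (lift us) = G *m E & forall u, M *m A u *m M^T = A (u *m G)].
Proof.
move=> uu eu; move: us eu uu; apply: even_seq_ind => [_|v w us eu IHus].
  exists 1%:M, 1%:M; rewrite /vec_prod big_nil (half_spin1 hh); split.
  - by rewrite mulmx1 mul1mx.
  - by apply/unitarymxP; rewrite trmx1 map_mx1 mulmx1.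
  - exact: det1.
  - by rewrite mulmx1 mul1mx.
  by move=> u; rewrite trmx1 !mulmx1 mul1mx.
move=> /= /and3P[/eqP v1 /eqP w1 /IHus[M [G [hM uM dM aM GM]]]].
exists (A v *m cA w *m M), (G *m reflection w *m reflection v).
have ucw : cA w \is unitarymx.
  by rewrite conjC_unitary spinor_mx_unitary.
split.
- rewrite !vec_prod_cons mulrA (half_spinM hh) ?even_vec_prod ?(fvec_even LF e0L fE) //.
  by rewrite -mulmxA hM mulmxA hW -!mulmxA.
- exact: mul_unitarymx (mul_unitarymx (spinor_mx_unitary v1) ucw) uM.
- by rewrite !det_mulmx dM det_map_mx !det_spinor_mx // rmorph1 !mulr1.
- by rewrite /= !(mulmxN, mulNmx) opprK !mulmxA aM !frame_reflection.
move=> u; have trc (X : 'M[C]_(2 + 2)) :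
    A v *m cA w *m M *m X *m (A v *m cA w *m M)^T
    = A v *m (cA w *m (M *m X *m M^T) *m cA w) *m A v.
  rewrite !trmx_mul spinor_mx_tr map_trmx spinor_mx_tr map_mxN.
  by rewrite !(mulmxN, mulNmx) opprK !mulmxA.
rewrite trc GM -{1}(conjmxK (A (u *m G))) -!map_mxM /= spinor_mx_reflection //.
by rewrite spinor_mx_reflection // !mulmxA.
Qed.

Lemma perp_frame s : perp_seq e0 s -> exists2 us, unitary_seq us & s = lift us.
Proof.
elim: s => [_|v s IHs]; first by exists [::].
rewrite perp_cons => /and3P[v1 /eqP ve /IHs[us uu ->]].
have vE := frame_coord LF e0L fE ve.
exists (v *m E^T :: us); last by rewrite /= -vE.
by rewrite /unitary_seq /= -(frame_sqnorm fE) -vE v1.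
Qed.

(** In [spinN0_perp] the scalar is 1 or -1 because h is unitary on N^0, and a
    sign is absorbed by inserting a unit vector twice. *)
Lemma spinN0_frame x : spinN0 L F x ->
  exists us, [/\ unitary_seq us, ~~ odd (size us) & x = vec_prod (lift us)].
Proof.
move=> N0x; have [s [c [ps es xE]]] := spinN0_perp LF e01 e0L N0x.
have [us uu sE] := perp_frame ps; subst s; rewrite size_map in es.
have ux := half_spin_unitary hh N0x.
have N0s : spinN0 L F (vec_prod (lift us)).
  by apply: (perp_spinN0 LF e01 e0L ps); rewrite size_map.
have conjr (a : R) : (a%:C)^* = a%:C by rewrite [LHS]conj_Complex oppr0.
have c2 : c ^+ 2 = 1.
  have /unitarymxP := ux; rewrite xE (half_spinZ hh) ?even_vec_prod // linearZ /= map_mxZ /= conjr.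
  rewrite -scalemxAl -scalemxAr scalerA (unitarymxP (half_spin_unitary hh N0s)).
  move=> /matrixP/(_ q0 q0); rewrite !mxE eqxx !mulr1 -rmorphM.
  by move=> /(@complexI R) <-; rewrite expr2.
move: c2 => /eqP; rewrite sqrf_eq1 => /orP[]/eqP cE.
  by exists us; rewrite xE cE scale1r.
(* The product of d 0 with itself is -1. *)
exists [:: d 0, d 0 & us]; rewrite /unitary_seq /= sqnorm_basis // !eqxx /= negbK; split=> //.
rewrite !vec_prod_cons mulrA clifford_unit_sqr ?(frame_sqnorm fE) ?sqnorm_basis //.
by rewrite xE cE scaleN1r mulN1r.
Qed.

Definition model x := W ^t* *m h x *m W.

Lemma spinN0_even x : spinN0 L F x -> x \in Ev.
Proof. by move=> /spinN0_frame[us [_ eu ->]]; apply: even_vec_prod. Qed.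

Lemma spinN0_model x : spinN0 L F x ->
  exists G, [/\ \det (h x) = 1, E *m spin_action x = G *m E &
    forall u, model x *m A u *m (model x)^T = A (u *m G)].
Proof.
move=> N0x; have [us [uu eu xE]] := spinN0_frame N0x.
have [M [G [hM uM dM aM GM]]] := model_even uu eu.
have WW := unitary_trC_mul uW.
have Mx : model x = M by rewrite /model -mulmxA xE hM mulmxA WW mul1mx.
exists G; split=> //; last by rewrite Mx.
- have := congr1 determinant hM; rewrite -xE !det_mulmx dM mulr1 -[RHS]mul1r.
  apply: mulIf; have := unitarymx_unit uW; rewrite unitmxE unitfE //.
- by rewrite xE spin_action_vec_prod //; elim: us uu {eu xE hM aM} => //= u us IHus
    /andP[u1 /IHus]; rewrite /unitary_seq /= (frame_sqnorm fE) u1 => ->.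
Qed.

Lemma frame_decomp (v : 'rV[R]_7) : v = v *m E^T *m E + v *m e0^T *m e0.
Proof.
have [_ Ee] := fE; have e0E : e0 *m E^T = 0 by rewrite -[e0]trmxK -trmx_mul Ee trmx0.
have := frame_coord LF e0L fE (v := v - v *m e0^T *m e0).
rewrite mulmxBl -(mulmxA _ e0 e0^T) sqnormE e01 mulmx1 subrr => /(_ erefl) e.
rewrite -[LHS](subrK (v *m e0^T *m e0)) {1}e mulmxBl -(mulmxA _ e0) e0E.
by rewrite mulmx0 subr0.
Qed.

(** If h z = 1 then z acts trivially on the vectors, so it is central and even,
    hence a scalar, and this scalar is 1. *)
Lemma half_spin_inj x y : spinN0 L F x -> spinN0 L F y -> h x = h y -> x = y.
Proof.
move=> Nx Ny hxy; have ux : x \is a GRing.unit by apply: spin_unit Nx.1.1.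
have Nz : spinN0 L F (x^-1 * y).
  by apply: (spinN0M LF e01 e0L) => //; apply: (spinN0V LF e01 e0L).
set z := x^-1 * y in Nz; have zE := spinN0_even Nz.
have hz : h z = 1%:M.
  have hVx : h x^-1 *m h x = 1%:M.
    by rewrite -(half_spinM hh) ?spinN0_even ?mulVr ?(half_spin1 hh) //; apply: (spinN0V LF e01 e0L).
  rewrite (half_spinM hh) ?spinN0_even -?hxy //; exact: (spinN0V LF e01 e0L).
have mz : model z = 1%:M by rewrite /model hz mulmx1 unitary_trC_mul.
have [G [_ EG AG]] := spinN0_model Nz.
have uG (u : 'rV[R]_6) : u *m G = u.
  by apply: (@spinor_mx_inj R); rewrite -AG mz trmx1 mul1mx mulmx1.
have ez : e0 *m spin_action z = e0 by have /(spinN0P LF e01 e0L)[] := Nz.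
have vz (v : 'rV[R]_7) : v *m spin_action z = v.
  rewrite {1}[v]frame_decomp mulmxDl -[X in X + _]mulmxA EG mulmxA uG.
  by rewrite -[X in _ + X]mulmxA ez -frame_decomp.
have [s [es us zs]] := Nz.1.1.
have pz : parity false z by have := @parity_vec_prod R 7 s; rewrite (negPf es) /vec_prod -zs.
have zc i : cv (delta_mx 0 i) * z = (-1) ^+ false * (z * cv (delta_mx 0 i)).
  have e := spin_action_conj (delta_mx 0 i) Nz.1.1; rewrite vz in e.
  by rewrite expr0 mul1r -{1}e (mulrVK (spin_unit Nz.1.1)).
have zE' := parity_commute pz zc; move: zE' => /= zE'.
have z1 : z = 1.
  have := hz; rewrite zE' (half_spinZ hh) ?one_even // (half_spin1 hh) scalemx1.
  move=> /matrixP/(_ q0 q0); rewrite !mxE eqxx !mulr1n => /(@complexI R) ->.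
  by rewrite scale1r.
by rewrite -[LHS]mulr1 -z1 /z mulVKr.
Qed.

Lemma gamma_mx_volume : gamma_mx (imag R) 1 *m gamma_mx (imag R) 2 *m gamma_mx (imag R) 3 *m gamma_mx (imag R) 4
  *m gamma_mx (imag R) 5 = (imag R)%:M.
Proof.
pose p a := fvec E (d a) * fvec E (d 0).
have pE a : p a \in Ev by apply: (fvec_even LF e0L fE).
have hp a : (a < 6)%N -> h (p a) *m W = W *m gamma_mx (imag R) a.
  by move=> la; rewrite hW spinor_gamma_mx.
have step x X a : (a < 6)%N -> x \in Ev -> h x *m W = W *m X ->
    h (x * p a) *m W = W *m (X *m gamma_mx (imag R) a).
  by move=> la xE hx; rewrite (half_spinM hh) // -mulmxA hp // mulmxA hx -mulmxA.
have p2 := mul_even (pE 1) (pE 2); have p3 := mul_even p2 (pE 3).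
have p4 := mul_even p3 (pE 4).
have e := step _ _ 5 isT p4 (step _ _ 4 isT p3 (step _ _ 3 isT p2
  (step _ _ 2 isT (pE 1) (hp 1 isT)))).
apply: (can_inj (mulKmx (unitarymx_unit uW))); rewrite -e.
by rewrite -[X in h X]/(volume E) hv mul_scalar_mx mul_mx_scalar.
Qed.

(** N commutes with all A(u) conj A(w), hence with the gamma matrices. *)
Lemma spinor_commute_scalar (N : 'M[C]_(2 + 2)) : N \is unitarymx ->
  (forall u, N *m A u *m N^T = A u) -> N = 1%:M \/ N = - 1%:M.
Proof.
move=> uN NA.
have [c NE] : exists c, N = c%:M.
  apply: (@gamma_mx_commutant _ (imag R)); first exact: imag2.
  move=> k /andP[_ lk]; have {}lk : (k < 6)%N by apply: ltn_trans lk _.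
  have := congruence_conj_mul (A (d k)) (A (d 0)) uN.
  rewrite !NA spinor_gamma_mx // => e.
  by rewrite [in RHS]e -[RHS]mulmxA unitary_trC_mul // mulmx1.
have : c ^+ 2 = 1.
  have := NA (d 0); rewrite NE tr_scalar_mx mul_mx_scalar mul_scalar_mx scalerA.
  move=> /(congr1 (mulmx^~ (cA (d 0)))); rewrite -scalemxAl spinor_mx_sqr.
  rewrite sqnorm_basis // rmorph1 scale_scalar_mx => /matrixP/(_ q0 q0).
  by rewrite !mxE eqxx !mulr1n mulrN1 => /oppr_inj; rewrite expr2.
move=> /eqP; rewrite sqrf_eq1 NE => /orP[]/eqP ->; first by left.
by right; rewrite raddfN.
Qed.

(** N would conjugate each gamma matrix to its complex conjugate; but their
    product is the scalar i. *)
Lemma spinor_conj_absurd (N : 'M[C]_(2 + 2)) : N \is unitarymx ->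
  ~ (forall u, N *m A u *m N^T = - cA u).
Proof.
move=> uN NA.
have Ng k : (k < 6)%N -> N *m gamma_mx (imag R) k = map_mx conjC (gamma_mx (imag R) k) *m N.
  move=> lk; have := congruence_conj_mul (A (d k)) (A (d 0)) uN.
  rewrite !NA map_mxN /= conjmxK mulmxN mulNmx opprK spinor_gamma_mx // => e.
  rewrite -(spinor_gamma_mx _ lk) map_mxM /= conjmxK e spinor_gamma_mx //.
  by rewrite -mulmxA unitary_trC_mul // mulmx1.
have step X k : (k < 6)%N -> N *m X = map_mx conjC X *m N ->
    N *m (X *m gamma_mx (imag R) k) = map_mx conjC (X *m gamma_mx (imag R) k) *m N.
  by move=> lk NX; rewrite map_mxM [LHS]mulmxA NX -[LHS]mulmxA Ng // [LHS]mulmxA.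
have := step _ 5 isT (step _ 4 isT (step _ 3 isT (step _ 2 isT (Ng 1 isT)))).
rewrite gamma_mx_volume map_scalar_mx /= conj_imag mul_mx_scalar mul_scalar_mx => e.
have : (imag R *+ 2) *: N = 0 by rewrite mulr2n scalerDl {1}e -scalerDl addNr scale0r.
move=> /eqP; rewrite scaler_eq0 mulrn_eq0 (negPf (imag_neq0 R)) /= => /eqP N0.
have := unitarymxP uN; rewrite N0 mul0mx => /matrixP/(_ q0 q0).
by rewrite !mxE eqxx => /esym/eqP; rewrite oner_eq0.
Qed.

Lemma lift_perp us : unitary_seq us -> perp_seq e0 (lift us).
Proof.
elim: us => [//|u us IHus] /andP[/eqP u1 /IHus ps].
by rewrite perp_cons ps (frame_sqnorm fE) u1 (frame_perp fE) !eqxx.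
Qed.

Lemma frame_cancel (X Y : 'M[R]_6) : X *m E = Y *m E -> X = Y.
Proof.
have [EE _] := fE => /(congr1 (mulmx^~ E^T)).
by rewrite -!mulmxA EE !mulmx1.
Qed.

(** Extend g to R^7 by the identity on L. *)
Lemma frame_rotation (g : 'M[R]_6) : orthomx_real g ->
  exists2 us, unitary_seq us & g *m E = (-1) ^+ size us *: (E *m vec_rot (lift us)).
Proof.
move=> og; have [EE Ee] := fE.
have e0e0 : e0 *m e0^T = 1%:M by rewrite sqnormE e01.
have e0E : e0 *m E^T = 0 by rewrite -[e0]trmxK -trmx_mul Ee trmx0.
have one : E^T *m E + e0^T *m e0 = 1%:M.
  apply/row_matrixP => i; rewrite !rowE mulmxDr !mulmxA mulmx1 -frame_decomp //.
pose G := E^T *m g *m E + e0^T *m e0.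
have EG : E *m G = g *m E.
  by rewrite mulmxDr !mulmxA EE mul1mx Ee mul0mx addr0.
have e0G : e0 *m G = e0.
  by rewrite mulmxDr !mulmxA e0E !mul0mx add0r e0e0 mul1mx.
have oG : orthomx_real G.
  rewrite /orthomx_real -[RHS]one /G [G^T]raddfD /= !trmx_mul !trmxK.
  rewrite mulmxDl !mulmxDr.
  have -> : E^T *m g *m E *m (E^T *m (g^T *m E)) = E^T *m E.
    rewrite -(mulmxA (E^T *m g)) (mulmxA E) EE mul1mx -mulmxA (mulmxA g).
    by rewrite (og : g *m g^T = 1%:M) mul1mx.
  rewrite -(mulmxA (E^T *m g)) (mulmxA E) Ee mul0mx mulmx0 addr0.
  rewrite -(mulmxA e0^T) (mulmxA e0) e0E mul0mx mulmx0 add0r.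
  by rewrite -(mulmxA e0^T) (mulmxA e0) e0e0 mul1mx.
have [O OO rO] := ortho_with_row e01.
have [|s [us so ge]] := cartan_dieudonne OO oG (isT : (1 <= 7)%N).
  move=> i; rewrite ltnS leqn0 => /eqP i0.
  by rewrite (_ : i = 0) ?rO //; apply: val_inj.
have ps : perp_seq e0 s.
  by rewrite /perp_seq us; apply/allP => v vs; rewrite -rO (so v vs 0).
have [t ut sE] := perp_frame ps; exists t => //.
by rewrite -EG ge sE size_map -scalemxAr.
Qed.

Lemma spinN0N x : spinN0 L F x -> spinN0 L F (- x).
Proof.
move=> N0x; have [us [uu eu ->]] := spinN0_frame N0x.
have -> : - vec_prod (lift us) = vec_prod (lift [:: d 0, d 0 & us]).
  rewrite !vec_prod_cons mulrA clifford_unit_sqr ?(frame_sqnorm fE) ?sqnorm_basis //.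
  by rewrite mulN1r.
apply: (perp_spinN0 LF e01 e0L); last by rewrite /= size_map negbK.
by apply: lift_perp; rewrite /unitary_seq /= sqnorm_basis // eqxx.
Qed.

Lemma mulmx_congruence (X Y Z : 'M[C]_(2 + 2)) :
  (X *m Y) *m Z *m (X *m Y)^T = X *m (Y *m Z *m Y^T) *m X^T.
Proof. by rewrite trmx_mul !mulmxA. Qed.

(** In the basis given by W, U acts on the skew matrices by a rotation g, which
    is a product of reflections.  If their number is even, they define an
    element of N^0 with the same action as U, so it is U or - U.  If it were
    odd, remove the reflection in v, to be left with an element M' of SU(4);
    then A(v) conj M' would act on the complex conjugates of the skew matrices
    as U does on these matrices, up to sign, which [spinor_conj_absurd]
    excludes. *)
Lemma half_spin_surj U : U \is unitarymx -> \det U = 1 ->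
  exists2 x, spinN0 L F x & h x = U.
Proof.
move=> uU dU; pose M := W ^t* *m U *m W.
have WW := unitary_trC_mul uW; have uWt := etrans (trmxC_unitary W) uW.
have uM : M \is unitarymx := mul_unitarymx (mul_unitarymx uWt uU) uW.
have dM : \det M = 1.
  by rewrite /M !det_mulmx dU mulr1 -det_mulmx WW det1.
have UE : U = W *m M *m W ^t*.
  rewrite /M !mulmxA (unitarymxP uW) mul1mx -mulmxA (unitarymxP uW) mulmx1 //.
have [g og gE] := su4_rotation uM dM.
have [us uu] := frame_rotation og; case: (boolP (odd (size us))) => eu.
  case: us uu eu => [//|v us] /andP[/eqP v1 uu] /= eu.
  rewrite /= -signr_odd /= eu /= expr1 mulmxN scaleN1r mulmxN opprK mulmxA.
  have [M' [G [_ uM' _ -> GA]]] := model_even uu eu.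
  rewrite frame_reflection => /frame_cancel gG.
  (* P acts as U does, but on the conjugates of the skew matrices, up to
     sign. *)
  pose P := A v *m map_mx conjC M'.
  have uP : P \is unitarymx.
    by apply: mul_unitarymx (spinor_mx_unitary v1) _; rewrite conjC_unitary.
  have PA u : P *m cA u *m P^T = - (M *m A u *m M^T).
    rewrite gE gG mulmxA -spinor_mx_reflection // -GA !map_mxM /=.
    by rewrite /P trmx_mul spinor_mx_tr map_trmx !mulmxN !mulmxA.
  have uPt := etrans (trmxC_unitary P) uP.
  case: (@spinor_conj_absurd (P ^t* *m M) (mul_unitarymx uPt uM)) => u.
  rewrite mulmx_congruence -[M *m _ *m _]opprK -PA mulmxN mulNmx; congr (- _).
  by rewrite -mulmx_congruence (unitary_trC_mul uP) trmx1 mul1mx mulmx1.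
rewrite -signr_odd (negPf eu) expr0 scale1r.
have [M' [G [hM uM' _ -> GA]]] := model_even uu eu.
move=> /frame_cancel gG.
have N0x : spinN0 L F (vec_prod (lift us)).
  by apply: (perp_spinN0 LF e01 e0L); rewrite ?size_map //; apply: lift_perp.
have uMt := etrans (trmxC_unitary M') uM'.
have NA u : (M' ^t* *m M) *m A u *m (M' ^t* *m M)^T = A u.
  rewrite mulmx_congruence gE gG -GA.
  by rewrite -mulmx_congruence (unitary_trC_mul uM') trmx1 mul1mx mulmx1.
have hx : h (vec_prod (lift us)) = W *m M' *m W ^t*.
  by rewrite -hM -mulmxA (unitarymxP uW) mulmx1.
case: (spinor_commute_scalar (mul_unitarymx uMt uM) NA) => /(congr1 (mulmx M')).
  rewrite mulmxA (unitarymxP uM') mul1mx mulmx1 => MM.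
  by exists (vec_prod (lift us)); rewrite // hx UE MM.
rewrite mulmxA (unitarymxP uM') mul1mx mulmxN mulmx1 => MM.
exists (- vec_prod (lift us)); first exact: spinN0N.
by rewrite (half_spinN hh) ?even_vec_prod // hx UE MM mulmxN mulNmx.
Qed.

Let f := fvec E (d 0).

Lemma fvec0_sqr : f * f = -1.
Proof. by apply: fvec_basis_sqr fE _ _. Qed.

Lemma fvec0_conj u : f * fvec E u * f = fvec E (u *m reflection (d 0)).
Proof.
by rewrite /f /fvec clifford_reflection ?(frame_sqnorm fE) ?sqnorm_basis // frame_reflection.
Qed.

(** Conjugation by a unit vector f of F turns A(u) conj A(w) into
    A(f) conj(A(u) conj A(w)) A(f)^-1. *)
Lemma model_conj us : ~~ odd (size us) -> exists M,
  [/\ h (vec_prod (lift us)) *m W = W *m M, f * vec_prod (lift us) * - f \in Ev &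
    h (f * vec_prod (lift us) * - f) *m W = W *m (A (d 0) *m map_mx conjC M *m - cA (d 0))].
Proof.
have d1 : sqnorm (d 0) = 1 by rewrite sqnorm_basis.
have A0 : A (d 0) *m cA (d 0) = - 1%:M.
  by rewrite spinor_mx_sqr d1 rmorph1 raddfN.
have A0' : cA (d 0) *m A (d 0) = - 1%:M.
  by rewrite spinor_mx_sqr' d1 rmorph1 raddfN.
move: us; apply: even_seq_ind => [|v w us eu [M [hM cE hC]]].
  exists 1%:M; rewrite /vec_prod big_nil mulr1 mulrN fvec0_sqr opprK one_even (half_spin1 hh); split=> //.
    by rewrite mulmx1 mul1mx.
  by rewrite map_mx1 mulmx1 mulmxN A0 opprK mulmx1 mul1mx.
exists (A v *m cA w *m M).
have fE' : f * vec_prod (lift [:: v, w & us]) * - f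
    = (fvec E (v *m reflection (d 0)) * fvec E (w *m reflection (d 0)))
      * (f * vec_prod (lift us) * - f).
  rewrite -!fvec0_conj /= !vec_prod_cons -!mulrA (mulrA f f (_ * _)) fvec0_sqr mulN1r.
  by rewrite (mulrA f f (_ * _)) fvec0_sqr !mulN1r !mulrN !mulrA opprK.
split.
- rewrite /= !vec_prod_cons mulrA (half_spinM hh) ?even_vec_prod ?(fvec_even LF e0L fE) //.
  by rewrite -mulmxA hM mulmxA hW -!mulmxA.
- by rewrite fE' mul_even // (fvec_even LF e0L fE).
rewrite fE' (half_spinM hh (fvec_even LF e0L fE _ _) cE).
rewrite -[LHS]mulmxA hC [LHS]mulmxA hW -[LHS]mulmxA; congr (W *m _).
rewrite -(spinor_mx_reflection v d1) -(spinor_mx_reflection w d1) !map_mxM /= conjmxK.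
exact: sandwich_mul A0 A0'.
Qed.

(** n0 is the product of a unit vector of F and of one of L. *)
Lemma outer_line : spin n0 /\ e0 *m spin_action n0 = - e0.
Proof.
have nE : n0 = vec_prod [:: d 0 *m E; e0] by rewrite !vec_prod_cons /vec_prod big_nil mulr1.
have un : unitary_seq [:: d 0 *m E; e0].
  by rewrite /unitary_seq /= (frame_sqnorm fE) sqnorm_basis // e01 !eqxx.
split; first by exists [:: d 0 *m E; e0].
have r0 : e0 *m reflection e0 = - e0.
  rewrite /reflection mulmxBr mulmx1 -scalemxAr mulmxA sqnormE e01 mul1mx.
  by rewrite scaler_nat mulr2n opprD addrA subrr add0r.
rewrite nE spin_action_vec_prod //= mul1mx mulmxA !(mulmxN, mulNmx) r0 opprK mulNmx
  reflection_fix //.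
exact: frame_perp fE _.
Qed.

Lemma outer_spinN : spinN L n0.
Proof.
have [sn en] := outer_line; apply: (line_spinN e0L sn (c := -1)).
by rewrite scaleN1r.
Qed.

Lemma spinN_cosets g : spinN L g ->
  spinN0 L F g \/ exists2 y, spinN0 L F y & g = n0 * y.
Proof.
move=> Ng; have [c ec /eqP] := spinN_line e01 e0L Ng; have [sg _] := Ng.
rewrite sqrf_eq1 => /orP[]/eqP cE.
  by left; apply/(spinN0P LF e01 e0L); rewrite ec cE scale1r.
right; have [sn en] := outer_line; exists (n0^-1 * g); last first.
  by rewrite mulVKr // spin_unit.
apply/(spinN0P LF e01 e0L); split; first by apply: spinM => //; apply: spinV.
rewrite (spin_actionM (spinV sn) sg) mulmxA ec cE scaleN1r -en -mulmxA.
by rewrite spin_actionV // mulmx1.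
Qed.

Lemma e0_commute us : ~~ odd (size us) ->
  cv e0 * vec_prod (lift us) = vec_prod (lift us) * cv e0.
Proof.
have C u : cv e0 * fvec E u = - (fvec E u * cv e0).
  apply/eqP; rewrite -addr_eq0 clifford_vec_polar -[_ *m _]trmxK trmx_mul trmxK.
  by rewrite (frame_perp fE) mxE mxE mulr0 scale0r.
move: us; apply: even_seq_ind => [|v w us _ IHus].
  by rewrite /vec_prod big_nil mulr1 mul1r.
rewrite /= !vec_prod_cons -/(fvec E v) -/(fvec E w) (mulrA (cv e0)) C mulNr -(mulrA (fvec E v) (cv e0)).
by rewrite (mulrA (cv e0)) C mulNr mulrN opprK -!mulrA IHus.
Qed.

(** The factor e0 of n0 commutes with N^0, so only the other factor
    matters. *)
Lemma outer_conj x : spinN0 L F x -> spinN0 L F (n0 * x * n0^-1) /\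
  h (n0 * x * n0^-1)
  = W *m (A (d 0) *m map_mx conjC (model x) *m - cA (d 0)) *m W ^t*.
Proof.
move=> N0x; have [sn en] := outer_line.
split.
  have /(spinN0P LF e01 e0L)[sx ex] := N0x.
  apply/(spinN0P LF e01 e0L); split; first exact: spinM (spinM sn sx) (spinV sn).
  rewrite (spin_actionM (spinM sn sx) (spinV sn)) (spin_actionM sn sx) !mulmxA.
  have eV : e0 *m spin_action n0^-1 = - e0.
    by rewrite -{1}[e0]opprK -en mulNmx -mulmxA spin_actionV // mulmx1.
  by rewrite eV !mulNmx ex en opprK.
have [us [uu eu xE]] := spinN0_frame N0x.
have [M [hM cE hC]] := model_conj eu.
have ue : cv e0 \is a GRing.unit by apply: clifford_unit_unit.
have uf : f \is a GRing.unit.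
  by apply: clifford_unit_unit; rewrite (frame_sqnorm fE) sqnorm_basis.
have -> : n0 * x * n0^-1 = f * vec_prod (lift us) * - f.
  rewrite /n0 -/f invrM // -(clifford_unitV (v := d 0 *m E)); last first.
    by rewrite (frame_sqnorm fE) sqnorm_basis.
  by rewrite -(mulrA f) xE e0_commute // !mulrA mulrK.
rewrite /model xE -!mulmxA hM (mulmxA (W ^t*)) unitary_trC_mul // mul1mx !mulmxA.
by rewrite -[LHS]mulmx1 -(unitarymxP uW) mulmxA hC !mulmxA.
Qed.

End SpinModel.

(** * Conjugacy in N and equivalence of representations *)

(** Divide by an n-th root of the determinant. *)
Lemma special_unitary_scale (C : numClosedFieldType) n (P : 'M[C]_n.+1) :
  P \is unitarymx ->
  exists c, [/\ c != 0, c *: P \is unitarymx & \det (c *: P) = 1].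
Proof.
move=> uP.
have dP : `|\det P| = 1.
  have /(congr1 determinant) := unitarymxP uP.
  rewrite det_mulmx det1 det_map_mx det_tr -normCK => /eqP.
  by rewrite pexpr_eq1 ?normr_ge0 // => /eqP.
have dP0 : \det P != 0 by rewrite -normr_eq0 dP oner_eq0.
pose c := (n.+1.-root (\det P))^-1.
have cn : c ^+ n.+1 = (\det P)^-1 by rewrite exprVn rootCK.
have c1 : `|c| = 1.
  have : `|c| ^+ n.+1 = 1 by rewrite -normrX cn normfV dP invr1.
  by move=> /eqP; rewrite pexpr_eq1 ?normr_ge0 // => /eqP.
exists c; split.
- by rewrite -normr_eq0 c1 oner_eq0.
- apply/unitarymxP; rewrite linearZ /= map_mxZ /= -scalemxAl -scalemxAr scalerA.
  by rewrite -normCK c1 expr1n scale1r (unitarymxP uP).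
- by rewrite detZ cn mulVf.
Qed.

Lemma congruence_conjC (C : numClosedFieldType) n (W A X : 'M[C]_n) :
  W *m (A *m map_mx conjC (W ^t* *m X *m W) *m A ^t*) *m W ^t*
  = (W *m A *m W^T) *m map_mx conjC X *m (W *m A *m W^T) ^t*.
Proof.
rewrite !trmxC_mul !map_mxM /=.
have -> : map_mx conjC (W ^t*) = W^T by apply/matrixP => a b; rewrite !mxE conjCK.
have -> : W^T ^t* = map_mx conjC W by rewrite trmxK.
by rewrite !mulmxA.
Qed.

Section SpinSU4.

Variables (R : realType) (L F : 'M[R]_7).
Hypothesis LF : line_decomposition L F.
Variable h : clifford R 7 -> 'M[R[i]]_4.
Hypothesis hh : unitary_half_spin L F h.
Local Notation Cl := (clifford R 7).
Local Notation C := R[i].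
Local Notation N := (spinN L).
Local Notation N0 := (spinN0 L F).

Lemma half_spin_su4 : [/\ forall x, N0 x -> x \in even_clifford F,
  forall x, N0 x -> \det (h x) = 1,
  forall x y, N0 x -> N0 y -> h x = h y -> x = y &
  forall U, U \is unitarymx -> \det U = 1 -> exists2 x, N0 x & h x = U].
Proof.
have [e0 e01 e0L] := line_generator LF.
have [E [W [fE uW hv hW]]] := spin_model LF hh e01 e0L.
split.
- exact (spinN0_even LF hh e01 e0L fE).
- by move=> x N0x; have [G [dx _ _]] := spinN0_model LF hh e01 e0L fE uW hW N0x; exact dx.
- exact (half_spin_inj LF hh e01 e0L fE uW hW).
- exact (half_spin_surj LF hh e01 e0L fE uW hv hW).
Qed.

Lemma spinN_subgroup : [/\ forall x y, N x -> N y -> N (x * y),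
  forall x, N x -> N x^-1, forall x y, N0 x -> N0 y -> N0 (x * y),
  forall x, N0 x -> N0 x^-1 & forall x, N0 x -> N0 (- x)].
Proof.
have [e0 e01 e0L] := line_generator LF.
have [E [W [fE uW hv hW]]] := spin_model LF hh e01 e0L.
split; [exact (spinN_M e01 e0L) | exact (spinN_V e01 e0L) | | |].
- exact (spinN0M LF e01 e0L).
- exact (spinN0V LF e01 e0L).
- exact (spinN0N LF hh e01 e0L fE).
Qed.

Lemma outer_conjugation : exists n0 : Cl, [/\ N n0,
  forall g, N g -> N0 g \/ exists2 y, N0 y & g = n0 * y &
  exists2 B, B \is unitarymx & forall x, N0 x -> N0 (n0 * x * n0^-1) /\
    h (n0 * x * n0^-1) = B *m map_mx conjC (h x) *m B ^t*].
Proof.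
have [e0 e01 e0L] := line_generator LF.
have [E [W [fE uW hv hW]]] := spin_model LF hh e01 e0L.
exists (fvec E (delta_mx 0 (o6 0)) * clifford_vec e0); split.
- exact (outer_spinN e01 e0L fE).
- exact (spinN_cosets LF e01 e0L fE).
have d1 : sqnorm (delta_mx 0 (o6 0) : 'rV[R]_6) = 1 by rewrite sqnorm_basis.
pose A0 := @spinor_mx R (delta_mx 0 (o6 0)).
exists (W *m A0 *m W^T).
  by apply: mul_unitarymx (mul_unitarymx uW (spinor_mx_unitary d1)) _;
    rewrite trmx_unitary.
have A0t : A0 ^t* = - map_mx conjC A0 by rewrite spinor_mx_tr map_mxN.
move=> x N0x; have [N0' hx] := outer_conj LF hh e01 e0L fE uW hW N0x; split=> //.
apply: (etrans hx); rewrite -A0t; exact: congruence_conjC.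
Qed.

Variable Gamma : groupType.

Lemma half_spin_N0M x y : N0 x -> N0 y -> h (x * y) = h x *m h y.
Proof.
have [NE _ _ _] := half_spin_su4; move=> /NE xE /NE yE.
exact: (half_spin_mul hh).
Qed.

Lemma spinN0_unit x : N0 x -> x \is a GRing.unit.
Proof. by move=> [[sx _] _]; apply: spin_unit sx. Qed.

(** An equivalence can be rescaled to be in SU(4), hence it is h x for some x
    in N^0. *)
Lemma realize_equivalence (s : Gamma -> Cl) M (P : 'M[C]_4) :
    (forall g, N0 (s g)) -> P \is unitarymx ->
    (forall g, h (s g) *m P = P *m M g) ->
  exists2 x, N0 x & forall g, h (x * s g * x^-1) = M g.
Proof.
move=> Ns uP sP; have [_ _ _ surj] := half_spin_su4.
have [_ _ NM NV _] := spinN_subgroup.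
have [c [c0 uQ dQ]] := special_unitary_scale uP.
have [x Nx hx] := surj _ uQ dQ.
exists x^-1 => [|g]; first exact: NV.
have hVx : h x^-1 *m h x = 1%:M.
  by rewrite -half_spin_N0M ?mulVr ?spinN0_unit ?(half_spin_one hh) //; apply: NV.
have NVx := NV _ Nx; rewrite invrK (half_spin_N0M (NM _ _ NVx (Ns g)) Nx).
rewrite (half_spin_N0M NVx (Ns g)) -mulmxA hx -scalemxAr sP scalemxAl -hx mulmxA.
by rewrite hVx mul1mx.
Qed.

Lemma equivalent_conjugate (s s' : Gamma -> Cl) :
    (forall g, N0 (s g)) -> (forall g, N0 (s' g)) ->
    uequiv (fun g => h (s g)) (fun g => h (s' g)) ->
  exists2 x, N0 x & forall g, s' g = x * s g * x^-1.
Proof.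
move=> Ns Ns' [P [uP _ sP]]; have [_ _ inj _] := half_spin_su4.
have [_ _ NM NV _] := spinN_subgroup.
have [x Nx hx] := realize_equivalence Ns uP sP.
exists x => // g; apply: inj => //; exact: NM (NM _ _ Nx (Ns g)) (NV _ Nx).
Qed.

Lemma half_spin_conj_trace x y : N0 x -> N0 y ->
  \tr (h (x * y * x^-1)) = \tr (h y).
Proof.
move=> Nx Ny; have [_ _ NM NV _] := spinN_subgroup.
have Nxy := NM _ _ Nx Ny; have NxV := NV _ Nx.
rewrite (half_spin_N0M Nxy NxV) mxtrace_mulC -(half_spin_N0M NxV Nxy) mulKr //.
exact: spinN0_unit Nx.
Qed.

Lemma half_spin_urep (s : Gamma -> Cl) : group_morphism N s ->
  (forall g, N0 (s g)) -> urep (fun g => h (s g)).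
Proof.
move=> [_ s1 sM] Ns; split.
- by move=> g; exact (half_spin_unitary hh (Ns g)).
- by rewrite s1 (half_spin_one hh).
- by move=> g k; rewrite sM half_spin_N0M.
Qed.

End SpinSU4.

Theorem theorem5p8 (R : realType) (L F : 'M[R]_7)
    (LF : line_decomposition L F)
    (h : clifford R 7 -> 'M[R[i]]_4) (hh : unitary_half_spin L F h)
    (Gamma : groupType) (r r' : Gamma -> clifford R 7)
    (r_morph : group_morphism (spinN L) r)
    (r'_morph : group_morphism (spinN L) r')
    (r_N0 : forall x, spinN0 L F (r x))
    (r'_N0 : forall x, spinN0 L F (r' x))
    (rr'_elt : element_conjugate (spinN L) r r')
    (rr'_nconj : ~ group_conjugate (spinN L) r r') :
  exists f : Gamma -> 'M[R[i]]_2 * 'M[R[i]]_2,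
    group_morphism (@groupG R) f /\
    exists r1 r1' : Gamma -> clifford R 7,
      [/\ group_conjugate (spinN L) r r1,
          group_conjugate (spinN L) r' r1',
          forall x, h (r1 x) = rho (f x),
          forall x, r1' x = complex.Re (upsilon (f x)) *: r1 x
        & [/\ order2_character (fun x => upsilon (f x)),
              order2_character (fun x => detG (f x))
            & exists x, upsilon (f x) != detG (f x)]].
Proof.
have [NE det1h inj surj] := half_spin_su4 LF hh.
have [MM MV NM NV NN] := spinN_subgroup LF hh.
have [n0 [Nn0 cosets [B uB conjB]]] := outer_conjugation LF hh.
have un0 : n0 \is a GRing.unit by apply: spin_unit Nn0.1.
have tr_conj x : spinN0 L F x -> \tr (h (n0 * x * n0^-1)) = (\tr (h x))^*.
  move=> Nx; have [_ ->] := conjB x Nx.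
  rewrite mxtrace_mulC mulmxA unitary_trC_mul // mul1mx.
  by rewrite trace_map_mx.
have tr_alt g : \tr (h (r' g)) = \tr (h (r g))
    \/ \tr (h (r' g)) = (\tr (h (r g)))^*.
  have [k Nk ->] := rr'_elt g; have [N0k|[y N0y ->]] := cosets k Nk.
    by left; apply: (half_spin_conj_trace LF hh).
  right; rewrite -(half_spin_conj_trace LF hh N0y (r_N0 g)) -tr_conj.
    by rewrite invrM ?(spinN0_unit N0y) // !mulrA.
  exact: NM (NM _ _ N0y (r_N0 g)) (NV _ N0y).
have no_eq : ~ uequiv (fun g => h (r g)) (fun g => h (r' g)).
  move=> /(equivalent_conjugate LF hh r_N0 r'_N0)[x Nx xE].
  by apply: rr'_nconj; exists x => //; have [] := Nx.
have no_conj : ~ uequiv (conjrep (fun g => h (r g))) (fun g => h (r' g)).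
  move=> [P [uP uPt PE]]; pose s g := n0 * r g * n0^-1.
  have Ns g : spinN0 L F (s g) by have [] := conjB (r g) (r_N0 g).
  have se : uequiv (fun g => h (s g)) (fun g => h (r' g)).
    exists (B *m P); split; first exact: mul_unitarymx.
      by rewrite trmxC_unitary mul_unitarymx.
    move=> g; have [_ ->] := conjB (r g) (r_N0 g).
    rewrite -mulmxA (mulmxA (B ^t*)) unitary_trC_mul // mul1mx -mulmxA PE.
    by rewrite mulmxA.
  have [x Nx xE] := equivalent_conjugate LF hh Ns r'_N0 se.
  apply: rr'_nconj; exists (x * n0); first by apply: MM => //; have [] := Nx.
  by move=> g; rewrite xE invrM ?(spinN0_unit Nx) // /s !mulrA.
have [f [fG [P [uP _ rP]] [P' [uP' _ r'P]] [[uf u2 u1] df ne]]] :=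
  su4_classification (half_spin_urep LF hh r_morph r_N0)
    (half_spin_urep LF hh r'_morph r'_N0) (fun g => det1h _ (r_N0 g))
    (fun g => det1h _ (r'_N0 g)) tr_alt no_eq no_conj.
have [x Nx xE] := realize_equivalence LF hh r_N0 uP rP.
have [x' Nx' x'E] := realize_equivalence LF hh r'_N0 uP' r'P.
exists f; split=> //.
exists (fun g => x * r g * x^-1), (fun g => x' * r' g * x'^-1); split=> //.
- by exists x => //; have [] := Nx.
- by exists x' => //; have [] := Nx'.
move=> g; have N1 : spinN0 L F (x * r g * x^-1).
  exact: NM (NM _ _ Nx (r_N0 g)) (NV _ Nx).
have N1' : spinN0 L F (x' * r' g * x'^-1).
  exact: NM (NM _ _ Nx' (r'_N0 g)) (NV _ Nx').
have /eqP := u2 g; rewrite sqrf_eq1 => /orP[]/eqP ug.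
  by rewrite ug scale1r; apply: inj; rewrite // x'E xE ug scale1r.
rewrite ug /= scaleN1r; apply: inj => //; first exact: NN.
by rewrite (half_spinN hh) ?NE // x'E xE ug scaleN1r.
Qed.
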